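(* Let $\mathcal{D}(\bar A)=(\mathcal{X},\mathcal{E}_{\bar A})$ be a state digraph, let $\mathcal{F}$ be an arbitrary minimal feasible solution, $p=|\mathcal{F}|$, $\mathcal{I}=\{1,\dots,p\}$, and let $\mathcal{Z}_j$, $\mathcal{V}^s_j$, $c_j$ ($j=1,\dots,N$) be the associated sets and costs defined in the context. Consider the weighted set covering problem of minimizing $\sum_{k\in\mathcal{J}}c_k$ over $\mathcal{J}\subset\{1,\dots,N\}$ subject to $\mathcal{I}\subset\bigcup_{j\in\mathcal{J}}\mathcal{V}^s_j$, assumed to admit at least one feasible $\mathcal{J}$. Then this weighted set covering problem can be constructed with complexity $\mathcal{O}(|\mathcal{X}|^5)$. Further, a feasible but approximate solution $\mathcal{J}'$ of this weighted set covering problem can be constructed using an $\mathcal{O}(|\mathcal{X}|^3)$ complexity algorithm such that $$\mathcal{F}'=\bigcup_{j\in\mathcal{J}'}\mathcal{Z}_j\ \cup\ \mathcal{F}$$ is an $s$-robust feasible solution, and the performance ratio, i.e., the ratio between $|\mathcal{F}'|$ and the size of a minimal (minimum-cardinality) $s$-robust feasible solution containing $\mathcal{F}$, is bounded by the harmonic number $H(p)=\sum_{k=1}^{p}\frac1k$.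
   Context: Symbol $\subset$ allows equality. Structural observability. A structural matrix $\bar A\in\{0,\star\}^{n\times n}$ is a pattern: $0$ denotes a fixed zero and $\star$ an independent real parameter (any real value). For $\mathcal{J}\subset\{1,\dots,n\}$, $\mathbb{I}_n(\mathcal{J})$ consists of the rows of the $n\times n$ identity matrix indexed by $\mathcal{J}$, and $\bar{\mathbb{I}}_n(\mathcal{J})$ is its pattern. The pair $(\bar A,\bar{\mathbb{I}}_n(\mathcal{J}))$ is structurally observable if there is a real matrix $A'$ with $A'_{ij}=0$ whenever $[\bar A]_{i,j}=0$ such that the system $\dot x=A'x$, $y=\mathbb{I}_n(\mathcal{J})x$ is observable. The state digraph is $\mathcal{D}(\bar A)=(\mathcal{X},\mathcal{E}_{\bar A})$, $\mathcal{X}=\{x_1,\dots,x_n\}$, $\mathcal{E}_{\bar A}=\{(x_i,x_j):[\bar A]_{j,i}\ne0\}$. A set $\mathcal{F}=\bigcup_{j\in\mathcal{J}}\{x_j\}$ is a feasible solution if $(\bar A,\bar{\mathbb{I}}_n(\mathcal{J}))$ is structurally observable; it is a minimal feasible solution if it has the minimum cardinality among feasible solutions. A set $\mathcal{F}^s\subset\mathcal{X}$ is an $s$-robust feasible solution if for all $x\in\mathcal{F}^s$ the set $\mathcal{F}^s\setminus\{x\}$ is a feasible solution. Graph notions. A path is a directed path with distinct vertices $v_1\to\dots\to v_k$ ($k\ge1$; an isolated vertex is a degenerate path), with tip $v_k$; a cycle is a path together with an edge from its tip to its root $v_1$ (self-loops are cycles). A P&C decomposition of a digraph is a collection of vertex-disjoint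 paths and cycles (subgraphs) spanning all vertices; it is minimum if its number of paths is least possible. An SCC is a strongly connected component; a sink-SCC is an SCC with no edge from its vertices to another SCC. Decomposition of $\mathcal{F}$. A minimal feasible solution $\mathcal{F}=\{x_{\tau_1},\dots,x_{\tau_p}\}$ is written (by a known characterization) as $\mathcal{F}=\mathcal{T}\cup\mathcal{S}^\circ$, relative to a minimum P&C decomposition $\Xi$ of $\mathcal{D}(\bar A)$: $\mathcal{T}=\{x_{\tau_1},\dots,x_{\tau_m}\}$ is the set of tips of the paths in $\Xi$, and $\mathcal{S}^\circ=\{x_{\tau_{m+1}},\dots,x_{\tau_p}\}$ consists of one state variable from each sink-SCC containing no element of $\mathcal{T}$. Such a decomposition is fixed. Back-ups. For $i\le m$, the set of tip-alternatives of $x_{\tau_i}$ is $\Delta^{\mathcal{T}}_{\tau_i}=\{x\in\mathcal{X}\setminus\{x_{\tau_i}\}: (\mathcal{T}\setminus\{x_{\tau_i}\})\cup\{x\}$ is the set of tips of the paths of a minimum P&C decomposition of $\mathcal{D}(\bar A)\}$. For $x\in\Delta^{\mathcal{T}}_{\tau_i}$ the interchanged solution is $\mathcal{F}^{-x_{\tau_i}}_{x}=\big((\mathcal{T}\setminus\{x_{\tau_i}\})\cup\{x\}\big)\cup\mathcal{S}^\circ$. For $i>m$, the set of sink-alternatives is $\Delta^{\mathcal{S}}_{\tau_i}=\{x\in\mathcal{X}\setminus\{x_{\tau_i}\}: x$ belongs to the same sink-SCC as $x_{\tau_i}\}$. The set of back-ups $\Omega^i_{\mathcal{F}}$ of $x_{\tau_i}$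 is the following collection of subsets of $\mathcal{X}$: (1) for $i=1,\dots,m$: for each $\delta\in\Delta^{\mathcal{T}}_{\tau_i}$, if $\mathcal{F}^{-x_{\tau_i}}_{\delta}$ is a feasible solution then $\{\delta\}\in\Omega^i_{\mathcal{F}}$; otherwise $\{\delta,x'\}\in\Omega^i_{\mathcal{F}}$ for every $x'\neq x_{\tau_i}$ in the same SCC as $x_{\tau_i}$; and $\Omega^i_{\mathcal{F}}$ contains no other sets; (2) for $i=m+1,\dots,p$: $\Omega^i_{\mathcal{F}}=\{\{\delta\}:\delta\in\Delta^{\mathcal{S}}_{\tau_i}\}$. Covering data. Let $N=n+\binom n2$ and let $\mathcal{Z}_1,\dots,\mathcal{Z}_N$ enumerate the one- and two-element subsets of $\mathcal{X}$, with $\mathcal{Z}_j=\{x_j\}$ for $j\le n$ and $\mathcal{Z}_{n+1},\dots,\mathcal{Z}_N$ the two-element subsets. Define $\mathcal{V}^s_j=\{i\in\mathcal{I}:\mathcal{Z}_j\in\Omega^i_{\mathcal{F}}\}$ for $j=1,\dots,n$; $\mathcal{V}^s_j=\{i\in\mathcal{I}:\mathcal{Z}_j\in\Omega^i_{\mathcal{F}}\}\cup\bigcup_{x_k\in\mathcal{Z}_j}\mathcal{V}^s_k$ for $j=n+1,\dots,N$; and costs $c_j=|\mathcal{Z}_j|$ for $j=1,\dots,N$. *)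

(* Defs.v *)
From HB Require Import structures.
From mathcomp Require Import all_boot all_order all_algebra.
From mathcomp Require Import all_classical all_reals all_analysis.
Set Implicit Arguments.
Unset Strict Implicit.
Unset Printing Implicit Defensive.
Import Order.TTheory GRing.Theory Num.Theory numFieldNormedType.Exports.
Local Open Scope ring_scope.

(* A path or a cycle is given by its root and the list of the following
   vertices, so that it has at least one vertex. *)
Section Digraph.
Variables (T : finType) (e : rel T).

Definition walk : Type := (T * seq T)%type.
Definition vertices (w : walk) : seq T := w.1 :: w.2.
Definition tip (w : walk) : T := last w.1 w.2.
Definition is_path (w : walk) : bool := path e w.1 w.2 && uniq (vertices w).
Definition is_cycle (w : walk) : bool := is_path w && e (tip w) w.1.

Definition pc_decomposition (ps cs : seq walk) : bool :=
  [&& all is_path ps, all is_cycle cs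
    & perm_eq (flatten (map vertices (ps ++ cs))) (enum T)].

Definition min_pc_decomposition (ps cs : seq walk) : Prop :=
  pc_decomposition ps cs /\
  forall ps' cs', pc_decomposition ps' cs' -> (size ps <= size ps')%N.

Definition tips (ps : seq walk) : {set T} := [set x in map tip ps].

Definition is_tip_set (X : {set T}) : Prop :=
  exists ps cs, min_pc_decomposition ps cs /\ X = tips ps.

Definition scc (x : T) : {set T} := [set y | connect e x y && connect e y x].

Definition is_sink_scc (C : {set T}) : Prop :=
  (exists x, C = scc x) /\
  forall x y, x \in C -> e x y -> y \in C.

Definition one_per_uncovered_sink (Tp S : {set T}) : Prop :=
  (forall x, x \in S -> is_sink_scc (scc x) /\ [disjoint scc x & Tp]) /\
  (forall C, is_sink_scc C -> [disjoint C & Tp] -> #|C :&: S| = 1%N).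

End Digraph.

Section Observability.
Variable R : realType.

Definition trajectory (n : nat) (A : 'M[R]_n) (x : R -> 'cV[R]_n) : Prop :=
  forall (t : R) (i : 'I_n),
    is_derive t 1 (fun s => x s i 0) ((A *m x t) i 0).

(* The output on [0, +oo[ determines the initial state. *)
Definition observable (n q : nat) (A : 'M[R]_n) (C : 'M[R]_(q, n)) : Prop :=
  forall x1 x2 : R -> 'cV[R]_n, trajectory A x1 -> trajectory A x2 ->
    (forall t : R, 0 <= t -> C *m x1 t = C *m x2 t) -> x1 0 = x2 0.

Definition id_rows (n : nat) (J : {set 'I_n}) : 'M[R]_(#|J|, n) :=
  rowsub (enum_val : 'I_#|J| -> 'I_n) 1%:M.

End Observability.

Section StructuralSystem.
Variables (R : realType) (n : nat).
(* The pattern: [true] is a free parameter, [false] a fixed zero. The state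
   variable x_i is identified with its index i. *)
Variable A : 'M[bool]_n.

Definition state_digraph : rel 'I_n := fun i j => A j i.

Definition feasible (F : {set 'I_n}) : Prop :=
  exists A' : 'M[R]_n,
    (forall i j, A i j = false -> A' i j = 0) /\ observable A' (id_rows R F).

Definition min_feasible (F : {set 'I_n}) : Prop :=
  feasible F /\ forall G, feasible G -> (#|F| <= #|G|)%N.

Definition s_robust (F : {set 'I_n}) : Prop :=
  forall x, x \in F -> feasible (F :\ x).

Definition min_s_robust_containing (F G : {set 'I_n}) : Prop :=
  [/\ F \subset G, s_robust G
    & forall G' : {set 'I_n}, F \subset G' -> s_robust G' -> (#|G| <= #|G'|)%N].

(* Indices are 0-based: tau enumerates the tips first, then the
   representatives of the remaining sink-SCCs. *)
Section BackUps.
Variables (p m : nat) (tau : 'I_p -> 'I_n).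

Definition tip_part : {set 'I_n} := [set tau i | i : 'I_p & (i < m)%N].
Definition sink_part : {set 'I_n} := [set tau i | i : 'I_p & (m <= i)%N].

Definition decomposes (F : {set 'I_n}) (ps cs : seq (walk 'I_n)) : Prop :=
  [/\ injective tau, F = [set tau i | i : 'I_p], (m <= p)%N,
      min_pc_decomposition state_digraph ps cs /\ tip_part = tips ps
    & one_per_uncovered_sink state_digraph tip_part sink_part].

Definition swap_tip (i : 'I_p) (d : 'I_n) : {set 'I_n} :=
  d |: (tip_part :\ tau i).

Definition tip_alternative (i : 'I_p) (d : 'I_n) : Prop :=
  d != tau i /\ is_tip_set state_digraph (swap_tip i d).

Definition interchanged (i : 'I_p) (d : 'I_n) : {set 'I_n} :=
  swap_tip i d :|: sink_part.

Definition sink_alternative (i : 'I_p) (d : 'I_n) : Prop :=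
  [/\ d != tau i, d \in scc state_digraph (tau i)
    & is_sink_scc state_digraph (scc state_digraph (tau i))].

Definition back_up (i : 'I_p) (Y : {set 'I_n}) : Prop :=
  if (i < m)%N then
    exists d, tip_alternative i d /\
      ((feasible (interchanged i d) /\ Y = [set d]) \/
       (~ feasible (interchanged i d) /\
        exists x', [/\ x' != tau i, x' \in scc state_digraph (tau i)
                     & Y = [set d; x']]))
  else exists d, sink_alternative i d /\ Y = [set d].

Variable Z : 'I_(n + 'C(n, 2)) -> {set 'I_n}.

Definition backed_up_by (Y : {set 'I_n}) : {set 'I_p} :=
  [set i | `[< back_up i Y >]].

Definition cover_set (j : 'I_(n + 'C(n, 2))) : {set 'I_p} :=
  if (j < n)%N then backed_up_by (Z j)
  else backed_up_by (Z j) :|: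
       \bigcup_(k in Z j) backed_up_by (Z (lshift 'C(n, 2) k)).

End BackUps.

Definition enumerates_small_sets
    (Z : 'I_(n + 'C(n, 2)) -> {set 'I_n}) : Prop :=
  [/\ injective Z,
      forall Y, Y \in codom Z <-> (#|Y| = 1%N \/ #|Y| = 2%N),
      forall k : 'I_n, Z (lshift 'C(n, 2) k) = [set k]
    & forall l : 'I_('C(n, 2)), #|Z (rshift n l)| = 2%N].

End StructuralSystem.

Definition is_cover (p N : nat) (V : 'I_N -> {set 'I_p}) (J : {set 'I_N}) :
    Prop := [set: 'I_p] \subset \bigcup_(j in J) V j.

(* Complexity is measured on a uniform-cost random access machine, presented as
   a structured language whose only arithmetic is addition and truncated
   subtraction of natural numbers. The memory is split into arrays: [s a k] is
   cell k of array a. The array names occurring in a program are constants, so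
   a program uses a fixed finite number of arrays. *)
Definition store := nat -> nat -> nat.

Inductive expr : Type :=
  | Cst of nat
  | Get of nat & expr
  | Add of expr & expr
  | Sub of expr & expr.

Inductive cmd : Type :=
  | Skip
  | Put of nat & expr & expr
  | Seq of cmd & cmd
  | If of expr & cmd & cmd
  | While of expr & cmd.

Fixpoint eval (s : store) (x : expr) : nat :=
  match x with
  | Cst c => c
  | Get a y => s a (eval s y)
  | Add y z => (eval s y + eval s z)%N
  | Sub y z => (eval s y - eval s z)%N
  end.

Fixpoint expr_cost (x : expr) : nat :=
  match x with
  | Cst _ => 1
  | Get _ y => (expr_cost y).+1
  | Add y z | Sub y z => (expr_cost y + expr_cost z).+1
  end.

Definition update (s : store) (a k v : nat) : store :=
  fun b l => if (b == a) && (l == k) then v else s b l.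

(* [exec c s t s'] : c, started in s, halts in s' after t elementary steps.
   A test succeeds when its value is nonzero. *)
Inductive exec : cmd -> store -> nat -> store -> Prop :=
  | ExecSkip s : exec Skip s 1 s
  | ExecPut a x y s :
      exec (Put a x y) s (expr_cost x + expr_cost y).+1
        (update s a (eval s x) (eval s y))
  | ExecSeq c d s t s' t' s'' :
      exec c s t s' -> exec d s' t' s'' -> exec (Seq c d) s (t + t') s''
  | ExecIfTrue x c d s t s' :
      eval s x != 0%N -> exec c s t s' ->
      exec (If x c d) s (expr_cost x + t).+1 s'
  | ExecIfFalse x c d s t s' :
      eval s x = 0%N -> exec d s t s' ->
      exec (If x c d) s (expr_cost x + t).+1 s'
  | ExecWhileTrue x c s t s' t' s'' :
      eval s x != 0%N -> exec c s t s' -> exec (While x c) s' t' s'' ->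
      exec (While x c) s (expr_cost x + t + t').+1 s''
  | ExecWhileFalse x c s :
      eval s x = 0%N -> exec (While x c) s (expr_cost x).+1 s.

(* Sets and matrices are stored as 0/1 tables in row-major order; cells not
   mentioned are arbitrary. *)
Definition stores_system (s : store) (n p m : nat) (A : 'M[bool]_n)
    (tau : 'I_p -> 'I_n) (Z : 'I_(n + 'C(n, 2)) -> {set 'I_n}) : Prop :=
  [/\ [/\ s 0%N 0%N = n, s 0%N 1%N = m & s 0%N 2%N = p],
      forall i j : 'I_n, s 1%N (i * n + j)%N = A i j,
      forall i : 'I_p, s 2%N i = tau i
    & forall (j : 'I_(n + 'C(n, 2))) (k : 'I_n),
        s 3%N (j * n + k)%N = (k \in Z j)].

Definition stores_set_cover (s : store) (p N : nat) (c : 'I_N -> nat)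
    (V : 'I_N -> {set 'I_p}) : Prop :=
  [/\ s 4%N 0%N = p, s 4%N 1%N = N,
      forall j : 'I_N, s 5%N j = c j
    & forall (j : 'I_N) (i : 'I_p), s 6%N (j * p + i)%N = (i \in V j)].

Definition stores_selection (s : store) (N : nat) (J : {set 'I_N}) : Prop :=
  forall j : 'I_N, s 7%N j = (j \in J).

(* Main.v *)
Require Import Defs.
From HB Require Import structures.
From mathcomp Require Import all_boot all_order all_algebra all_fingroup.
From mathcomp Require Import all_classical all_reals all_analysis.
From mathcomp Require Import complex.
From mathcomp Require Import zify ring lra.
Set Implicit Arguments.
Unset Strict Implicit.
Unset Printing Implicit Defensive.
Import Order.TTheory GRing.Theory Num.Theory numFieldNormedType.Exports.
Import Defs.

(** Structural observability is a combinatorial property: a set Y of observed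
    states is feasible exactly when every vertex reaches Y and some permutation
    moves every vertex outside Y along an edge (feasibleP).  Necessity of the
    two conditions comes from a complex eigenvector supported on the vertices
    that do not reach Y, and from the expansion of a nonzero minor.  For
    sufficiency the permutation is cut into orbits: those meeting Y give an
    observable nilpotent system, and every other orbit is a cycle that is
    attached by one edge to what has been built, with a weight so large that
    the eigenvalues of the cycle avoid the finitely many unfavourable values.

    Tip sets of minimum decompositions are then the smallest sets for which
    such a permutation exists (is_tip_setP), and they satisfy the exchange
    property of the bases of a matroid (matched_exchange).  With this, the sets
    V_j of the covering problem take a uniform shape (cover_setE): i lies in
    V_j when Z_j contains two states d and x, possibly equal, that repair the
    loss of the i-th state of F.

    The covering problem is tabulated by a program that computes the
    reachability relation and then, for each of the at most n^2 pairs (i, d),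
    tests in time n^3 by an auction whether d may replace the i-th tip, and
    marks the sets Z_j that contain a repairing pair.  The running time is read
    off the syntax of the program (exec_code).

    A cover makes F robust because a repairing pair does (cover_robust).  For
    the performance ratio, let G be robust, contain F, and suppose p > 0; then
    G has at least p+1 elements.  If it has exactly p+1, its unique element
    outside F repairs every loss (single_extra_repairs), so a singleton Z_j
    covers everything; the selection program looks for such a perfect set
    first, and choosing it is optimal.  Otherwise G has at least p+2 elements,
    while choosing one Z_j for each i gives a robust set of at most
    p + 2p elements, and 3p <= (p+2) H(p) (harmonic_ge). *)

(** * Matchings and path-and-cycle decompositions *)

Section Matchings.
Variables (T : finType) (e : rel T).
Implicit Types (X Y : {set T}) (s : {perm T}).

(** The successor function of a decomposition whose tips lie in X, encoded as a
    permutation: only its values outside X are constrained, which avoids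
    partial injections and makes the notion monotone in X. *)
Definition matched X : Prop :=
  exists s : {perm T}, forall x, x \notin X -> e x (s x).

Lemma matched_sub X Y : X \subset Y -> matched X -> matched Y.
Proof.
move=> sXY [s sP]; exists s => x xY; apply: sP; apply: contra xY.
exact: (fintype.subsetP sXY).
Qed.

(** One point at a time: composing with a transposition corrects the value at
    a new point and, by injectivity, disturbs none of the earlier ones. *)
Lemma perm_extends_injection (f : T -> T) (D : {set T}) :
  {in D &, injective f} -> exists s, {in D, s =1 f}.
Proof.
move=> injf.
suff [s sP] : exists s, {in enum D, s =1 f}.
  by exists s => x xD; apply: sP; rewrite mem_enum.
have : {subset enum D <= D} by move=> x; rewrite mem_enum.
elim: (enum D) (enum_uniq D) => [|x l IH] /=; first by exists 1%g.
move=> /andP[xl ul] lD.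
have [s sP] := IH ul (fun y yl => lD y (mem_behead (s := x :: l) yl)).
exists (s * tperm (s x) (f x))%g => y; rewrite inE permM => /orP[/eqP ->|yl].
  by rewrite tpermL.
have nyx : y != x by apply: contraNneq xl => <-.
rewrite -(sP y yl) tpermD //.
- by rewrite (inj_eq perm_inj) eq_sym.
- rewrite (sP y yl); apply: contraNneq nyx => /injf -> //; apply: lD; rewrite inE ?eqxx //.
  by rewrite yl orbT.
Qed.

(** An alternating walk between the two permutations.  Redirecting s at t to
    r t takes this value from a vertex w, which becomes free in place of t;
    s and r then agree at one more point.  The walk ends when w is in Y, or
    when no vertex has to be freed. *)
Lemma matched_exchange X Y (t : T) :
    matched X -> matched Y -> t \in X -> t \notin Y ->
  matched (X :\ t) \/ exists2 d, d \in Y & matched (d |: X :\ t).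
Proof.
move=> [s sP] [r rP].
have [k] := ubnP #|[set x | s x != r x]|.
elim: k => // k IH in X t s sP * => /ltnSE ltk tX tY.
pose w := (s^-1)%g (r t); have sw : s w = r t by rewrite permKV.
have [wt|nwt] := eqVneq w t.
  left; exists s => x; rewrite !inE negb_and negbK => /orP[/eqP ->|/sP //].
  by rewrite -{2}wt sw rP.
pose s' := (tperm t w * s)%g.
have s't : s' t = r t by rewrite permM tpermL.
have s'D x : x != t -> x != w -> s' x = s x.
  by move=> xt xw; rewrite permM tpermD // eq_sym.
have s'P x : x \notin w |: X :\ t -> e x (s' x).
  rewrite !inE negb_or negb_and negbK => /andP[xw] /orP[/eqP ->|xX].
    by rewrite s't rP.
  by rewrite s'D ?sP //; apply: contraNneq xX => ->.
have [wX|wX] := boolP (w \in X).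
  left; exists s' => x xX; apply: s'P; apply: contra xX.
  by rewrite !inE => /orP[/eqP ->|//]; rewrite nwt.
have [wY|wY] := boolP (w \in Y); first by right; exists w => //; exists s'.
have XE : (w |: X :\ t) :\ w = X :\ t.
  by rewrite finset.setU1K // !inE negb_and wX orbT.
rewrite -XE; apply: IH s'P _ _ wY; last by rewrite !inE eqxx.
apply: leq_trans ltk; apply: proper_card; apply/properP; split.
  apply/fintype.subsetP => x; rewrite !inE; apply: contraNneq => sx.
  have [->|xt] := eqVneq x t; first by rewrite s't.
  rewrite s'D ?sx //; apply: contraNneq xt => xw; apply/eqP/(@perm_inj _ r).
  by rewrite -sx xw sw.
exists t; rewrite !inE ?s't ?eqxx //.
by rewrite -sw (inj_eq perm_inj) eq_sym.
Qed.

Implicit Types (ps cs ws : seq (walk T)).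

Definition spanned ws := flatten (map (@vertices T) ws).

Lemma spanned_cons w ws : spanned (w :: ws) = vertices w ++ spanned ws.
Proof. by []. Qed.

Lemma perm_spanned ws ws' : perm_eq ws ws' -> perm_eq (spanned ws) (spanned ws').
Proof. by move=> pw; apply/perm_flatten/perm_map. Qed.

Lemma uniq_marks (f : walk T -> T) ws :
    (forall w, f w \in vertices w) -> uniq (spanned ws) -> uniq (map f ws).
Proof.
move=> fP; elim: ws => // w ws IH.
rewrite spanned_cons cat_uniq => /and3P[_ dis /IH uws] /=; rewrite uws andbT.
have {}dis x : x \in spanned ws -> x \notin vertices w by move: x; apply/hasPn.
apply/mapP => -[w' w'ws ff]; have /dis/negP : f w \in spanned ws.
  by apply/flattenP; exists (vertices w'); rewrite ?map_f // ff.
by apply; apply: fP.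
Qed.

Lemma tip_vertices (w : walk T) : tip w \in vertices w.
Proof. exact: mem_last. Qed.

Lemma pc_decomposition_uniq ps cs :
  pc_decomposition e ps cs -> uniq (spanned (ps ++ cs)).
Proof. by case/and3P => _ _ /perm_uniq ->; rewrite enum_uniq. Qed.

Lemma card_tips ps cs : pc_decomposition e ps cs -> #|tips ps| = size ps.
Proof.
move=> /pc_decomposition_uniq; rewrite /spanned map_cat flatten_cat cat_uniq.
case/and3P => ups _ _; rewrite /tips cardsE.
by rewrite (card_uniqP (uniq_marks tip_vertices ups)) size_map.
Qed.

Lemma perm_pc_decomposition ps ps' cs :
  perm_eq ps ps' -> pc_decomposition e ps cs = pc_decomposition e ps' cs.
Proof.
move=> pp; rewrite /pc_decomposition (perm_all _ pp); congr [&& _, _ & _].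
apply: permPl; apply: perm_flatten; apply: perm_map.
by rewrite perm_cat2r.
Qed.

Lemma perm_mem_cons (U : eqType) (V : eqType) (f : U -> V) (l : seq U) y :
  y \in map f l -> exists w l', perm_eq l (w :: l') /\ f w = y.
Proof.
by case/mapP => w wl ->; exists w, (rem w l); split=> //; apply: perm_to_rem.
Qed.

(** Begin with the paths of length zero and add the edges x -> s x one by one:
    x is the tip of some path and s x the root of some path.  If the two paths
    differ they are concatenated, otherwise the path closes to a cycle.  The
    induction keeps track of the roots, which are the s-images of the tips. *)
Lemma matched_pc X :
  matched X -> exists ps cs, pc_decomposition e ps cs /\ tips ps = X.
Proof.
case=> s sP.
suff [ps [cs [dec tipsE _]]] : exists ps cs,
    [/\ pc_decomposition e ps cs, perm_eq (map (@tip T) ps) (enum X)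
      & perm_eq (map fst ps) (map s (enum X))].
  exists ps, cs; split=> //; apply/setP => x.
  by rewrite inE (perm_mem tipsE) mem_enum.
have [k] := ubnP #|~: X|; elim: k => // k IH in X sP * => /ltnSE leXk.
have [XT|/fintype.subsetPn [x _ xX]] := boolP ([set: T] \subset X).
  have {XT} -> : X = [set: T] by apply/eqP; rewrite finset.eqEsubset finset.subsetT.
  exists [seq (x, [::]) | x <- enum T], [::]; split.
  - apply/and3P; split=> //; first by apply/allP => w /mapP[y _ ->].
    rewrite cats0 -map_comp.
    by rewrite (_ : flatten _ = enum T) //; elim: (enum T) => //= a l ->.
  - by rewrite -map_comp map_id_in // enum_setT enumT.
  - rewrite -map_comp (eq_map (g := id)) // map_id.
    rewrite enum_setT -enumT; apply: uniq_perm; rewrite ?enum_uniq //.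
      by rewrite map_inj_uniq ?enum_uniq //; apply: perm_inj.
    move=> y; rewrite !mem_enum /=; apply/esym/mapP.
    by exists ((s^-1)%g y); rewrite ?mem_enum ?permKV.
have enumxX : perm_eq (enum (x |: X)) (x :: enum X).
  apply: uniq_perm; rewrite /= ?mem_enum ?xX ?enum_uniq // => y.
  by rewrite mem_enum !inE mem_enum.
case: (IH (x |: X)).
- by move=> y; rewrite !inE negb_or => /andP[_]; apply: sP.
- apply: leq_trans leXk; apply: proper_card; apply/properP; split.
    by rewrite finset.setCS finset.subsetUr.
  by exists x; rewrite !inE ?eqxx.
move=> ps [cs [dec tipsE rootsE]].
have : x \in map (@tip T) ps by rewrite (perm_mem tipsE) mem_enum setU11.
case/perm_mem_cons => w1 [ps1 [psE tw1]].
rewrite (perm_pc_decomposition _ psE) in dec.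
have {tipsE} tipsE : perm_eq (map (@tip T) ps1) (enum X).
  rewrite -(perm_cons x) -{1}tw1 -(permPr enumxX).
  by rewrite -(permPr tipsE) perm_sym (perm_map (@tip T) psE).
have {rootsE} rootsE : perm_eq (w1.1 :: map fst ps1) (s x :: map s (enum X)).
  have := perm_map s enumxX; rewrite /= => /permPr <-.
  by rewrite -(permPr rootsE) perm_sym (perm_map fst psE).
have ew1 : e (tip w1) (s x) by rewrite tw1 sP.
have uniqs := pc_decomposition_uniq dec.
move: dec => /and3P[/= /andP[pw1 pps1] ccs span].
have [rw1|rw1] := eqVneq w1.1 (s x).
  exists ps1, (w1 :: cs); split=> //; last first.
    by rewrite rw1 perm_cons in rootsE.
  apply/and3P; split=> //; first by rewrite /= /is_cycle pw1 rw1 ew1 ccs.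
  apply: perm_trans span.
  apply: (@perm_spanned (ps1 ++ w1 :: cs) (w1 :: ps1 ++ cs)).
  by rewrite (perm_catCA ps1 [:: w1] cs).
have : s x \in map fst ps1.
  by have := perm_mem rootsE (s x); rewrite !inE eqxx eq_sym (negPf rw1).
case/perm_mem_cons => w2 [ps2 [ps1E rw2]].
have E : perm_eq (spanned ((w1.1, w1.2 ++ vertices w2) :: ps2 ++ cs))
                 (spanned (w1 :: ps1 ++ cs)).
  rewrite /spanned /= -/(vertices w1).
  have -> : w1.1 :: ((w1.1, w1.2 ++ vertices w2).2 ++
     flatten [seq vertices i | i <- ps2 ++ cs]) =
     vertices w1 ++ (vertices w2 ++ flatten [seq vertices i | i <- ps2 ++ cs]).
    by rewrite /= -catA.
  rewrite perm_cat2l perm_sym.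
  apply: (@perm_spanned (ps1 ++ cs) (w2 :: ps2 ++ cs)).
  by rewrite -cat_cons perm_cat2r.
exists ((w1.1, w1.2 ++ vertices w2) :: ps2), cs; split.
- apply/and3P; split=> //; last exact: perm_trans E span.
  have [pw2 pps2] : is_path e w2 /\ all (is_path e) ps2.
    by move: pps1; rewrite (perm_all _ ps1E) => /andP.
  have ew12 : e (tip w1) w2.1 by rewrite rw2.
  rewrite [all _ _]/= pps2 andbT /is_path /= cat_path /= -/(tip w1) ew12.
  move: pw1 pw2 => /andP[-> _] /andP[-> _] /=.
  move: uniqs; rewrite -(perm_uniq E) spanned_cons cat_uniq.
  by case/andP.
- rewrite -(permPr tipsE) perm_sym (permPl (perm_map _ ps1E)) /=.
  by rewrite /tip /= last_cat.
- rewrite -(perm_cons (s x)); apply: perm_trans rootsE; rewrite /=.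
  have E2 : perm_eq [:: s x, w1.1 & map fst ps2] [:: w1.1, s x & map fst ps2].
    by rewrite (perm_catCA [:: s x] [:: w1.1]).
  by rewrite (permPl E2) perm_cons perm_sym (permPl (perm_map _ ps1E)) /= rw2.
Qed.

(** The permutation sends a vertex to the next one of its own path or cycle, a
    path being closed up by mapping its tip to its root. *)
Lemma pc_matched ps cs : pc_decomposition e ps cs -> matched (tips ps).
Proof.
move=> dec; have uniqs := pc_decomposition_uniq dec.
case/and3P: dec => /allP pps /allP ccs /perm_mem span.
have ex x : {w | w \in ps ++ cs & x \in vertices w}.
  apply: sig2W.
  have : x \in spanned (ps ++ cs) by rewrite span mem_enum.
  by case/flattenP => v /mapP[w ww ->] xw; exists w.
pose comp x := s2val (ex x).
have compP x : comp x \in ps ++ cs by rewrite /comp; case: (ex x).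
have compV x : x \in vertices (comp x) by rewrite /comp; case: (ex x).
have ucomp w : w \in ps ++ cs -> uniq (vertices w).
  by rewrite mem_cat => /orP[/pps|/ccs/andP[]] /andP[].
have comp_uniq w w' x : w \in ps ++ cs -> w' \in ps ++ cs ->
    x \in vertices w -> x \in vertices w' -> w = w'.
  elim: (ps ++ cs) uniqs => // v l IH.
  rewrite spanned_cons cat_uniq => /and3P[_ dis ul]; rewrite !inE.
  have {}dis y : y \in spanned l -> y \notin vertices v by move: y; apply/hasPn.
  move=> /orP[/eqP ->|wl] /orP[/eqP ->|wl'] xw xw' //; last exact: IH.
    have /dis/negP[] : x \in spanned l; last by [].
      by apply/flattenP; exists (vertices w') => //; apply: map_f.
  have /dis/negP[] : x \in spanned l; last by [].
    by apply/flattenP; exists (vertices w) => //; apply: map_f.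
pose f x := next (vertices (comp x)) x.
have fV x : f x \in vertices (comp x) by rewrite mem_next.
have [s sP] : exists s, {in [set: T], s =1 f}.
  apply: perm_extends_injection => x y _ _ fxy.
  have cxy : comp x = comp y.
    by apply: comp_uniq (compP x) (compP y) (fV x) _; rewrite fxy.
  move: fxy; rewrite /f cxy => /(congr1 (prev (vertices (comp y)))).
  by rewrite !prev_next // ucomp.
exists s => x xps; rewrite sP ?inE // /f.
have cyc : path.cycle e (vertices (comp x)) -> e x (f x).
  by move=> c; apply: (next_cycle c (compV x)).
have := compP x; rewrite mem_cat => /orP[cps|ccs']; last first.
  apply: cyc; have /andP[/andP[p _] l] := ccs _ ccs'.
  by rewrite /vertices /= rcons_path p.
have /andP[p u] := pps _ cps; rewrite next_nth compV.
have nt : x != tip (comp x).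
  by apply: contraNneq xps => ->; rewrite inE map_f.
rewrite /vertices.
have xi : (index x (vertices (comp x)) < size (comp x).2)%N.
  have := compV x; rewrite -index_mem [size _]/= ltnS leq_eqVlt => /orP[/eqP E|//].
  case/eqP: nt; rewrite -[LHS](nth_index (comp x).1 (compV x)) E.
  by rewrite /tip (last_nth (comp x).1).
have := pathP (comp x).1 p _ xi.
by rewrite -/(vertices _) nth_index //= (set_nth_default x).
Qed.

(** The number of paths is the number of tips, so minimality of a decomposition
    becomes minimality of the cardinal among matched sets. *)
Lemma is_tip_setP X :
  is_tip_set e X <->
  matched X /\ forall Y, matched Y -> (#|X| <= #|Y|)%N.
Proof.
split=> [[ps [cs [[dec min] ->]]]|[/matched_pc [ps [cs [dec <-]]] min]].
  split=> [|Y /matched_pc [ps' [cs' [dec' <-]]]]; first exact: pc_matched dec.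
  by rewrite (card_tips dec) (card_tips dec') (min _ _ dec').
exists ps, cs; split=> //; split=> // ps' cs' dec'.
rewrite -(card_tips dec) -(card_tips dec').
exact: min (pc_matched dec').
Qed.

End Matchings.

(** * Eigenvectors, kernels and adjugates *)

Section LinearAlgebra.
Local Open Scope ring_scope.

(** By Cayley-Hamilton a product of factors A - l kills x; the first factor in
    the product that kills the vector reached so far exhibits an eigenvector,
    and every vector on the way still satisfies U. *)
Lemma eigenvector_in (F : closedFieldType) (n : nat) (A : 'M[F]_n)
    (U : 'cV[F]_n -> Prop) (x : 'cV[F]_n) :
    (forall l z, U z -> U (A *m z - l *: z)) -> U x -> x != 0 ->
  exists l z, [/\ U z, z != 0 & A *m z = l *: z].
Proof.
case: n A U x => [|n] A U x UA; first by rewrite (flatmx0 x) eqxx.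
have [s chiE] := closed_field_poly_normal (char_poly A).
have := Cayley_Hamilton A.
rewrite chiE (monicP (char_poly_monic A)) scale1r rmorph_prod /=.
rewrite (eq_bigr (fun z => A - z%:M)); last first.
  by move=> z _; rewrite rmorphB /= horner_mx_X horner_mx_C.
move=> CH; have {CH chiE} : (\prod_(z <- s) (A - z%:M)) *m x = 0.
  by rewrite CH mul0mx.
elim/last_ind: s x => [|s l IH] x; first by rewrite big_nil mul1mx => ->; rewrite eqxx.
rewrite -cats1 big_cat big_seq1 /= -mulmxA mulmxBl mul_scalar_mx => sx0 Ux x0.
have [yz|ynz] := eqVneq (A *m x - l *: x) 0; last exact: IH sx0 (UA _ _ Ux) ynz.
by exists l, x; split=> //; apply/eqP; rewrite -subr_eq0 yz.
Qed.

(** Stack M on the coordinate forms of Y.  The resulting matrix has full column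
    rank, hence an invertible square submatrix, and a nonzero term of its
    determinant assigns to each column outside Y its own row of M. *)
Lemma trivial_kernel_perm (F : fieldType) (n : nat) (M : 'M[F]_n)
    (Y : {set 'I_n}) :
    (forall x : 'cV[F]_n, M *m x = 0 -> (forall y, y \in Y -> x y 0 = 0) ->
      x = 0) ->
  exists s : {perm 'I_n}, forall j, j \notin Y -> M (s j) j != 0.
Proof.
move=> ker0.
(* The rows of D outside Y are zero, and a row of D is nonzero only in its own
   column: a column outside Y must therefore select a row of M. *)
pose D : 'M[F]_n := \matrix_(i, j) ((i == j) && (j \in Y))%:R.
pose B := col_mx M D.
have Bfull : row_full B.
  rewrite /row_full -mxrank_tr -[_ == n]/(row_free B^T) -kermx_eq0.
  apply/eqP/row_matrixP => i; rewrite row0.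
  have /(congr1 trmx) : row i (kermx B^T) *m B^T = 0.
    by apply/sub_kermxP; apply: row_sub.
  rewrite trmx_mul trmxK trmx0 => /eqP.
  rewrite mul_col_mx col_mx_eq0 => /andP[/eqP Mx0 /eqP Dx0].
  apply/trmx_inj; rewrite trmx0; apply: ker0 Mx0 _ => y yY.
  have /matrixP/(_ y 0) := Dx0; rewrite mxE (bigD1 y) //= big1 => [|j jy].
    by rewrite !mxE eqxx yY mul1r addr0.
  by rewrite !mxE eq_sym (negPf jy) mul0r.
pose f := fullrankfun Bfull.
have : \det (rowsub f B) != 0.
  by rewrite -unitfE; have := fullrowsub_unit Bfull; rewrite unitmxE.
have [/existsP[s /forallP sP] _|/existsPn nos] :=
  boolP [exists s : {perm 'I_n}, forall i, B (f i) (s i) != 0]; last first.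
  rewrite /determinant big1 ?eqxx // => s _.
  have /fintype.forallPn := nos s; case=> i; rewrite negbK => /eqP Bi0.
  by rewrite (bigD1 i) //= [mxsub _ _ _ _ _]mxE Bi0 mul0r mulr0.
pose h j := f ((s^-1)%g j).
have hP j : B (h j) j != 0 by have := sP ((s^-1)%g j); rewrite permKV.
pose g j := match fintype.split (h j) with inl i => i | inr i => i end.
have hE j : j \notin Y -> h j = lshift n (g j).
  move=> jY; rewrite /g; have := hP j; rewrite /B mxE.
  case: fintype.splitP => [i E _|i E]; first exact: val_inj.
  by rewrite mxE (negPf jY) andbF eqxx.
have [r rP] : exists r : {perm 'I_n}, {in ~: Y, r =1 g}.
  apply: perm_extends_injection => i j; rewrite !inE => iY jY gij.
  have : h i = h j by rewrite (hE _ iY) (hE _ jY) gij.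
  by move/(@fullrankfun_inj _ _ _ _ Bfull)/perm_inj.
exists r => j jY; rewrite rP ?inE //.
by have := hP j; rewrite (hE _ jY) col_mxEu.
Qed.

Section Transfer.
Variables (F : closedFieldType) (n : nat) (M : 'M[F]_n) (V Y : {set 'I_n}).
Hypothesis supp_M : forall i j, M i j != 0 -> i \in V.
Hypothesis no_hidden_mode : forall l (x : 'cV[F]_n),
  (forall i, i \notin V -> x i 0 = 0) -> M *m x = l *: x ->
  (forall y, y \in Y -> x y 0 = 0) -> x = 0.

Lemma char_poly_mxE (v : 'cV[{poly F}]_n) i :
  (char_poly_mx M *m v) i 0 = 'X * v i 0 - \sum_j (M i j)%:P * v j 0.
Proof.
rewrite /char_poly_mx mulmxBl mul_scalar_mx !mxE; congr (_ - _).
by apply: eq_bigr => j _; rewrite mxE.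
Qed.

(** Induction on the number of factors.  At a root z the value v(z) is an
    eigenvector invisible on Y, hence zero, so v is divisible by X - z and the
    factor cancels.  Without factors left, the degree of X v exceeds that of
    a constant right-hand side. *)
Lemma hidden_polynomial_vector (s : seq F) (v : 'cV[{poly F}]_n) w :
    w \in V -> (forall y, y \in Y -> v y 0 = 0) ->
  char_poly_mx M *m v != (\prod_(z <- s) ('X - z%:P)) *: delta_mx w 0.
Proof.
move=> wV; elim: s v => [|z s IH] v vY; apply/eqP => /matrixP vE.
  rewrite big_nil scale1r in vE.
  have row i : 'X * v i 0 - \sum_j (M i j)%:P * v j 0 = (i == w)%:R.
    by rewrite -char_poly_mxE vE !mxE eqxx andbT.
  pose sz i := size (v i 0).
  pose i0 := [arg max_(i > w) sz i]%N.
  have max_i0 i : (sz i <= sz i0)%N.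
    by rewrite /i0; case: arg_maxnP => // k _ /(_ i isT).
  have [v0|vnz] := eqVneq (v i0 0) 0.
    have v0i i : v i 0 = 0.
      by apply/eqP; rewrite -size_poly_eq0 -leqn0 (leq_trans (max_i0 i)) // /sz v0 size_poly0.
    have := row w; rewrite v0i mulr0 big1 => [|j _]; last by rewrite v0i mulr0.
    by rewrite subrr eqxx => /esym/eqP; rewrite oner_eq0.
  have := congr1 (coefp (size (v i0 0))) (row i0).
  rewrite /= coefB coefXM size_poly_eq0 (negPf vnz) coef_sum big1 => [|j _].
    rewrite subr0 -lead_coefE -polyC_natr.
    rewrite coefC size_poly_eq0 (negPf vnz) => /eqP.
    by rewrite lead_coef_eq0 (negPf vnz).
  by rewrite coefCM nth_default ?mulr0 //; apply: max_i0.
have row i : 'X * v i 0 - \sum_j (M i j)%:P * v j 0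
    = (i == w)%:R * (('X - z%:P) * \prod_(z <- s) ('X - z%:P)).
  by rewrite -char_poly_mxE vE !mxE eqxx andbT big_cons mulrC.
pose x : 'cV[F]_n := \col_i (v i 0).[z].
have x0 : x = 0.
  apply: (@no_hidden_mode z) => [i iV||y yY]; last by rewrite mxE vY // horner0.
    have := row i; rewrite big1 => [|j _]; last first.
      suff /eqP -> : M i j == 0 by rewrite mul0r.
      by apply: contraNT iV => /supp_M.
    have -> : (i == w) = false by apply: contraNF iV => /eqP ->.
    rewrite mul0r subr0 => /eqP; rewrite mulf_eq0 polyX_eq0 /= => /eqP v0.
    by rewrite mxE v0 horner0.
  apply/matrixP => i k; rewrite ord1 !mxE; apply/esym/eqP.
  have := congr1 (horner_eval z) (row i); rewrite /= /horner_eval.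
  rewrite hornerD hornerN !hornerM hornerXsubC hornerX subrr mul0r mulr0.
  move=> /eqP; rewrite subr_eq0 => /eqP ->.
  rewrite horner_sum; apply/eqP; apply: eq_bigr => j _.
  by rewrite !hornerE mxE.
have vz i : {q | v i 0 = q * ('X - z%:P)}.
  apply: sig_eqW; apply/factor_theorem/rootP.
  by have /matrixP/(_ i 0) := x0; rewrite !mxE.
have [v' v'E] : exists v' : 'cV[{poly F}]_n, forall i, v i 0 = v' i 0 * ('X - z%:P).
  by exists (\col_i sval (vz i)) => i; rewrite mxE; case: (vz i).
have Xz0 : 'X - z%:P != 0 :> {poly F} by rewrite polyXsubC_eq0.
have v'Y y : y \in Y -> v' y 0 = 0.
  by move=> /vY /eqP; rewrite v'E mulf_eq0 (negPf Xz0) orbF => /eqP.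
case/eqP: (IH v' v'Y); apply/matrixP => i k; rewrite ord1 char_poly_mxE.
rewrite !mxE eqxx andbT; apply: (mulIf Xz0).
transitivity ('X * v i 0 - \sum_j (M i j)%:P * v j 0).
  rewrite mulrBl mulr_suml v'E mulrA; congr (_ - _).
  by apply: eq_bigr => j _; rewrite v'E mulrA.
by rewrite row mulrCA mulrC [X in X * _]mulrC.
Qed.

(** Column w of the adjugate is a vector v with (X - M) v = char_poly M e_w.
    Up to the factor char_poly M its entry y is the transfer function from an
    input at w to the output y. *)
Lemma observed_transfer w :
  w \in V -> exists2 y, y \in Y & \adj (char_poly_mx M) y w != 0.
Proof.
move=> wV; apply/exists_inP/existsPn => /= adj0.
have [s chiE] := closed_field_poly_normal (char_poly M).
rewrite (monicP (char_poly_monic M)) scale1r in chiE.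
pose v := col w (\adj (char_poly_mx M)).
have vY y : y \in Y -> v y 0 = 0.
  by move=> yY; have := adj0 y; rewrite yY /= negbK => /eqP <-; rewrite mxE.
case/eqP: (hidden_polynomial_vector s wV vY).
by rewrite -chiE /v colE mulmxA mul_mx_adj mul_scalar_mx.
Qed.

End Transfer.

End LinearAlgebra.

(** * Observability and hidden modes *)

Section Hautus.
Local Open Scope ring_scope.
Variables (R : realType) (n : nat).
Local Notation toC := (map_mx (real_complex R)).

(** The Popov-Belevitch-Hautus test over the complex numbers: no eigenvector of
    A is invisible on Y. *)
Definition hautus (A : 'M[R]_n) (Y : {set 'I_n}) : Prop :=
  forall l (x : 'cV[R[i]]_n), toC A *m x = l *: x ->
    (forall y, y \in Y -> x y 0 = 0) -> x = 0.

Lemma output_id_rows (Y : {set 'I_n}) (x : 'cV[R]_n) y (yY : y \in Y) :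
  (id_rows R Y *m x) (enum_rank_in yY y) 0 = x y 0.
Proof.
by rewrite /id_rows mul_rowsub_mx mul1mx mxE enum_rankK_in.
Qed.

(** Outputs are compared at nonnegative times only, so at t = 0 the derivative
    has to be recovered from the right. *)
Lemma right_derivative_zero (f : R -> R) (t l : R) :
  0 <= t -> (forall s, 0 <= s -> f s = 0) -> is_derive t 1 f l -> l = 0.
Proof.
move=> t0 f0 [df dl].
have /cvg_dnbhs_at_right := df.
rewrite -/(derive f t 1) dl => cvl.
have cv0 : (h^-1 *: ((f \o shift t) (h *: 1) - f t) @[h --> 0^'+] --> (0 : R))%classic.
  apply: cvg_near_cst; near=> h; have h0 : 0 < h by near: h; exact: nbhs_right_gt.
  rewrite /= !f0 ?subrr ?scaler0 // addr_ge0 //.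
  by rewrite /GRing.scale /= mulr1 ltW.
by apply: (cvg_unique _ cvl cv0).
Unshelve. all: by end_near.
Qed.

Lemma derive_mulmx_entry (A : 'M[R]_n) (x : R -> 'cV[R]_n) (dx : 'cV[R]_n) (t : R) :
    (forall i, is_derive t 1 (fun s => x s i 0) (dx i 0)) ->
  forall i, is_derive t 1 (fun s => (A *m x s) i 0) ((A *m dx) i 0).
Proof.
move=> xD i; rewrite mxE.
have -> : (fun s => (A *m x s) i 0) = \sum_(j < n) (A i j \*: (fun s => x s j 0)).
  by apply/funext => s; rewrite mxE fct_sumE.
apply: is_derive_sum => j; apply: is_deriveZ; exact: xD.
Qed.

(** Differentiating the vanishing output repeatedly shows that A^k d(0) is
    invisible on Y for all k, where d is the difference of the trajectories.
    If d(0) were nonzero, the A-stable space of such vectors would contain an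
    eigenvector. *)
Lemma hautus_observable (A : 'M[R]_n) (Y : {set 'I_n}) :
  hautus A Y -> observable A (id_rows R Y).
Proof.
move=> hA x1 x2 tr1 tr2 out.
pose d t := x1 t - x2 t.
have dD k (t : R) i : is_derive t 1 (fun s => iter k (mulmx A) (d s) i 0)
    (iter k.+1 (mulmx A) (d t) i 0).
  elim: k i => [|k IH] i; last exact: derive_mulmx_entry.
  rewrite /= /d mulmxBr.
  have -> : (fun s => (x1 s - x2 s) i 0) = (fun s => x1 s i 0) - (fun s => x2 s i 0).
    by apply/funext => s; rewrite !mxE.
  have -> : (A *m x1 t - A *m x2 t) i 0 = (A *m x1 t) i 0 - (A *m x2 t) i 0.
    by rewrite mxE [X in _ + X]mxE.
  exact: is_deriveB.
have d0 k t y : y \in Y -> 0 <= t -> iter k (mulmx A) (d t) y 0 = 0.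
  move=> yY; elim: k t => [|k IH] t t0.
    have /matrixP/(_ (enum_rank_in yY y) 0) := out t t0.
    by rewrite !output_id_rows /= !mxE => ->; rewrite subrr.
  exact: right_derivative_zero t0 IH (dD k t y).
apply/eqP; rewrite -subr_eq0 -/(d 0); apply/negPn/negP => d00.
pose U (z : 'cV[R[i]]_n) :=
  forall k y, y \in Y -> iter k (mulmx (toC A)) z y 0 = 0.
have iterB k l z : iter k (mulmx (toC A)) (toC A *m z - l *: z) =
    iter k.+1 (mulmx (toC A)) z - l *: iter k (mulmx (toC A)) z.
  by elim: k => //= k ->; rewrite mulmxBr -scalemxAr.
have iter_map k z : iter k (mulmx (toC A)) (toC z) = toC (iter k (mulmx A) z).
  by elim: k => //= k ->; rewrite map_mxM.
have [|||l [z [Uz /negP z0 Az]]] := @eigenvector_in R[i] n (toC A) U (toC (d 0)).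
- by move=> l z Uz k y yY; rewrite iterB mxE [X in _ + X]mxE [X in _ - X]mxE !Uz // mulr0 subr0.
- by move=> k y yY; rewrite iter_map mxE d0.
- by apply: contra d00 => /eqP/matrixP dz; apply/eqP/matrixP => i j;
    have := dz i j; rewrite !mxE => /complexI.
by apply: z0; apply/eqP; apply: hA Az _ => y; apply: (Uz 0%N).
Qed.

(** The real part of exp (l t) (u + i w), where l = a + i b and u + i w is an
    eigenvector for l. *)
Lemma eigenmode_trajectory (A : 'M[R]_n) (a b : R) (u w : 'cV[R]_n) :
    A *m u = a *: u - b *: w -> A *m w = b *: u + a *: w ->
  trajectory A (fun t => (expR (a * t) * cos (b * t)) *: u -
                         (expR (a * t) * sin (b * t)) *: w).
Proof.
move=> Au Aw t i.
have der (f df : R -> R) (c : R) : (forall s : R, is_derive s 1 f (df s)) ->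
    is_derive t 1 (fun s => f (c * s)) (df (c * t) * c).
  move=> fD.
  have cD : is_derive t (1 : R) ( *%R c) c.
    have -> : ( *%R c) = c \*: (@id R) by [].
    by apply: is_derive_eq; rewrite /GRing.scale /= mulr1.
  exact: (is_derive1_comp (fD _) cD).
have eD := der expR expR a (fun s => is_derive_expR s).
have cD := der cos (fun s => - sin s) b (fun s => is_derive_cos s).
have sD := der sin cos b (fun s => is_derive_sin s).
have -> : (fun s => ((expR (a * s) * cos (b * s)) *: u -
                     (expR (a * s) * sin (b * s)) *: w) i 0) =
  u i 0 \*: ((fun s => expR (a * s)) * (fun s => cos (b * s))) -
  w i 0 \*: ((fun s => expR (a * s)) * (fun s => sin (b * s))).
  by apply/funext => s; rewrite !mxE ![_ * u i 0]mulrC ![_ * w i 0]mulrC.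
apply: (is_derive_eq (is_deriveB (is_deriveZ (u i 0) (is_deriveM eD cD))
                                 (is_deriveZ (w i 0) (is_deriveM eD sD)))).
rewrite mulmxBr -!scalemxAr Au Aw !mxE /GRing.scale /=.
ring.
Qed.

(** An eigenvector invisible on Y yields a trajectory with zero output; it
    starts at the real part u, so u = 0.  Multiplying the eigenvector by -i
    treats the imaginary part in the same way. *)
Lemma observable_hautus (A : 'M[R]_n) (Y : {set 'I_n}) :
  observable A (id_rows R Y) -> hautus A Y.
Proof.
move=> obs l x Ax xY.
have real_mode a b (u w : 'cV[R]_n) : A *m u = a *: u - b *: w ->
    A *m w = b *: u + a *: w -> (forall y, y \in Y -> u y 0 = 0) ->
    (forall y, y \in Y -> w y 0 = 0) -> u = 0.
  move=> Au Aw uY wY.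
  have := obs _ (fun=> 0) (eigenmode_trajectory Au Aw).
  rewrite !mulr0 expR0 cos0 sin0 !mul1r scale1r scale0r subr0; apply.
    move=> t i; rewrite mulmx0 mxE.
    exact: is_derive_cst.
  move=> t _; apply/matrixP => i j; rewrite mulmx0 /id_rows mul_rowsub_mx mul1mx.
  by rewrite ord1 !mxE uY ?enum_valP // wY ?enum_valP // !mulr0 subr0.
pose u := map_mx (@complex.Re R) x; pose w := map_mx (@complex.Im R) x.
have xE i : x i 0 = Complex (u i 0) (w i 0) by rewrite !mxE; case: (x i 0).
have lE : l = Complex (complex.Re l) (complex.Im l) by case: (l).
have row i : (A *m u) i 0 = (complex.Re l *: u - complex.Im l *: w) i 0 /\
    (A *m w) i 0 = (complex.Im l *: u + complex.Re l *: w) i 0.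
  have /matrixP/(_ i 0) := Ax; rewrite !mxE xE.
  have -> : \sum_j toC A i j * x j 0 =
      Complex (\sum_j A i j * u j 0) (\sum_j A i j * w j 0).
    elim/big_rec3: _ => // j p q r _ ->.
    rewrite xE mxE /= /real_complex_def; simpc; congr Complex; ring.
  rewrite [X in _ = X * _ -> _]lE => -[ulE wlE].
  by rewrite ulE wlE; split=> //=; rewrite addrC.
have Au : A *m u = complex.Re l *: u - complex.Im l *: w.
  by apply/matrixP => i j; rewrite ord1; case: (row i).
have Aw : A *m w = complex.Im l *: u + complex.Re l *: w.
  by apply/matrixP => i j; rewrite ord1; case: (row i).
have uY y : y \in Y -> u y 0 = 0 by move=> /xY; rewrite mxE => ->.
have wY y : y \in Y -> w y 0 = 0 by move=> /xY; rewrite mxE => ->.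
have u0 := real_mode _ _ _ _ Au Aw uY wY.
have w0 : w = 0.
  apply: (real_mode (complex.Re l) (complex.Im l) w (- u)) => //.
  - by rewrite scalerN opprK addrC.
  - by rewrite mulmxN Au opprB scalerN addrC.
  - by move=> y /uY; rewrite [(- u) _ _]mxE => ->; rewrite oppr0.
by apply/matrixP => i j; rewrite ord1 xE u0 w0 !mxE.
Qed.

End Hautus.

(** * Structural observability *)

Definition reaches (T : finType) (e : rel T) (Y : {set T}) : Prop :=
  forall v, exists2 y, y \in Y & connect e v y.

Lemma porbit_image (T : finType) (s : {perm T}) x : porbit s (s x) = porbit s x.
Proof. by have := porbit_perm s 1 x; rewrite expg1. Qed.

Section StructuralObservability.
Local Open Scope ring_scope.
Variables (R : realType) (n : nat) (A : 'M[bool]_n).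
Local Notation toC := (map_mx (real_complex R)).
Local Notation e := (state_digraph A).

Definition realization (A' : 'M[R]_n) : Prop :=
  forall i j, A i j = false -> A' i j = 0.

(** The vectors supported on the vertices reachable from v form an invariant
    space, so it contains an eigenvector; were Y unreachable from v, this
    eigenvector would be invisible on Y. *)
Lemma hautus_reaches (A' : 'M[R]_n) (Y : {set 'I_n}) :
  realization A' -> hautus A' Y -> reaches e Y.
Proof.
move=> rA' hA' v; apply/exists_inP/existsPn => /= noY.
pose U (z : 'cV[R[i]]_n) := forall i, ~~ connect e v i -> z i 0 = 0.
have [|||l [z [Uz /negP z0 Az]]] := @eigenvector_in R[i] n (toC A') U (delta_mx v 0).
- move=> l z Uz i vi; rewrite mxE [X in _ + X]mxE [X in _ - X]mxE Uz // mulr0 subr0.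
  rewrite mxE big1 // => j _; rewrite mxE.
  have [vj|vj] := boolP (connect e v j); last by rewrite Uz ?mulr0.
  rewrite rA' ?mul0r //; apply: contraNF vi => Aij.
  exact: connect_trans vj (connect1 _).
- by move=> i; rewrite mxE; have [->|//] := eqVneq i v; rewrite connect0.
- apply/eqP => /matrixP/(_ v 0); rewrite !mxE !eqxx /= => /eqP.
  by rewrite oner_eq0.
apply: z0; apply/eqP; apply: hA' Az _ => y yY; apply: Uz.
by have := noY y; rewrite yY.
Qed.

(** The test at the eigenvalue 0 says that no kernel vector vanishes on Y. *)
Lemma hautus_matched (A' : 'M[R]_n) (Y : {set 'I_n}) :
  realization A' -> hautus A' Y -> matched e Y.
Proof.
move=> rA' hA'; have [|s sP] := @trivial_kernel_perm R[i] n (toC A') Y.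
  by move=> x Ax; apply: (hA' 0); rewrite Ax scale0r.
exists s => x /sP; rewrite mxE; apply: contraNT => /negbTE/rA' ->.
by rewrite rmorph0.
Qed.

(** The state of the construction: a realization that only uses the vertices of
    V and passes the Hautus test for vectors supported on V. *)
Definition observable_part (Y V : {set 'I_n}) : Prop :=
  exists A' : 'M[R]_n,
    [/\ realization A', forall i j, A' i j != 0 -> (i \in V) && (j \in V)
      & forall l (x : 'cV[R[i]]_n), (forall i, i \notin V -> x i 0 = 0) ->
          toC A' *m x = l *: x -> (forall y, y \in Y -> x y 0 = 0) -> x = 0].

Section Growth.
Variables (Y : {set 'I_n}) (s : {perm 'I_n}).
Hypothesis sP : forall x, x \notin Y -> e x (s x).

(** With unit weights along s, an eigenvector satisfies x_v = l x_(s v) at each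
    v outside Y.  Following s until it meets Y gives x_v = 0, for every l
    including 0. *)
Lemma observable_paths :
  observable_part Y [set v | [exists y in Y, y \in porbit s v]].
Proof.
set V := [set _ | _].
exists (\matrix_(i, j) ((i == s j) && (j \in V :\: Y))%:R); split.
- move=> i j Aij; rewrite mxE; case: andP => // -[/eqP iE].
  by rewrite inE => /andP[/sP]; rewrite /state_digraph -iE Aij.
- move=> i j; rewrite mxE; case: andP => [[/eqP ->]|]; last by rewrite eqxx.
  rewrite inE => /andP[_ jV] _; rewrite jV andbT.
  move: jV; rewrite !inE => /exists_inP[y yY yj]; apply/exists_inP; exists y => //.
  by rewrite porbit_image.
move=> l x xV Ax xY.
have step v : v \in V -> v \notin Y -> x v 0 = l * x (s v) 0.
  move=> vV vY; have /matrixP/(_ (s v) 0) := Ax; rewrite !mxE => <-.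
  rewrite (bigD1 v) //= big1 => [|j jv].
    by rewrite !mxE eqxx inE vY vV /= rmorph1 mul1r addr0.
  by rewrite !mxE (inj_eq perm_inj) eq_sym (negPf jv) /= rmorph0 mul0r.
apply/matrixP => v k; rewrite ord1 [RHS]mxE.
have [vV|/xV //] := boolP (v \in V).
move: (vV); rewrite inE => /exists_inP[y yY] /porbitP[m yE].
elim: m v vV yE => [|m IH] v vV yE; first by rewrite xY // -(perm1 v) -[1%g](expg0 s) -yE.
have [/xY //|vY] := boolP (v \in Y).
rewrite step // IH ?mulr0 //; last by rewrite yE expgS permM.
by rewrite inE; apply/exists_inP; exists y => //; apply/porbitP; exists m; rewrite yE expgS permM.
Qed.

Lemma large_modulus_nonroot (p : {poly R[i]}) : p != 0 ->
  exists2 a : R, 0 < a & forall l, `|l| = (a%:C)%C -> p.[l] != 0.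
Proof.
move=> p0; have [r pE] := closed_field_poly_normal p.
pose modulus (z : R[i]) := complex.Re `|z|.
have modulus_ge0 z : 0 <= modulus z.
  by have := normr_ge0 z; rewrite lecE => /andP[].
pose a := 1 + \sum_(z <- r) modulus z.
exists a => [|l la]; first by rewrite ltr_pwDl ?sumr_ge0.
rewrite pE hornerZ mulf_neq0 ?lead_coef_eq0 // horner_prod prodf_seq_neq0.
apply/allP => z zr /=; rewrite !hornerE subr_eq0; apply/eqP => lz.
have : modulus z = a by rewrite /modulus -lz la.
apply/eqP; rewrite lt_eqF // /a (big_rem z) //= addrCA ltrDl.
by rewrite ltr_pwDl ?sumr_ge0.
Qed.

(** Give all edges of the cycle the weight a and the edge u -> w weight 1.  The
    cycle receives no input, so an eigenvector either vanishes on it, and the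
    test on V applies, or has |l| = a and x_u <> 0.  In the second case the
    restriction of x to V solves (l - A') x = x_u e_w, whose solution is visible
    on Y unless l is a root of a fixed nonzero polynomial; a is chosen beyond
    the moduli of those roots. *)
Lemma observable_cycle (V : {set 'I_n}) u w :
    Y \subset V -> (forall v, (s v \in V) = (v \in V)) ->
    u \notin V -> w \in V -> e u w -> observable_part Y V ->
  observable_part Y (V :|: porbit s u).
Proof.
move=> YV sV uV wV euw [A' [rA' suppA' obsA']].
have orbV v : v \in porbit s u -> v \notin V.
  case/porbitP => m ->; elim: m => [|m IH]; first by rewrite expg0 perm1.
  by rewrite expgSr permM sV.
have [y yY adj0] : exists2 y, y \in Y & \adj (char_poly_mx (toC A')) y w != 0.
  apply: observed_transfer wV => [i j|]; last exact: obsA'.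
  rewrite mxE => Aij; have /suppA'/andP[] // : A' i j != 0.
  by apply: contraNneq Aij => ->; rewrite rmorph0.
have [a a0 aP] := large_modulus_nonroot adj0.
pose c := porbit s u.
have cS j : (s j \in c) = (j \in c) by rewrite porbit_sym porbit_image porbit_sym.
exists (A' + \matrix_(i, j) (a * ((i == s j) && (j \in c))%:R
                             + ((i == w) && (j == u))%:R)); split.
- move=> i j Aij; rewrite !mxE rA' // add0r.
  case: andP => [[/eqP iE jc]|_].
    suff : A i j by rewrite Aij.
    by rewrite iE; apply: sP; apply/negP => /(fintype.subsetP YV); apply/negP/orbV.
  case: andP => [[/eqP iE /eqP jE]|_]; last by rewrite mulr0 addr0.
  by move: euw; rewrite /state_digraph -iE -jE Aij.
- move=> i j; have [/suppA'/andP[iV jV] _|/negPn/eqP Aij] := boolP (A' i j != 0).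
    by rewrite !inE iV jV.
  rewrite !mxE Aij add0r; case: andP => [[/eqP -> jc] _|_].
    rewrite !inE -/c.
    by rewrite cS jc !orbT.
  case: andP => [[/eqP -> /eqP ->] _|_]; last by rewrite mulr0 addr0 eqxx.
  by rewrite !inE wV porbit_id orbT.
move=> l x xV Ax xY.
have rowE i : l * x i 0 =
    \sum_k (A' i k)%:C%C * x k 0 + (if (s^-1)%g i \in c then (a%:C)%C * x ((s^-1)%g i) 0 else 0)
    + (if i == w then x u 0 else 0).
  have /matrixP/(_ i 0) := Ax; rewrite !mxE => <-.
  have -> : (if (s^-1)%g i \in c then (a%:C)%C * x ((s^-1)%g i) 0 else 0) =
      \sum_k ((a * ((i == s k) && (k \in c))%:R)%:C)%C * x k 0.
    rewrite (bigD1 ((s^-1)%g i)) //= big1 => [|k ki].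
      by rewrite permKV eqxx addr0; case: ifP; rewrite ?mulr1 ?mulr0 ?rmorph0 ?mul0r.
    rewrite (_ : i == s k = false) ?mulr0 ?rmorph0 ?mul0r //.
    by apply: contraNF ki => /eqP ->; rewrite permK.
  have -> : (if i == w then x u 0 else 0) =
      \sum_k ((((i == w) && (k == u))%:R)%:C)%C * x k 0.
    rewrite (bigD1 u) //= big1 => [|k ku].
      by rewrite eqxx andbT addr0; case: ifP; rewrite ?rmorph1 ?mul1r ?rmorph0 ?mul0r.
    by rewrite (negPf ku) andbF rmorph0 mul0r.
  rewrite -!big_split; apply: eq_bigr => k _ /=.
  by rewrite !mxE !rmorphD !mulrDl addrA.
have A'0 i k : i \notin V -> A' i k = 0.
  by move=> iV; apply/eqP; apply: contraNT iV => /suppA'/andP[].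
have row_cycle j : j \in c -> l * x (s j) 0 = (a%:C)%C * x j 0.
  move=> jc; have sjV : s j \notin V by apply: orbV; rewrite -/c cS.
  rewrite rowE permK jc big1 => [|k _]; last by rewrite A'0 // rmorph0 mul0r.
  by rewrite add0r (_ : s j == w = false) ?addr0 //; apply: contraNF sjV => /eqP ->.
have aC0 : (a%:C)%C != 0 by rewrite (inj_eq (@complexI R) a 0) gt_eqF.
have xc_u : x u 0 = 0 -> forall j, j \in c -> x j 0 = 0.
  move=> xu0 j jc; have := jc; rewrite porbit_sym => /porbitP[m uE].
  elim: m j jc uE => [|m IH] j jc uE; first by rewrite uE expg0 perm1 in xu0.
  have := row_cycle j jc; rewrite IH ?cS //; last by rewrite uE expgS permM.
  by rewrite mulr0 => /esym/eqP; rewrite mulf_eq0 (negPf aC0) => /eqP.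
(* The restriction of x to V solves the system on V with input x_u at w. *)
pose xV' : 'cV[R[i]]_n := \col_i (if i \in V then x i 0 else 0).
have restr : toC A' *m xV' = l *: xV' - x u 0 *: delta_mx w 0.
  apply/matrixP => i k; rewrite ord1 !mxE andbT.
  have -> : \sum_j toC A' i j * xV' j 0 = \sum_j (A' i j)%:C%C * x j 0.
    apply: eq_bigr => j _; rewrite !mxE; case: ifP => // jV.
    suff -> : A' i j = 0 by rewrite rmorph0 !mul0r.
    by apply/eqP; apply: contraFT jV => /suppA'/andP[].
  case: ifPn => iV; last first.
    rewrite big1 => [|j _]; last by rewrite A'0 // rmorph0 mul0r.
    by rewrite (_ : i == w = false) ?mulr0 ?subr0 //; apply: contraNF iV => /eqP ->.
  rewrite rowE ifN; last first.
    by apply/negP; rewrite -cS permKV => /orbV; rewrite iV.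
  by rewrite addr0; case: eqP => _; rewrite ?mulr1 ?addrK // mulr0 subr0 addr0.
have xV'Y y' : y' \in Y -> xV' y' 0 = 0 by move=> y'Y; rewrite mxE xY // if_same.
have [xu0|xu0] := eqVneq (x u 0) 0.
  have xV'0 : xV' = 0.
    apply: (obsA' l) => // [i iV|]; first by rewrite mxE (negPf iV).
    by rewrite restr xu0 scale0r subr0.
  apply/matrixP => i k; rewrite ord1 [RHS]mxE.
  have [iV|iV] := boolP (i \in V).
    by have /matrixP/(_ i 0) := xV'0; rewrite !mxE iV.
  have [ic|ic] := boolP (i \in c); first exact: xc_u.
  by apply: xV; rewrite !inE negb_or iV.
have la : `|l| = (a%:C)%C.
  (* A full turn around the cycle gives l ^+ m * x_u = a ^+ m * x_u. *)
  have turn m : iter m s u \in c /\ l ^+ m * x (iter m s u) 0 = (a%:C)%C ^+ m * x u 0.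
    elim: m => [|m [mc IH]]; first by rewrite !expr0 /= porbit_id.
    split; first by rewrite /= cS.
    by rewrite exprSr -mulrA /= row_cycle // mulrCA IH mulrA -exprS.
  have [_] := turn #|porbit s u|; rewrite iter_porbit => /(mulIf xu0)/(congr1 Num.norm).
  have aC : 0 <= (a%:C)%C by rewrite lecR ltW.
  rewrite !normrX (ger0_norm aC) => /eqP.
  by rewrite eqrXn2 ?normr_ge0 ?lt0n ?card_porbit_neq0 // => /eqP.
case/negP: (aP l la); apply/eqP.
pose N := l%:M - toC A'.
have NE : map_mx (horner_eval l) (char_poly_mx (toC A')) = N.
  apply/matrixP => i j; rewrite !mxE /horner_eval hornerD hornerN hornerC.
  by rewrite hornerMn hornerX.
have -> : (\adj (char_poly_mx (toC A')) y w).[l] = \adj N y w.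
  by rewrite -NE -map_mx_adj [RHS]mxE.
have Nx : N *m xV' = x u 0 *: delta_mx w 0.
  by rewrite mulmxBl mul_scalar_mx restr opprB addrC subrK.
have := congr1 (mulmx (\adj N)) Nx.
rewrite mulmxA mul_adj_mx mul_scalar_mx -scalemxAr -colE => /matrixP/(_ y 0).
rewrite [LHS]mxE xV'Y // mulr0 [RHS]mxE [col _ _ _ _]mxE => /esym/eqP.
by rewrite mulf_eq0 (negPf xu0) => /eqP.
Qed.

(** As long as V is not everything, some edge enters V from outside, because Y
    is contained in V and reachable; the orbit of its source is added. *)
Lemma observable_all : reaches e Y -> observable_part Y [set: 'I_n].
Proof.
move=> reach.
suff grow V : observable_part Y V -> Y \subset V -> (forall v, (s v \in V) = (v \in V)) ->
    observable_part Y [set: 'I_n].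
  apply: grow observable_paths _ _.
    by apply/fintype.subsetP => y yY; rewrite inE; apply/exists_inP; exists y; rewrite ?porbit_id.
  move=> v; rewrite !inE; apply: eq_existsb => y; congr (_ && _).
  by rewrite porbit_image.
have [k] := ubnP #|~: V|; elim: k => // k IH in V * => /ltnSE ltk obsV YV sV.
have [VT|/fintype.subsetPn[v _ vV]] := boolP ([set: 'I_n] \subset V).
  by have -> : [set: 'I_n] = V by apply/eqP; rewrite finset.eqEsubset finset.subsetT andbT.
have [u [w [uV wV euw]]] : exists u w, [/\ u \notin V, w \in V & e u w].
  have [y /(fintype.subsetP YV) yV /connectP[p]] := reach v.
  elim: p v vV => [|w p IHp] v vV /=; first by move=> _ yE; rewrite yE (negPf vV) in yV.
  move=> /andP[evw pw] yE; have [wV|wV] := boolP (w \in V); last exact: IHp pw yE.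
  by exists v, w.
apply: (IH (V :|: porbit s u)); last 1 first.
- move=> x; rewrite !inE sV; congr (_ || _).
  by rewrite porbit_sym porbit_image porbit_sym.
- apply: leq_trans ltk; apply: proper_card; apply/properP; split.
    by rewrite finset.setCS finset.subsetUl.
  by exists u; rewrite !inE ?uV // porbit_id orbT.
- exact: observable_cycle wV euw obsV.
- exact: fintype.subset_trans YV (finset.subsetUl _ _).
Qed.

End Growth.

Theorem feasibleP (Y : {set 'I_n}) :
  feasible R A Y <-> reaches e Y /\ matched e Y.
Proof.
split=> [[A' [rA' /observable_hautus hA']]|[reach [s sP]]].
  by split; [apply: hautus_reaches hA'|apply: hautus_matched hA'].
have [A' [rA' _ hA']] := observable_all sP reach.
exists A'; split=> //; apply: hautus_observable => l x; apply: hA' => i.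
by rewrite inE.
Qed.

End StructuralObservability.

(** * Programs with counted loops *)

(** The fragment of the command language whose only loops are counted loops
    [PFor a b p]: cell 0 of array a runs from 0 up to the value of cell 0 of
    array b.  It has a total semantics and a syntactic time bound. *)
Inductive prog : Type :=
  | PSkip
  | PPut of nat & expr & expr
  | PSeq of prog & prog
  | PIf of expr & prog & prog
  | PFor of nat & nat & prog.

Definition Var (a : nat) : expr := Get a (Cst 0).

Fixpoint code (p : prog) : cmd :=
  match p with
  | PSkip => Skip
  | PPut a x y => Put a x y
  | PSeq p q => Seq (code p) (code q)
  | PIf x p q => If x (code p) (code q)
  | PFor a b p =>
      Seq (Put a (Cst 0) (Cst 0))
        (While (Sub (Var b) (Var a))
           (Seq (code p) (Put a (Cst 0) (Add (Var a) (Cst 1)))))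
  end.

(** The counter is written before each turn, so the number of turns is i even
    for a body that overwrites the counter. *)
Fixpoint loop (body : store -> store) (a i : nat) (s : store) : store :=
  if i is i'.+1 then body (update (loop body a i' s) a 0 i') else s.

Fixpoint sem (p : prog) (s : store) : store :=
  match p with
  | PSkip => s
  | PPut a x y => update s a (eval s x) (eval s y)
  | PSeq p q => sem q (sem p s)
  | PIf x p q => if eval s x == 0 then sem q s else sem p s
  | PFor a b p => update (loop (sem p) a (s b 0) s) a 0 (s b 0)
  end.

Fixpoint writes (p : prog) : seq nat :=
  match p with
  | PSkip => [::]
  | PPut a _ _ => [:: a]
  | PSeq p q | PIf _ p q => writes p ++ writes q
  | PFor a _ p => a :: writes p
  end.

Fixpoint well_formed (p : prog) : bool :=
  match p with
  | PSkip | PPut _ _ _ => true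
  | PSeq p q | PIf _ p q => well_formed p && well_formed q
  | PFor a b p => [&& a \notin writes p, b \notin a :: writes p & well_formed p]
  end.

Fixpoint bounds (p : prog) : seq nat :=
  match p with
  | PSkip | PPut _ _ _ => [::]
  | PSeq p q | PIf _ p q => bounds p ++ bounds q
  | PFor _ b p => b :: bounds p
  end.

(** If every loop bound b has value at most q ^ w b, the running time is at most
    [coefficient p * q ^ degree w p]. *)
Fixpoint degree (w : nat -> nat) (p : prog) : nat :=
  match p with
  | PSkip | PPut _ _ _ => 0
  | PSeq p q | PIf _ p q => maxn (degree w p) (degree w q)
  | PFor _ b p => w b + degree w p
  end.

Fixpoint coefficient (p : prog) : nat :=
  match p with
  | PSkip => 1
  | PPut _ x y => (expr_cost x + expr_cost y).+1
  | PSeq p q => coefficient p + coefficient q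
  | PIf x p q => (expr_cost x + (coefficient p + coefficient q)).+1
    (* per turn 12 steps for the test and the increment, and 9 steps once for
       the initialization and the last test *)
  | PFor _ _ p => 21 + coefficient p
  end.

Lemma updateE s a k v : update s a k v a k = v.
Proof. by rewrite /update !eqxx. Qed.

Lemma update_other s a k v b : b != a -> update s a k v b = s b.
Proof. by move=> /negPf ba; rewrite /update ba. Qed.

Lemma loop_frame body a i s b :
    (forall s', body s' b = s' b) -> b != a -> loop body a i s b = s b.
Proof.
by move=> fr ba; elim: i => //= i IH; rewrite fr update_other.
Qed.

Lemma sem_frame p s b : b \notin writes p -> sem p s b = s b.
Proof.
elim: p s => [|a x y|p IHp q IHq|x p IHp q IHq|a c p IHp] s //=.
- by rewrite inE => ba; rewrite update_other.
- by rewrite mem_cat negb_or => /andP[/IHp Ep /IHq ->].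
- by rewrite mem_cat negb_or => /andP[/IHp Ep /IHq Eq]; case: ifP.
- rewrite inE negb_or => /andP[ba /IHp Ep].
  by rewrite update_other // loop_frame.
Qed.

(** The bounds must not be overwritten, so that their initial values remain
    valid during the whole run. *)
Lemma exec_code (w : nat -> nat) (q : nat) p s :
    0 < q -> well_formed p -> (forall b, b \in bounds p -> b \notin writes p) ->
    (forall b, b \in bounds p -> s b 0 <= q ^ w b) ->
  exists2 t, exec (code p) s t (sem p s) & t <= coefficient p * q ^ degree w p.
Proof.
move=> q0; elim: p s => [|a x y|p IHp r IHr|x p IHp r IHr|a c p IHp] s /=.
- by exists 1; [constructor|rewrite expn0].
- by exists (expr_cost x + expr_cost y).+1; [constructor|rewrite expn0 muln1].
- move=> /andP[wp wr] bw bs.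
  have [||t1 e1 t1le] := IHp s wp.
  + move=> b bp; have := bw b; rewrite !mem_cat bp => /(_ isT).
    by rewrite negb_or => /andP[].
  + by move=> b bp; apply: bs; rewrite mem_cat bp.
  have [||t2 e2 t2le] := IHr (sem p s) wr.
  + move=> b bp; have := bw b; rewrite !mem_cat bp orbT => /(_ isT).
    by rewrite negb_or => /andP[].
  + move=> b br; have := bw b; rewrite !mem_cat br orbT => /(_ isT).
    rewrite negb_or => /andP[bp _]; rewrite sem_frame //.
    by apply: bs; rewrite mem_cat br orbT.
  exists (t1 + t2); first exact: ExecSeq e1 e2.
  rewrite mulnDl leq_add // ?(leq_trans t1le) ?(leq_trans t2le) //.
    by rewrite leq_mul // leq_pexp2l // leq_maxl.
  by rewrite leq_mul // leq_pexp2l // leq_maxr.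
- move=> /andP[wp wr] bw bs.
  have [||t1 e1 t1le] := IHp s wp.
  + move=> b bp; have := bw b; rewrite !mem_cat bp => /(_ isT).
    by rewrite negb_or => /andP[].
  + by move=> b bp; apply: bs; rewrite mem_cat bp.
  have [||t2 e2 t2le] := IHr s wr.
  + move=> b bp; have := bw b; rewrite !mem_cat bp orbT => /(_ isT).
    by rewrite negb_or => /andP[].
  + by move=> b bp; apply: bs; rewrite mem_cat bp orbT.
  set D := maxn _ _.
  have D1 : q ^ degree w p <= q ^ D by rewrite leq_pexp2l // leq_maxl.
  have D2 : q ^ degree w r <= q ^ D by rewrite leq_pexp2l // leq_maxr.
  have D0 : 0 < q ^ D by rewrite expn_gt0 q0.
  have := leq_trans t1le (leq_mul (leqnn _) D1).
  have := leq_trans t2le (leq_mul (leqnn _) D2).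
  have [x0|x0] := eqVneq (eval s x) 0.
    by exists (expr_cost x + t2).+1; [apply: ExecIfFalse|nia].
  by exists (expr_cost x + t1).+1; [apply: ExecIfTrue|nia].
move=> /and3P[ap]; rewrite inE negb_or => /andP[ca cp] wp bw bs.
set N := s c 0; set D := degree w p.
have cN : N <= q ^ w c by apply: bs; rewrite inE eqxx.
pose X i := loop (sem p) a i s.
have XF b i : b \notin a :: writes p -> X i b = s b.
  rewrite inE negb_or => /andP[ba bp]; apply: loop_frame => // s'.
  exact: sem_frame.
have body i : exists2 t, exec (code p) (update (X i) a 0 i) t (X i.+1)
                       & t <= coefficient p * q ^ D.
  apply: IHp => // b bp.
    have := bw b; rewrite !inE bp orbT => /(_ isT).
    by rewrite negb_or => /andP[].
  have baw : b \notin a :: writes p by apply: bw; rewrite inE bp orbT.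
  rewrite update_other; last by move: baw; rewrite inE negb_or => /andP[].
  by rewrite XF //; apply: bs; rewrite inE bp orbT.
pose W := While (Sub (Var c) (Var a))
           (Seq (code p) (Put a (Cst 0) (Add (Var a) (Cst 1)))).
have run k i : i + k = N -> exists2 t, exec W (update (X i) a 0 i) t (update (X N) a 0 N)
    & t <= k * (coefficient p * q ^ D + 12) + 6.
  elim: k i => [|k IH] i iN.
    rewrite addn0 in iN; rewrite iN; exists 6 => //.
    apply: ExecWhileFalse; rewrite /= updateE update_other // XF ?subnn //.
    by rewrite inE negb_or ca.
  have [t et tle] := body i.
  have [t' et' t'le] := IH i.+1 (etrans (addSnnS i k) iN).
  exists (5 + (t + 6) + t').+1; last by nia.
  have := @ExecWhileTrue (Sub (Var c) (Var a)) _ (update (X i) a 0 i) (t + 6) _ t' _ _ _ et'.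
  apply.
    rewrite /= updateE update_other // XF ?inE ?negb_or ?ca //.
    by rewrite -/N; lia.
  apply: ExecSeq et _.
  have := ExecPut a (Cst 0) (Add (Var a) (Cst 1)) (X i.+1).
  have Xa : X i.+1 a 0 = i by rewrite /X /= sem_frame // updateE.
  by rewrite [eval _ _]/= [eval _ (Add _ _)]/= Xa addn1.
have [t et tle] := run N 0 (add0n N).
exists (3 + t); first exact: (ExecSeq (ExecPut a (Cst 0) (Cst 0) s) et).
rewrite expnD; have D0 : 0 < q ^ D by rewrite expn_gt0 q0.
have c0 : 0 < q ^ w c by rewrite expn_gt0 q0.
apply: leq_trans (leq_add (leqnn 3) tle) _.
apply: (@leq_trans (3 + (q ^ w c * (coefficient p * q ^ D + 12) + 6))).
  by rewrite !leq_add2l leq_add2r leq_mul2r cN orbT.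
have : 12 * q ^ w c <= 12 * (q ^ w c * q ^ D) by rewrite leq_mul2l leq_pmulr.
have : 0 < q ^ w c * q ^ D by rewrite muln_gt0 c0.
rewrite mulnDr mulnDl mulnCA; lia.
Qed.

(** The rule of invariants.  The second hypothesis on I says that it does not
    mention the counter; for a concrete I it holds by computation. *)
Lemma for_ind (N : nat) (I : nat -> store -> Prop) a b p s :
    s b 0 = N -> a \notin writes p ->
    (forall i s' v, I i s' -> I i (update s' a 0 v)) ->
    I 0 s ->
    (forall i s', i < N -> s' a 0 = i ->
       (forall c, c \notin a :: writes p -> s' c = s c) ->
       I i s' -> I i.+1 (sem p s')) ->
  I N (sem (PFor a b p) s).
Proof.
move=> <- ap Iupd I0 IS; rewrite /=; apply: (Iupd _ _ _ _).
have: s b 0 <= s b 0 by [].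
elim: {1 3 4}(s b 0) => //= i IH lt.
apply: IS lt (updateE _ _ _ _) _ (Iupd _ _ _ (IH (ltnW lt))) => c.
rewrite inE negb_or => /andP[ca cp]; rewrite update_other //.
by apply: loop_frame => // s'; apply: sem_frame.
Qed.

Lemma sem_skip s : sem PSkip s = s. Proof. by []. Qed.
Lemma sem_put a x y s : sem (PPut a x y) s = update s a (eval s x) (eval s y).
Proof. by []. Qed.
Lemma sem_seq p q s : sem (PSeq p q) s = sem q (sem p s). Proof. by []. Qed.
Lemma sem_if x p q s :
  sem (PIf x p q) s = if eval s x == 0 then sem q s else sem p s.
Proof. by []. Qed.

Arguments sem : simpl never.

(** * Bipartite matching by auction *)

Section Auction.
Variables (n : nat) (e : rel 'I_n) (X : {set 'I_n}).
Implicit Types (ow : 'I_n -> option 'I_n) (pr : 'I_n -> nat).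

(** [ow v] is the vertex to which the successor v is currently assigned and
    [pr v] the number of bids made for v.  The inequality in [owner_bid] is the
    approximate optimality of bids: nobody holds a successor that is more than
    one unit dearer than another one available to him. *)
Record auction_inv ow pr : Prop := AuctionInv {
  owner_bid : forall v u, ow v = Some u ->
    [/\ u \notin X, e u v & forall v', e u v' -> pr v <= (pr v').+1];
  owner_inj : forall v v' u, ow v = Some u -> ow v' = Some u -> v = v';
  priced_owned : forall v, 0 < pr v -> ow v;
  price_max : forall v, pr v <= n.+1 }.

Definition idle ow u := (u \notin X) && [forall v, ow v != Some u].

(** An idle vertex all of whose possible successors have reached the price
    n + 1. *)
Definition stuck ow pr := exists2 u, idle ow u & forall v, e u v -> n < pr v.

Lemma no_idle_matched ow pr :
  auction_inv ow pr -> (forall u, ~~ idle ow u) -> matched e X.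
Proof.
move=> inv busy.
have own u : u \notin X -> exists v, ow v == Some u.
  move=> uX; have := busy u; rewrite /idle uX /= => /fintype.forallPn[v].
  by rewrite negbK; exists v.
pose f u := odflt u [pick v | ow v == Some u].
have fP u : u \notin X -> ow (f u) = Some u.
  move=> /own[v vu]; rewrite /f; case: pickP => [w /eqP //|/(_ v)].
  by rewrite vu.
have [s sP] : exists s : {perm 'I_n}, {in ~: X, s =1 f}.
  apply: perm_extends_injection => x y; rewrite !inE => xX yX fxy.
  by have := fP x xX; rewrite fxy fP // => -[].
exists s => x xX; rewrite sP ?inE //.
by have [_ ->] := owner_bid inv (fP x xX).
Qed.

(** Hall's condition fails.  Among the prices 1, ..., n some value g is not
    taken, since a successor of the stuck vertex has a larger price.  Let L
    be the successors dearer than g and S the owners of L together with the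
    stuck vertex.  A successor of a vertex of S costs at least g by
    approximate optimality, hence more than g, so it is in L; but L has fewer
    elements than S. *)
Lemma stuck_unmatched ow pr : auction_inv ow pr -> stuck ow pr -> ~ matched e X.
Proof.
move=> inv [u /andP[uX /forallP uidle] ustuck] [s sP].
pose v0 := s u; have v0p : n < pr v0 by apply/ustuck/sP.
(* Otherwise the levels 1, ..., n would use up all vertices, v0 included. *)
have [g [g1 gn gap]] : exists g, [/\ 0 < g, g <= n & forall v, pr v != g].
  have [/existsP[g /forallP gP]|/existsPn all] :=
    boolP [exists g : 'I_n, forall v, pr v != g.+1].
    by exists g.+1; split=> //; apply: ltn_ord.
  have lev (g : 'I_n) : exists v, pr v == g.+1.
    by have /fintype.forallPn[v] := all g; rewrite negbK; exists v.
  pose h (g : 'I_n) := xchoose (lev g).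
  have hP g : pr (h g) = g.+1 by apply/eqP/(xchooseP (lev g)).
  have hinj : injective h.
    by move=> g g' /(congr1 pr); rewrite !hP => -[] /val_inj.
  have /codomP[g v0E] : v0 \in codom h by apply: inj_card_onto.
  by move: v0p; rewrite v0E hP ltnNge ltn_ord.
pose L := [set v | g < pr v].
pose S := u |: [set a | [exists v in L, ow v == Some a]].
have sS a : a \in S -> s a \in L.
  rewrite !inE => /orP[/eqP ->|/exists_inP[v]]; first exact: leq_ltn_trans v0p.
  rewrite inE => gv /eqP va; have [aX _ ineq] := owner_bid inv va.
  have := ineq _ (sP _ aX); rewrite ltn_neqAle eq_sym gap /=.
  by move=> h; rewrite -ltnS (leq_trans gv).
have : #|S| <= #|L|.
  rewrite -(card_imset S (@perm_inj _ s)); apply: subset_leq_card.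
  by apply/fintype.subsetP => b /imsetP[a aS ->]; apply: sS.
rewrite cardsU1 inE [X in ~~ X](_ : _ = false); last first.
  by apply/negbTE/negP => /exists_inP[v _]; apply/negP; apply: uidle.
rewrite add1n leqNgt ltnS.
case/negP.
have LS v : v \in L -> {a | ow v = Some a & a \in [set a | [exists v in L, ow v == Some a]]}.
  move=> vL; have vL' := vL; rewrite inE in vL'.
  have := priced_owned inv (leq_ltn_trans (leq0n _) vL').
  case va: (ow v) => [a|] // _; exists a => //.
  by rewrite inE; apply/exists_inP; exists v => //; apply/eqP.
pose k v := odflt v (ow v).
have kinj : {in L &, injective k}.
  move=> v v' /LS[a va _] /LS[a' va' _]; rewrite /k va va' /= => aa'.
  by rewrite -aa' in va'; apply: (owner_inj inv va va').
rewrite -(card_in_imset kinj); apply: subset_leq_card.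
by apply/fintype.subsetP => b /imsetP[v /LS[a va aS] ->]; rewrite /k va.
Qed.

Definition assign ow v u := fun w => if w == v then Some u else ow w.
Definition raise pr v := fun w => if w == v then (pr v).+1 else pr w.

Lemma assign_idle ow pr v u w : auction_inv ow pr -> idle ow u ->
  [exists x, assign ow v u x == Some w] =
  (w == u) || (ow v != Some w) && [exists x, ow x == Some w].
Proof.
move=> inv /andP[_ /forallP uidle]; have [->|wu] /= := eqVneq w u.
  by apply/existsP; exists v; rewrite /assign eqxx.
apply/existsP/andP => [[x]|[vw /existsP[x xw]]].
  rewrite /assign; case: (x =P v) => [_|xv xw].
    by rewrite (inj_eq Some_inj) eq_sym (negPf wu).
  split; last by apply/existsP; exists x.
  by apply/eqP => vw; apply: xv; apply: (owner_inj inv (eqP xw) vw).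
exists x; rewrite /assign ifN //.
by apply: contraNneq vw => <-.
Qed.

(** The bidder takes his cheapest successor, so after the increment it is dearer
    than his other choices by at most one. *)
Lemma bid_inv ow pr u v : auction_inv ow pr -> idle ow u -> e u v ->
    pr v <= n -> (forall v', e u v' -> pr v <= pr v') ->
  auction_inv (assign ow v u) (raise pr v).
Proof.
move=> inv /andP[uX /forallP uidle] euv vn vmin; rewrite /assign /raise; split.
- move=> w a; case: eqP => [->|wv].
    move=> -[<-]; split=> // v' /vmin h; case: eqP => [_|_]; lia.
  move=> wa; have [aX eaw h] := owner_bid inv wa; split=> // v' /h {h}.
  by case: eqP => [->|_]; lia.
- move=> w w' a; case: eqP => [->|wv]; case: eqP => [->|w'v] //.
  + by move=> -[<-] /eqP; rewrite (negPf (uidle _)).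
  + by move=> wa [au]; move: (uidle w); rewrite au wa eqxx.
  + by move=> wa wa'; apply: (owner_inj inv wa wa').
- by move=> w; case: eqP => // _; apply: priced_owned inv w.
- by move=> w; case: eqP => // _; apply: price_max inv w.
Qed.

Lemma bid_total pr v : \sum_w raise pr v w = (\sum_w pr w).+1.
Proof.
rewrite (bigD1 v) //= [in RHS](bigD1 v) //= /raise eqxx addSn.
by congr (_ + _).+1; apply: eq_bigr => w /negPf ->.
Qed.

Lemma bid_stuck ow pr u v : stuck ow pr -> e u v -> pr v <= n ->
  stuck (assign ow v u) (raise pr v).
Proof.
move=> [a /andP[aX /forallP aidle] astuck] euv vn.
exists a => [|w /astuck]; last by rewrite /raise; case: eqP => [->|//]; lia.
rewrite /idle aX; apply/forallP => w; rewrite /assign; case: (w =P v) => // _.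
by apply: contraTneq vn => -[ua]; rewrite -ltnNge astuck // -ua.
Qed.

End Auction.

(** * Tabulating the covering problem: the program *)

(* Arrays 0 to 7 hold the input and the output.  Names starting with x_ denote
   arrays of which only cell 0 is used, as a scalar variable. *)
Local Notation a_sizes := 0 (only parsing).
Local Notation a_pattern := 1 (only parsing).
Local Notation a_tau := 2 (only parsing).
Local Notation a_table := 3 (only parsing).
Local Notation a_out := 4 (only parsing).
Local Notation a_cost := 5 (only parsing).
Local Notation a_cover := 6 (only parsing).
Local Notation a_sel := 7 (only parsing).
Local Notation a_rown := 8 (only parsing).
Local Notation a_rowp := 9 (only parsing).
Local Notation a_reach := 10 (only parsing).
Local Notation a_tips := 11 (only parsing).
Local Notation a_owner := 12 (only parsing).
Local Notation a_busy := 13 (only parsing).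
Local Notation a_price := 14 (only parsing).
Local Notation a_mark := 15 (only parsing).
Local Notation x_hole := 16 (only parsing).
Local Notation x_best := 17 (only parsing).
Local Notation x_bid := 18 (only parsing).
Local Notation x_bad := 19 (only parsing).
Local Notation x_hit := 20 (only parsing).
Local Notation x_ok := 21 (only parsing).
Local Notation x_m := 22 (only parsing).
Local Notation x_p := 23 (only parsing).
Local Notation x_N := 24 (only parsing).
Local Notation x_n1 := 25 (only parsing).
Local Notation x_i := 30 (only parsing).
Local Notation x_d := 31 (only parsing).
Local Notation x_x := 32 (only parsing).
Local Notation x_j := 33 (only parsing).
Local Notation x_r := 34 (only parsing).
Local Notation x_t := 35 (only parsing).
Local Notation x_u := 36 (only parsing).
Local Notation x_v := 37 (only parsing).
Local Notation x_k := 38 (only parsing).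

Local Notation "p ;; q" := (PSeq p q) (at level 61, right associativity).
Local Notation "a ::= x" := (PPut a (Cst 0) x) (at level 60).
Local Notation "'when' x 'do' p" := (PIf x p PSkip) (at level 60, p at level 60).
Local Notation "'for' a 'below' b 'do' p" :=
  (PFor a b p) (at level 60, a at level 9, b at level 9, p at level 60).

Definition differ (x y : expr) : expr := Add (Sub x y) (Sub y x).
Definition pred_of (x : expr) : expr := Sub x (Cst 1).
Definition succ_of (x : expr) : expr := Add x (Cst 1).
Definition entry (a rows : nat) (x y : expr) : expr := Get a (Add (Get rows x) y).

(** The state digraph has an edge x -> y when entry (y, x) of the pattern is
    free. *)
Definition edge (x y : expr) : expr := entry a_pattern a_rown y x.

(** The number of sets Z_j is accumulated as 1 + 2 + ... + n, there being no
    multiplication. *)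
Definition setup : prog :=
  x_m ::= Get a_sizes (Cst 1) ;;
  x_p ::= Get a_sizes (Cst 2) ;;
  x_n1 ::= succ_of (Var a_sizes) ;;
  x_N ::= Cst 0 ;;
  for x_k below a_sizes do x_N ::= Add (Var x_N) (succ_of (Var x_k)).

(** Products j * b are tabulated once, so that later on two-dimensional tables
    are addressed by one addition. *)
Definition row_starts (a b : nat) : prog :=
  a ::= Cst 0 ;;
  for x_k below x_N do
    PPut a (succ_of (Var x_k)) (Add (Get a (Var x_k)) (Var b)).

Definition sizes_and_costs : prog :=
  PPut a_out (Cst 0) (Var x_p) ;;
  PPut a_out (Cst 1) (Var x_N) ;;
  for x_j below x_N do
    (PPut a_cost (Var x_j) (Cst 0) ;;
     for x_k below a_sizes do
       PPut a_cost (Var x_j)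
         (Add (Get a_cost (Var x_j)) (entry a_table a_rown (Var x_j) (Var x_k)))).

Definition clear_cover : prog :=
  for x_j below x_N do
    for x_i below x_p do
      PPut a_cover (Add (Get a_rowp (Var x_j)) (Var x_i)) (Cst 0).

(** One round of relaxation; n rounds reach every vertex, since a simple path
    has fewer than n edges. *)
Definition spread : prog :=
  for x_v below a_sizes do
    when Get a_mark (Var x_v) do
      for x_k below a_sizes do
        when edge (Var x_v) (Var x_k) do PPut a_mark (Var x_k) (Cst 1).

Definition closure : prog :=
  for x_u below a_sizes do
    ((for x_v below a_sizes do PPut a_mark (Var x_v) (Cst 0)) ;;
     PPut a_mark (Var x_u) (Cst 1) ;;
     (for x_r below a_sizes do spread) ;;
     for x_v below a_sizes do
       PPut a_reach (Add (Get a_rown (Var x_u)) (Var x_v)) (Get a_mark (Var x_v))).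

Definition tip_table : prog :=
  (for x_k below a_sizes do PPut a_tips (Var x_k) (Cst 0)) ;;
  (for x_k below x_m do PPut a_tips (Get a_tau (Var x_k)) (Cst 1)) ;;
  PPut a_tips (Get a_tau (Var x_i)) (Cst 0) ;;
  PPut a_tips (Var x_d) (Cst 1).

(** Vertices are stored shifted by one, so that 0 means none. *)
Definition find_idle : prog :=
  x_hole ::= Cst 0 ;;
  for x_u below a_sizes do
    PIf (Get a_tips (Var x_u)) PSkip
      (PIf (Get a_busy (Var x_u)) PSkip (x_hole ::= succ_of (Var x_u))).

Definition find_bid : prog :=
  x_best ::= Var x_n1 ;;
  x_bid ::= Cst 0 ;;
  for x_v below a_sizes do
    when edge (pred_of (Var x_hole)) (Var x_v) do
      when Sub (Var x_best) (Get a_price (Var x_v)) do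
        (x_best ::= Get a_price (Var x_v) ;; x_bid ::= succ_of (Var x_v)).

Definition place_bid : prog :=
  (when Get a_owner (pred_of (Var x_bid)) do
     PPut a_busy (pred_of (Get a_owner (pred_of (Var x_bid)))) (Cst 0)) ;;
  PPut a_owner (pred_of (Var x_bid)) (Var x_hole) ;;
  PPut a_busy (pred_of (Var x_hole)) (Cst 1) ;;
  PPut a_price (pred_of (Var x_bid)) (succ_of (Get a_price (pred_of (Var x_bid)))).

Definition auction_round : prog :=
  find_idle ;;
  when Var x_hole do (find_bid ;; when Var x_bid do place_bid).

(** All prices stay at most n + 1, so (n + 1)^2 rounds cannot all be followed by
    a bid: at the end nobody is idle or somebody is stuck. *)
Definition auction : prog :=
  (for x_v below a_sizes do
     (PPut a_owner (Var x_v) (Cst 0) ;;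
      PPut a_busy (Var x_v) (Cst 0) ;;
      PPut a_price (Var x_v) (Cst 0))) ;;
  (for x_r below x_n1 do for x_t below x_n1 do auction_round) ;;
  find_idle.

Definition check_reach : prog :=
  x_bad ::= Cst 0 ;;
  for x_u below a_sizes do
    (x_hit ::= entry a_reach a_rown (Var x_u) (Var x_d) ;;
     (for x_k below x_p do
        when differ (Var x_k) (Var x_i) do
          when entry a_reach a_rown (Var x_u) (Get a_tau (Var x_k)) do
            x_hit ::= Cst 1) ;;
     PIf (Var x_hit) PSkip (x_bad ::= Cst 1)).

Definition same_scc (x y : expr) (p : prog) : prog :=
  when entry a_reach a_rown x y do when entry a_reach a_rown y x do p.

Definition decide : prog :=
  x_ok ::= Cst 0 ;;
  PIf (Var x_bad)
    (when differ (Var x_x) (Get a_tau (Var x_i)) do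
       same_scc (Get a_tau (Var x_i)) (Var x_x) (x_ok ::= Cst 1))
    (PIf (differ (Var x_x) (Var x_d)) PSkip (x_ok ::= Cst 1)).

(** The element x is read from a variable that is the counter of a loop in one
    use and is set equal to d in the other. *)
Definition mark_covers : prog :=
  for x_j below x_N do
    when entry a_table a_rown (Var x_j) (Var x_d) do
      when entry a_table a_rown (Var x_j) (Var x_x) do
        PPut a_cover (Add (Get a_rowp (Var x_j)) (Var x_i)) (Cst 1).

Definition try_element : prog :=
  when differ (Var x_d) (Get a_tau (Var x_i)) do
    PIf (Sub (Var x_m) (Var x_i))
      (tip_table ;; auction ;;
       PIf (Var x_hole) PSkip
         (check_reach ;;
          for x_x below a_sizes do (decide ;; when Var x_ok do mark_covers)))
      (x_x ::= Var x_d ;;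
       same_scc (Get a_tau (Var x_i)) (Var x_d) mark_covers).

Definition fill_cover : prog :=
  for x_i below x_p do for x_d below a_sizes do try_element.

Definition tabulate : prog :=
  row_starts a_rown a_sizes ;; row_starts a_rowp x_p ;;
  sizes_and_costs ;; clear_cover ;; closure ;; fill_cover.

(** With q = n + 1, all loop bounds are at most q, except the number of sets,
    which is at most q ^ 2. *)
Definition size_exponent (b : nat) : nat := if b == x_N then 2 else 1.

Lemma tabulate_degree : degree size_exponent tabulate = 5.
Proof. by []. Qed.
Lemma tabulate_bounds : all (fun b => b \notin writes tabulate) (bounds tabulate).
Proof. by []. Qed.

(** * Tabulating the covering problem: correctness *)

Section Tables.
Variables (n p m : nat) (A : 'M[bool]_n) (tau : 'I_p -> 'I_n).
Variable Z : 'I_(n + 'C(n, 2)) -> {set 'I_n}.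
Local Notation N := (n + 'C(n, 2)).
Local Notation e := (state_digraph A).

Definition static := [:: a_sizes; a_pattern; a_tau; a_table; a_rown; a_rowp;
  x_m; x_p; x_N; x_n1].

(** What the main loops read and never write. *)
Record inputs (s : store) : Prop := Inputs {
  in_n : s a_sizes 0 = n; in_m : s x_m 0 = m; in_p : s x_p 0 = p;
  in_N : s x_N 0 = N; in_n1 : s x_n1 0 = n.+1;
  in_pattern : forall i j : 'I_n, s a_pattern (i * n + j) = A i j;
  in_tau : forall i : 'I_p, s a_tau i = tau i;
  in_table : forall (j : 'I_N) (k : 'I_n), s a_table (j * n + k) = (k \in Z j);
  in_rown : forall k, k < N -> s a_rown k = k * n;
  in_rowp : forall k, k < N -> s a_rowp k = k * p }.

Lemma inputs_frame (W : seq nat) s s' :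
    inputs s -> (forall c, c \notin W -> s' c = s c) ->
    all (fun c => c \notin W) static ->
  inputs s'.
Proof.
move=> [H1 H2 H3 H4 H5 H6 H7 H8 H9 H10] fr /allP fW.
have E c : c \in static -> s' c = s c by move/fW/fr.
by split; rewrite ?E.
Qed.

Lemma inputs_sem q s :
  inputs s -> all (fun c => c \notin writes q) static -> inputs (sem q s).
Proof.
by move=> ins; apply: inputs_frame ins _ => c; apply: sem_frame.
Qed.

Lemma ord_lt_N (u : 'I_n) : u < N.
Proof. exact: leq_trans (ltn_ord u) (leq_addr _ _). Qed.

Lemma eval_edge s x y (u v : 'I_n) : inputs s ->
  eval s x = u -> eval s y = v -> eval s (edge x y) = e u v.
Proof.
by move=> ins /= -> ->; rewrite (in_rown ins) ?ord_lt_N // (in_pattern ins).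
Qed.

(** Soundness is stated relative to a fixed source u.  Marks set in the course
    of the round may be propagated at once, so M' is not determined by M. *)
Lemma spread_spec (u : 'I_n) s (M : {set 'I_n}) : inputs s ->
    (forall v : 'I_n, s a_mark v = (v \in M)) ->
    (forall v, v \in M -> connect e u v) ->
  exists M' : {set 'I_n},
    [/\ forall v : 'I_n, sem spread s a_mark v = (v \in M'),
        M \subset M', forall v, v \in M' -> connect e u v
      & forall v w, v \in M -> e v w -> w \in M'].
Proof.
move=> ins sM soundM.
pose I k (s' : store) := exists M' : {set 'I_n},
    [/\ forall v : 'I_n, s' a_mark v = (v \in M'),
        M \subset M', forall v, v \in M' -> connect e u v
      & forall v w : 'I_n, v < k -> v \in M -> e v w -> w \in M'].
suff [M' [sM' MM' soundM' cl]] : I n (sem spread s).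
  by exists M'; split=> // v w; apply: cl; apply: ltn_ord.
apply: for_ind (in_n ins) _ _ _ _ => //; first by exists M.
move=> k s' kn s'k fr [M1 [sM1 MM1 soundM1 cl]].
have ins' : inputs s' by apply: inputs_frame ins fr _.
pose v := Ordinal kn.
rewrite sem_if.
have -> : eval s' (Get a_mark (Var x_v)) = (v \in M1) by rewrite /= s'k -sM1.
rewrite eqb0; case: ifPn => vM1.
  exists M1; split=> // w w'; rewrite ltnS leq_eqVlt => /orP[/eqP wk|]; last exact: cl.
  have -> : w = v by apply: val_inj.
  by move=> /(fintype.subsetP MM1) vM; rewrite vM in vM1.
rewrite negbK in vM1; exists (M1 :|: [set w | e v w]).
have sP : forall w : 'I_n,
    sem (PFor x_k a_sizes (PIf (edge (Var x_v) (Var x_k))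
      (PPut a_mark (Var x_k) (Cst 1)) PSkip)) s' a_mark w =
    (w \in M1) || (w < n) && e v w.
  pose J k (s2 : store) :=
    forall w : 'I_n, s2 a_mark w = (w \in M1) || (w < k) && e v w.
  change (J n (sem (PFor x_k a_sizes (PIf (edge (Var x_v) (Var x_k))
      (PPut a_mark (Var x_k) (Cst 1)) PSkip)) s')).
  apply: for_ind (in_n ins') _ _ _ _ => //.
    by move=> w; rewrite orbF.
  move=> l s2 ln s2l fr2 Jl w.
  have ins2 : inputs s2 by apply: inputs_frame ins' fr2 _.
  rewrite sem_if (@eval_edge _ _ _ v (Ordinal ln)) //=; last by rewrite fr2.
  rewrite eqb0 ltnS leq_eqVlt.
  have [wl|wl] := eqVneq (w : nat) l.
    have wE : w = Ordinal ln by apply: val_inj.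
    rewrite -wE; case: ifPn => evw.
      by rewrite sem_skip Jl (negPf evw) !andbF.
    by rewrite sem_put /= /update /= s2l wl eqxx /=; rewrite negbK in evw; rewrite evw orbT.
  case: ifP => _; first by rewrite sem_skip Jl.
  by rewrite sem_put /= /update /= s2l (negPf wl) Jl.
split=> [w|||].
- by rewrite sP !inE ltn_ord.
- exact: fintype.subset_trans MM1 (finset.subsetUl _ _).
- move=> w; rewrite !inE => /orP[/soundM1 //|evw].
  exact: connect_trans (soundM1 _ vM1) (connect1 evw).
- move=> w w'; rewrite ltnS leq_eqVlt !inE => /orP[/eqP wk _|wk wM eww'].
    by have -> : w = v by [apply: val_inj]; move=> ->; rewrite orbT.
  by rewrite (cl _ _ wk wM eww').
Qed.

Lemma row_index (q u v k l : nat) : v < q -> l < q ->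
  (u * q + v == k * q + l) = (u == k) && (v == l).
Proof.
move=> vq lq; have [->|uk] /= := eqVneq u k; first by rewrite eqn_add2l.
apply/negbTE; apply: contraNneq uk => /(congr1 (fun x => x %/ q)).
have q0 : 0 < q by apply: leq_ltn_trans vq.
by rewrite !divnMDl // !divn_small // !addn0 => ->.
Qed.

(** After r rounds all endpoints of paths with at most r edges are marked. *)
Lemma closure_spec s : inputs s ->
  forall u v : 'I_n, sem closure s a_reach (u * n + v) = connect e u v.
Proof.
move=> ins.
pose I k (s' : store) := forall u v : 'I_n, u < k ->
  s' a_reach (u * n + v) = connect e u v.
suff H : I n (sem closure s) by move=> u v; apply: H.
apply: for_ind (in_n ins) _ _ _ _ => //.
move=> k s' kn s'k fr Ik.
have ins' : inputs s' by apply: inputs_frame ins fr _.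
pose u := Ordinal kn.
rewrite !sem_seq; set s1 := sem _ s'.
have s1_mark : forall v : 'I_n, s1 a_mark v = 0.
  pose J l (s2 : store) := forall v : 'I_n, v < l -> s2 a_mark v = 0.
  suff H : J n s1 by move=> v; apply: H.
  apply: for_ind (in_n ins') _ _ _ _ => //.
  move=> l s2 ln s2l _ Jl v; rewrite ltnS leq_eqVlt sem_put /update /= s2l.
  by case: eqP => //= _; apply: Jl.
have ins1 : inputs s1 by apply: inputs_sem ins' _.
have s1u : s1 x_u 0 = u by rewrite /s1 sem_frame.
rewrite sem_put; set s2 := update _ _ _ _.
have ins2 : inputs s2.
  by apply: (inputs_frame (W := [:: a_mark])) ins1 _ _ => // c;
    rewrite inE => ca; rewrite /s2 update_other.
set s3 := sem _ s2.
have [M [s3M soundM allM]] : exists M : {set 'I_n},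
   [/\ forall v : 'I_n, s3 a_mark v = (v \in M), forall v, v \in M -> connect e u v
     & forall w, size w <= n -> path e u w -> last u w \in M].
  pose J r (s4 : store) := exists M : {set 'I_n},
   [/\ forall v : 'I_n, s4 a_mark v = (v \in M), forall v, v \in M -> connect e u v
     & forall w, size w <= r -> path e u w -> last u w \in M].
  suff : J n s3 by [].
  apply: for_ind (in_n ins2) _ _ _ _ => //.
    exists [set u]; split=> [v|v|[|//] _ _]; last by rewrite inE.
      rewrite /s2 /update /= s1u inE s1_mark.
      have -> : (v == u) = (v == u :> nat) by [].
      by case: eqP.
    by rewrite inE => /eqP ->.
  move=> r s4 rn s4r fr4 [M [s4M soundM allM]].
  have ins4 : inputs s4 by apply: inputs_frame ins2 fr4 _.
  have [M' [s4M' MM' soundM' clM']] := spread_spec ins4 s4M soundM.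
  exists M'; split=> //; elim/last_ind => [|w v _] szw pw.
    by apply: (fintype.subsetP MM'); apply: allM.
  move: szw pw; rewrite size_rcons rcons_path last_rcons ltnS => szw /andP[pw].
  exact/clM'/allM.
have s3P (v : 'I_n) : s3 a_mark v = connect e u v :> nat.
  rewrite s3M; congr nat_of_bool; apply/idP/idP => [/soundM //|].
  case/connectP => w pw ->; case/shortenP: pw => w' pw' uw' _.
  apply: allM => //; have := max_card (mem (u :: w')).
  by rewrite card_ord (card_uniqP uw') => /ltnW.
have ins3 : inputs s3 by apply: inputs_sem ins2 _.
have s3u : s3 x_u 0 = u by rewrite /s3 sem_frame.
have s3r x : s3 a_reach x = s' a_reach x.
  by rewrite /s3 sem_frame // /s2 /update /= /s1 sem_frame.
set s5 := sem _ s3.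
pose J l (s4 : store) := forall w v : 'I_n,
  (w < k) || (w == k :> nat) && (v < l) -> s4 a_reach (w * n + v) = connect e w v.
suff H : J n s5.
  by move=> w v; rewrite ltnS leq_eqVlt orbC => wk; apply: H; rewrite ltn_ord andbT.
apply: for_ind (in_n ins3) _ _ _ _ => //.
  by move=> w v; rewrite andbF orbF s3r; apply: Ik.
move=> l s4 ln s4l fr4 Jl w v.
have ins4 : inputs s4 by apply: inputs_frame ins3 fr4 _.
have s4u : s4 x_u 0 = k by rewrite fr4.
rewrite sem_put /update /= s4l s4u (in_rown ins4) ?(ord_lt_N u) //= row_index //.
move=> H; case: ifPn => [/andP[/eqP wk /eqP vl]|nwv].
  rewrite fr4 // -vl s3P; congr (nat_of_bool (connect _ _ _)).
  by apply: val_inj; rewrite /= wk.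
apply: Jl; move: H; case/orP => [->//|/andP[/eqP wk]].
rewrite ltnS leq_eqVlt => /orP[/eqP vl|->]; last by rewrite wk eqxx orbT.
by move: nwv; rewrite wk vl !eqxx.
Qed.

Lemma row_starts_spec M s a b c : s x_N 0 = M -> s b 0 = c ->
    a != x_k -> a != b -> b != x_k -> a != x_N ->
  forall k, k <= M -> sem (row_starts a b) s a k = k * c.
Proof.
move=> sN sb ak ab bk aN; rewrite /row_starts sem_seq; set s1 := sem _ s.
pose I l (s' : store) := forall k, k <= l -> s' a k = k * c.
suff : I M (sem (PFor x_k x_N
    (PPut a (succ_of (Var x_k)) (Add (Get a (Var x_k)) (Var b)))) s1) by [].
apply: for_ind => //=; rewrite ?inE.
- by rewrite /s1 sem_put update_other // eq_sym.
- by rewrite eq_sym.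
- by move=> i s' v Ii k ki; rewrite update_other // Ii.
- by move=> k; rewrite leqn0 => /eqP ->; rewrite /s1 sem_put updateE.
move=> l s' lN s'l fr Il k.
have s'b : s' b 0 = c.
  rewrite fr ?inE ?negb_or ?bk 1?eq_sym ?ab // /s1 sem_put update_other // eq_sym.
  by rewrite ab.
rewrite sem_put /update /= eqxx s'l s'b addn1.
case: ifPn => [/eqP -> _|kl]; first by rewrite Il // mulSnr.
by rewrite leq_eqVlt ltnS; case: eqP kl => [_ /=|_ _ /=]; [by []|apply: Il].
Qed.

Lemma sizes_and_costs_spec s : inputs s ->
  [/\ sem sizes_and_costs s a_out 0 = p, sem sizes_and_costs s a_out 1 = N
    & forall j : 'I_N, sem sizes_and_costs s a_cost j = #|Z j|].
Proof.
move=> ins; rewrite /sizes_and_costs !sem_seq !sem_put.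
set s1 := update s _ _ _; set s2 := update s1 _ _ _.
have ins2 : inputs s2.
  apply: (inputs_frame (W := [:: a_out])) ins _ _ => // c.
  by rewrite inE => ca; rewrite /s2 /s1 !update_other.
split.
- by rewrite sem_frame // /s2 /s1 /update /= (in_p ins).
- by rewrite sem_frame // /s2 /s1 /update /= (in_N ins).
set q := PFor _ _ _.
pose I k (s' : store) := forall j : 'I_N, j < k -> s' a_cost j = #|Z j|.
suff H : I N (sem q s2) by move=> j; apply: H.
apply: for_ind (in_N ins2) _ _ _ _ => //.
move=> k s' kN s'k fr Ik; have ins' := inputs_frame ins2 fr isT.
pose j := Ordinal kN.
rewrite sem_seq sem_put; set s3 := update _ _ _ _.
have ins3 : inputs s3.
  apply: (inputs_frame (W := [:: a_cost])) ins' _ _ => // c.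
  by rewrite inE => ca; rewrite /s3 update_other.
set q' := PFor _ _ _.
pose J l (s4 : store) := s4 a_cost k = \sum_(x < n | x < l) (x \in Z j) /\
  forall j : 'I_N, j < k -> s4 a_cost j = #|Z j|.
have [Hk Hj] : J n (sem q' s3).
  apply: for_ind (in_n ins3) _ _ _ _ => //.
    split; first by rewrite big_pred0 // /s3 /update /= s'k eqxx.
    move=> i ik; rewrite -Ik // /s3 /update /= s'k.
    by rewrite (ltn_eqF ik).
  move=> l s4 ln s4l fr4 [J1 J2]; have ins4 := inputs_frame ins3 fr4 isT.
  have s4k : s4 x_j 0 = k by rewrite fr4.
  have s4c : eval s4 (entry a_table a_rown (Var x_j) (Var x_k)) = (Ordinal ln \in Z j).
    by rewrite /= s4k s4l (in_rown ins4) // -(in_table ins4).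
  rewrite sem_put; split.
    rewrite /= in s4c; rewrite /update /= s4c s4k eqxx /= J1.
    rewrite [in RHS](bigD1 (Ordinal ln)) //= addnC; congr (_ + _).
    by apply: eq_bigl => x; rewrite ltnS ltn_neqAle andbC.
  move=> i ik; rewrite /update /= s4k (ltn_eqF ik).
  exact: J2.
move=> i; rewrite ltnS leq_eqVlt => /orP[/eqP ik|]; last exact: Hj.
rewrite ik Hk -sum1_card big_mkcond [RHS]big_mkcond /=.
have -> : i = j by apply: val_inj.
by apply: eq_bigr => x _; rewrite ltn_ord; case: (_ \in _).
Qed.

Lemma clear_cover_spec s : inputs s ->
  forall (j : 'I_N) (i : 'I_p), sem clear_cover s a_cover (j * p + i) = 0.
Proof.
move=> ins.
pose I k (s' : store) := forall (j : 'I_N) (i : 'I_p), j < k ->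
  s' a_cover (j * p + i) = 0.
suff H : I N (sem clear_cover s) by move=> j i; apply: H.
apply: for_ind (in_N ins) _ _ _ _ => //.
move=> k s' kN s'k fr Ik; have ins' := inputs_frame ins fr isT.
set q := PFor _ _ _.
pose J l (s' : store) := forall (j : 'I_N) (i : 'I_p),
  (j < k) || (j == k :> nat) && (i < l) -> s' a_cover (j * p + i) = 0.
suff H : J p (sem q s').
  by move=> j i; rewrite ltnS leq_eqVlt orbC => jk; apply: H; rewrite ltn_ord andbT.
apply: for_ind (in_p ins') _ _ _ _ => //.
  by move=> j i; rewrite andbF orbF; apply: Ik.
move=> l s4 lp s4l fr4 Jl j i; have ins4 := inputs_frame ins' fr4 isT.
have s4k : s4 x_j 0 = k by rewrite fr4.
rewrite sem_put /update /= s4l s4k (in_rowp ins4) //= row_index //.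
move=> H; case: ifPn => [//|nji]; apply: Jl; move: H; case/orP => [->//|/andP[/eqP jk]].
rewrite ltnS leq_eqVlt => /orP[/eqP il|->]; last by rewrite jk eqxx orbT.
by move: nji; rewrite jk il !eqxx.
Qed.
End Tables.

Section TipSets.
Variables (n p m : nat) (A : 'M[bool]_n) (tau : 'I_p -> 'I_n).
Variable Z : 'I_(n + 'C(n, 2)) -> {set 'I_n}.
Local Notation N := (n + 'C(n, 2)).
Local Notation e := (state_digraph A).
Local Notation inputs := (inputs m A tau Z).

Lemma tip_table_spec s (i : 'I_p) (d : 'I_n) : inputs s -> m <= p ->
    s x_i 0 = i -> s x_d 0 = d ->
  forall u : 'I_n, sem tip_table s a_tips u = (u \in swap_tip m tau i d).
Proof.
move=> ins mp si sd; rewrite /tip_table !sem_seq.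
set s1 := sem _ s.
have s1P : forall u : 'I_n, s1 a_tips u = 0.
  pose I k (s' : store) := forall u : 'I_n, u < k -> s' a_tips u = 0.
  suff H : I n s1 by move=> u; apply: H.
  apply: for_ind (in_n ins) _ _ _ _ => //.
  move=> k s' kn s'k _ Ik u; rewrite ltnS leq_eqVlt sem_put /update /= s'k.
  by case: eqP => //= _; apply: Ik.
have ins1 : inputs s1 by apply: inputs_sem ins _.
set s2 := sem _ s1.
have s2P (u : 'I_n) : s2 a_tips u = (u \in tip_part m tau).
  pose I k (s' : store) := forall u : 'I_n,
    s' a_tips u = [exists k' : 'I_p, (k' < k) && (tau k' == u)].
  have -> : (u \in tip_part m tau) = [exists k' : 'I_p, (k' < m) && (tau k' == u)].
    apply/imsetP/existsP => [[k km ->]|[k /andP[km /eqP <-]]].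
      by exists k; rewrite eqxx andbT; move: km; rewrite inE.
    by exists k; rewrite ?inE.
  move: u; suff : I m s2 by [].
  apply: for_ind (in_m ins1) _ _ _ _ => //.
    by move=> u; rewrite s1P; case: existsP => // -[].
  move=> k s' km s'k fr Ik u; have ins' := inputs_frame ins1 fr isT.
  pose k0 := Ordinal (leq_trans km mp).
  have s't : s' a_tau k = tau k0 by rewrite -(in_tau ins' k0).
  rewrite sem_put /update /= s'k s't Ik.
  have -> : [exists k' : 'I_p, (k' < k.+1) && (tau k' == u)]
     = (tau k0 == u) || [exists k' : 'I_p, (k' < k) && (tau k' == u)].
    apply/existsP/orP => [[k' /andP[]]|[k0u|/existsP[k' /andP[kk k'u]]]].
    - rewrite ltnS leq_eqVlt => /orP[/eqP kk'|kk'] k'u.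
        by left; rewrite (_ : k0 = k') //; apply: val_inj.
      by right; apply/existsP; exists k'; rewrite kk'.
    - by exists k0; rewrite ltnS leqnn k0u.
    - by exists k'; rewrite ltnS ltnW.
  have -> : (u == tau k0 :> nat) = (tau k0 == u) by rewrite eq_sym.
  by case: (_ == u).
have ins2 : inputs s2 by apply: inputs_sem ins1 _.
have s2i : s2 x_i 0 = i by rewrite /s2 sem_frame // /s1 sem_frame.
have s2d : s2 x_d 0 = d by rewrite /s2 sem_frame // /s1 sem_frame.
move=> u; rewrite !sem_put /update /= s2i s2d (in_tau ins2) s2P !inE.
have -> : (u == d :> nat) = (u == d) by [].
have -> : (u == tau i :> nat) = (u == tau i) by [].
by case: (u == d); case: (u == tau i).
Qed.

Section AuctionProgram.
Variable X : {set 'I_n}.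
Implicit Types (s : store) (ow : 'I_n -> option 'I_n) (pr : 'I_n -> nat).

(** The array a_busy tabulates the image of ow, so that the search for an idle
    vertex takes linear time. *)
Definition represents (s : store) ow pr := forall v : 'I_n,
  [/\ s a_owner v = oapp (fun u : 'I_n => u.+1) 0 (ow v),
      s a_busy v = [exists w, ow w == Some v] & s a_price v = pr v].

Lemma represents_frame (W : seq nat) s s' ow pr :
    represents s ow pr -> (forall c, c \notin W -> s' c = s c) ->
    all (fun c => c \notin W) [:: a_owner; a_busy; a_price] ->
  represents s' ow pr.
Proof.
by move=> rep fr /and4P[W1 W2 W3 _] v; have [] := rep v; rewrite !fr.
Qed.

Lemma find_idle_spec s ow pr : inputs s ->
    (forall u : 'I_n, s a_tips u = (u \in X)) -> represents s ow pr ->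
  (sem find_idle s x_hole 0 = 0 /\ forall u, ~~ idle X ow u) \/
  (exists2 u : 'I_n, sem find_idle s x_hole 0 = u.+1 & idle X ow u).
Proof.
move=> ins tipsX rep; rewrite /find_idle sem_seq sem_put.
set s1 := update _ _ _ _.
have fr1 c : c \notin [:: x_hole] -> s1 c = s c.
  by rewrite inE => ca; rewrite /s1 update_other.
have ins1 : inputs s1 by apply: inputs_frame ins fr1 _.
set q := PFor _ _ _.
pose I k (s' : store) :=
  (s' x_hole 0 = 0 /\ forall u : 'I_n, u < k -> ~~ idle X ow u) \/
  (exists2 u : 'I_n, s' x_hole 0 = u.+1 & idle X ow u).
suff [[h0 noi]|?] : I n (sem q s1).
- by left; split=> // u; apply: (noi _ (ltn_ord u)).
- by right.
apply: for_ind (in_n ins1) _ _ _ _ => //; first by left; split.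
move=> k s' kn s'k fr Ik; pose u := Ordinal kn.
have fr' c : c \notin [:: x_u; x_hole] -> s' c = s c.
  rewrite !inE negb_or => /andP[c1 c2]; rewrite fr ?inE ?negb_or ?c1 ?c2 //.
  by rewrite fr1 ?inE.
have -> : sem (PIf (Get a_tips (Var x_u)) PSkip
     (PIf (Get a_busy (Var x_u)) PSkip (x_hole ::= succ_of (Var x_u)))) s'
   = if idle X ow u then update s' x_hole 0 u.+1 else s'.
  rewrite !sem_if !sem_skip sem_put /= s'k !fr' // (tipsX u).
  have [_ -> _] := rep u; rewrite /idle !eqb0 -negb_exists addn1.
  by case: (u \in X) => //=; case: [exists _, _].
case: ifPn => [ui|ui]; first by right; exists u.
case: Ik => [[h0 noi]|?]; last by right.
left; split=> // w; rewrite ltnS leq_eqVlt => /orP[/eqP wk|]; last exact: noi.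
by rewrite (_ : w = u) //; apply: val_inj.
Qed.

Lemma find_bid_spec s ow pr (u : 'I_n) : inputs s -> represents s ow pr ->
    s x_hole 0 = u.+1 ->
  (sem find_bid s x_bid 0 = 0 /\ forall v, e u v -> n < pr v) \/
  (exists v : 'I_n, [/\ sem find_bid s x_bid 0 = v.+1, e u v, pr v <= n
                      & forall v', e u v' -> pr v <= pr v']).
Proof.
move=> ins rep sh; rewrite /find_bid !sem_seq !sem_put.
set s1 := update s _ _ _; set s2 := update s1 _ _ _.
have fr2 c : c \notin [:: x_best; x_bid] -> s2 c = s c.
  by rewrite !inE negb_or => /andP[c1 c2]; rewrite /s2 /s1 !update_other.
have ins2 : inputs s2 by apply: inputs_frame ins fr2 _.
set q := PFor _ _ _.
pose I k (s' : store) :=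
  [/\ s' x_bid 0 = 0, s' x_best 0 = n.+1 &
      forall v : 'I_n, v < k -> e u v -> n < pr v] \/
  (exists v : 'I_n, [/\ s' x_bid 0 = v.+1 /\ s' x_best 0 = pr v, e u v, pr v <= n
                      & forall v' : 'I_n, v' < k -> e u v' -> pr v <= pr v']).
suff [[b0 _ H]|[v [[vb _] uv vn H]]] : I n (sem q s2).
- by left; split=> // v; apply: (H _ (ltn_ord v)).
- by right; exists v; split=> // v2; apply: (H _ (ltn_ord v2)).
apply: for_ind (in_n ins2) _ _ _ _ => //.
  by left; split=> //; rewrite /s2 /s1 /update /= (in_n1 ins).
move=> k s' kn s'k fr Ik; pose w := Ordinal kn.
have fr' c : c \notin [:: x_v; x_best; x_bid] -> s' c = s c.
  rewrite !inE !negb_or => /and3P[c1 c2 c3].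
  by rewrite fr ?inE ?negb_or ?c1 ?c2 ?c3 // fr2 ?inE ?negb_or ?c2.
have ins' : inputs s' by apply: inputs_frame ins fr' _.
have stepE : sem (PIf (edge (pred_of (Var x_hole)) (Var x_v))
      (PIf (Sub (Var x_best) (Get a_price (Var x_v)))
        (x_best ::= Get a_price (Var x_v) ;; x_bid ::= succ_of (Var x_v)) PSkip) PSkip) s'
   = if e u w && (pr w < s' x_best 0)
     then update (update s' x_best 0 (pr w)) x_bid 0 w.+1 else s'.
  rewrite sem_if (@eval_edge _ _ _ _ _ _ _ _ _ u w ins') //=; last first.
    by rewrite fr' // sh subn1.
  rewrite sem_if !sem_skip sem_seq !sem_put /= eqb0 /update /= s'k.
  have -> : s' a_price k = pr w by rewrite fr' //; have [_ _ <-] := rep w.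
  by rewrite subn_eq0 addn1; case: (e u w) => //=; case: ltnP.
rewrite {}stepE; case: ifPn => [/andP[uw prw]|nuw].
  right; exists w; split=> //.
    by case: Ik => [[_ bn _]|[v [[_ vb] _ vn _]]]; lia.
  move=> v'; rewrite ltnS leq_eqVlt => /orP[/eqP v'w|v'k] uv'.
    by rewrite (_ : v' = w) //; apply: val_inj.
  by case: Ik => [[_ bn H]|[v [[_ vb] _ vn H]]]; have := H v' v'k uv'; lia.
case: Ik => [[b0 bn H]|[v [[vb bb] uv vn H]]]; [left|right].
  split=> // v'; rewrite ltnS leq_eqVlt => /orP[/eqP v'w|]; last exact: H.
  have -> : v' = w by apply: val_inj.
  by move=> uw; move: nuw; rewrite uw bn /= -leqNgt.
exists v; split=> // v'; rewrite ltnS leq_eqVlt => /orP[/eqP v'w|]; last exact: H.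
have -> : v' = w by apply: val_inj.
by move=> uw; move: nuw; rewrite uw bb /= -leqNgt.
Qed.

Lemma place_bid_spec (s : store) ow pr (u v : 'I_n) : represents s ow pr ->
    auction_inv e X ow pr -> idle X ow u ->
    s x_hole 0 = u.+1 -> s x_bid 0 = v.+1 ->
  represents (sem place_bid s) (assign ow v u) (raise pr v).
Proof.
move=> rep inv ui sh sb; rewrite /place_bid !sem_seq.
set s1 := sem _ s.
have fr1 c : c \notin [:: a_busy] -> s1 c = s c by move=> ca; rewrite /s1 sem_frame.
have s1b (w : 'I_n) : s1 a_busy w = (ow v != Some w) && [exists x, ow x == Some w].
  rewrite /s1 sem_if sem_skip sem_put /= sb subn1 /=.
  have [ov _ _] := rep v; have [_ bw _] := rep w.
  rewrite ov; case: (ow v) => [a|] /=; last by rewrite bw.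
  rewrite /update /= subn1 /= (inj_eq Some_inj) bw.
  have -> : (w == a :> nat) = (a == w) by rewrite eq_sym.
  by case: (a == w).
rewrite !sem_put => w; have [ov bv pv] := rep v; have [ow' bw pw] := rep w.
have s1h : s1 x_hole 0 = u.+1 by rewrite fr1.
have s1v : s1 x_bid 0 = v.+1 by rewrite fr1.
rewrite /update /= s1h s1v !subn1 /= (fr1 a_owner) // (fr1 a_price) //.
rewrite (assign_idle _ _ inv ui) /assign /raise.
have -> : (w == v :> nat) = (w == v) by [].
have -> : (w == u :> nat) = (w == u) by [].
split.
- by case: eqP.
- by rewrite s1b; case: (w == u).
- by rewrite addn1 pv pw; case: eqP => // ->.
Qed.

(** The progress measure: a round either makes a bid, which raises the total
    price by one, or changes nothing because nobody is idle or an idle vertex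
    is stuck. *)
Definition auction_state k (s : store) := exists ow pr,
  [/\ represents s ow pr, auction_inv e X ow pr
    & [\/ k <= \sum_v pr v, forall u, ~~ idle X ow u | stuck e X ow pr]].

Lemma auction_round_spec k s : inputs s ->
    (forall u : 'I_n, s a_tips u = (u \in X)) ->
  auction_state k s -> auction_state k.+1 (sem auction_round s).
Proof.
move=> ins tipsX [ow [pr [rep inv prog]]].
rewrite /auction_round sem_seq; have := find_idle_spec ins tipsX rep.
set s1 := sem find_idle s.
have fr1 c : c \notin writes find_idle -> s1 c = s c by apply: sem_frame.
have rep1 : represents s1 ow pr by apply: represents_frame rep fr1 _.
have ins1 : inputs s1 by apply: inputs_frame ins fr1 _.
rewrite sem_if sem_skip sem_seq /=.
case=> [[-> noi]|[u s1u ui]]; first by exists ow, pr; split=> //; apply: Or32.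
rewrite s1u /=; have := find_bid_spec ins1 rep1 s1u.
set s2 := sem find_bid s1.
have fr2 c : c \notin writes find_bid -> s2 c = s1 c by apply: sem_frame.
have rep2 : represents s2 ow pr by apply: represents_frame rep1 fr2 _.
rewrite sem_if sem_skip /=.
case=> [[-> stk]|[v [s2v uv vn vmin]]].
  by exists ow, pr; split=> //; apply: Or33; exists u.
rewrite s2v /=; exists (assign ow v u), (raise pr v); split.
- by apply: (place_bid_spec rep2 inv ui _ s2v); rewrite fr2.
- exact: bid_inv.
case: prog => [kp|noi|stk].
- by apply: Or31; rewrite bid_total.
- by move: (noi u); rewrite ui.
- by apply: Or33; apply: bid_stuck stk uv vn.
Qed.

Lemma auction_spec s : inputs s -> (forall u : 'I_n, s a_tips u = (u \in X)) ->
  sem auction s x_hole 0 = 0 <-> matched e X.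
Proof.
move=> ins tipsX; rewrite /auction 2!sem_seq.
set s1 := sem _ s.
have fr1 c : c \notin [:: x_v; a_owner; a_busy; a_price] -> s1 c = s c.
  by move=> ca; rewrite /s1 sem_frame.
have ins1 : inputs s1 by apply: inputs_frame ins fr1 _.
have st1 : auction_state 0 s1.
  exists (fun _ => None), (fun _ => 0); split; last exact: Or31.
    pose I k (s' : store) := forall v : 'I_n, v < k ->
      [/\ s' a_owner v = 0, s' a_busy v = 0 & s' a_price v = 0].
    suff H : I n s1.
      move=> v; have [-> -> ->] := H v (ltn_ord v); split=> //.
      by case: existsP => // -[].
    apply: for_ind (in_n ins) _ _ _ _ => //.
    move=> k s' kn s'k _ Ik v; rewrite ltnS leq_eqVlt !sem_seq !sem_put /update /= s'k.
    by case: eqP => //= _; apply: Ik.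
  by split.
set s2 := sem _ s1.
have fr2 c : c \notin [:: x_r, x_t & writes auction_round] -> s2 c = s1 c.
  by move=> ca; rewrite /s2 sem_frame.
have st2 : auction_state (n.+1 * n.+1) s2.
  pose I k s' := auction_state (k * n.+1) s'.
  change (I n.+1 s2).
  apply: for_ind (in_n1 ins1) _ _ _ _ => //.
  move=> k s3 _ _ fr3 Ik.
  have ins3 : inputs s3 by apply: inputs_frame ins1 fr3 _.
  pose J l s' := auction_state (k * n.+1 + l) s'.
  rewrite /I mulSnr.
  set s5 := sem _ s3; change (J n.+1 s5).
  apply: for_ind (in_n1 ins3) _ _ _ _ => //; first by rewrite /J addn0.
  move=> l s4 _ _ fr4 Jl; rewrite /J addnS; apply: auction_round_spec Jl.
    exact: inputs_frame ins3 fr4 isT.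
  by move=> u; rewrite fr4 // fr3 // fr1.
have ins2 : inputs s2 by apply: inputs_frame ins1 fr2 _.
have tips2 (u : 'I_n) : s2 a_tips u = (u \in X) by rewrite fr2 // fr1.
case: st2 => ow [pr [rep inv prog]].
have total : \sum_v pr v < n.+1 * n.+1.
  apply: leq_ltn_trans (_ : \sum_(v : 'I_n) n.+1 < _).
    by apply: leq_sum => v _; apply: price_max inv v.
  by rewrite sum_nat_const card_ord ltn_pmul2r.
have := find_idle_spec ins2 tips2 rep.
case=> [[h0 noi]|[u hu ui]].
  by rewrite h0; split=> // _; apply: no_idle_matched inv noi.
rewrite hu; split=> //; case: prog => [|noi|stk].
- by rewrite leqNgt total.
- by move: (noi u); rewrite ui.
- by move/(stuck_unmatched inv stk).
Qed.

End AuctionProgram.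

End TipSets.

Section Repairs.
Variables (n p m : nat) (A : 'M[bool]_n) (tau : 'I_p -> 'I_n).
Variable Z : 'I_(n + 'C(n, 2)) -> {set 'I_n}.
Local Notation N := (n + 'C(n, 2)).
Local Notation e := (state_digraph A).
Local Notation inputs := (inputs m A tau Z).

Lemma differ_eq0 s x y : (eval s (differ x y) == 0) = (eval s x == eval s y).
Proof. rewrite /=; lia. Qed.

Definition reach_table (s : store) :=
  forall u v : 'I_n, s a_reach (u * n + v) = connect e u v.

Lemma eval_reach s x y (u v : 'I_n) : inputs s -> reach_table s ->
    eval s x = u -> eval s y = v ->
  eval s (entry a_reach a_rown x y) = connect e u v.
Proof.
by move=> ins rt /= -> ->; rewrite (in_rown ins) ?ord_lt_N // rt.
Qed.

Lemma eval_table s x y (j : 'I_N) (k : 'I_n) : inputs s ->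
    eval s x = j -> eval s y = k ->
  eval s (entry a_table a_rown x y) = (k \in Z j).
Proof. by move=> ins /= -> ->; rewrite (in_rown ins) // (in_table ins). Qed.

Lemma eval_tau s x (i : 'I_p) : inputs s -> eval s x = i ->
  eval s (Get a_tau x) = tau i.
Proof. by move=> ins /= ->; rewrite (in_tau ins). Qed.

(** This is the form in which the program tests reachability: every state of F
    other than the lost one, together with d. *)
Lemma interchangedE (i : 'I_p) (d : 'I_n) : injective tau -> i < m ->
  interchanged m tau i d = d |: [set tau k | k : 'I_p & k != i].
Proof.
move=> tau_inj im; apply/setP => y; rewrite !inE.
have [//|yd] /= := eqVneq y d.
apply/orP/imsetP => [[/andP[yi /imsetP[k km yk]]|/imsetP[k km yk]]|[k]].
- by exists k => //; rewrite inE; apply: contraNneq yi => <-; rewrite yk.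
- exists k => //; rewrite inE; apply: contraTneq km => ->.
  by rewrite inE -ltnNge.
rewrite inE => ki ->; rewrite (inj_eq tau_inj) ki /=.
by have [km|mk] := ltnP k m; [left|right]; apply/imsetP; exists k; rewrite ?inE.
Qed.

Lemma check_reach_spec s (i : 'I_p) (d : 'I_n) : inputs s -> reach_table s ->
    injective tau -> i < m -> s x_i 0 = i -> s x_d 0 = d ->
  (sem check_reach s x_bad 0 == 0) = `[< reaches e (interchanged m tau i d) >].
Proof.
move=> ins rt tau_inj im si sd.
rewrite (interchangedE d tau_inj im); set W := d |: _.
have -> : `[< reaches e W >] = [forall u, [exists y in W, connect e u y]].
  apply/asboolP/forallP => [re u|re u]; last exact/exists_inP.
  by apply/exists_inP; apply: re.
rewrite /check_reach sem_seq sem_put; set s1 := update _ _ _ _.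
have fr1 c : c \notin [:: x_bad] -> s1 c = s c.
  by rewrite inE => ca; rewrite /s1 update_other.
have ins1 : inputs s1 by apply: inputs_frame ins fr1 _.
pose hits u := [exists y in W, connect e u y].
set q := PFor _ _ _.
pose I k (s' : store) :=
  (s' x_bad 0 == 0) = [forall u : 'I_n, (u < k) ==> hits u].
suff : I n (sem q s1).
  rewrite /I => ->; apply: eq_forallb => u; by rewrite ltn_ord.
apply: for_ind (in_n ins1) _ _ _ _ => //.
  by rewrite /I; apply/esym/forallP.
move=> k s' kn s'k fr Ik; pose u := Ordinal kn.
have fr' c : c \notin [:: x_u; x_hit; x_k; x_bad] -> s' c = s c.
  move=> ca; rewrite fr ?fr1 //; move: ca; rewrite !inE !negb_or.
    by case/and4P.
  by case/and4P => -> -> -> ->.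
have ins' : inputs s' by apply: inputs_frame ins fr' _.
have rt' : reach_table s' by move=> v w; rewrite fr' // rt.
rewrite 2!sem_seq sem_put; set s2 := update _ _ _ _.
have fr2 c : c \notin [:: x_hit] -> s2 c = s' c.
  by rewrite inE => ca; rewrite /s2 update_other.
have ins2 : inputs s2 by apply: inputs_frame ins' fr2 _.
have rt2 : reach_table s2 by move=> v w; rewrite fr2 // rt'.
have s2h : s2 x_hit 0 = connect e u d.
  by rewrite /s2 updateE; apply: eval_reach ins' rt' _ _ => //=; rewrite ?s'k ?fr'.
set s3 := sem _ s2.
have s3h : s3 x_hit 0 = hits u.
  pose J l (s4 : store) := s4 x_hit 0 = connect e u d ||
    [exists k' : 'I_p, [&& k' < l, k' != i & connect e u (tau k')]].
  have : J p s3.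
    apply: for_ind (in_p ins2) _ _ _ _ => //.
      by rewrite /J s2h; case: existsP => [[]|] //; rewrite orbF.
    move=> l s4 lp s4l fr4 Jl; have ins4 : inputs s4 by apply: inputs_frame ins2 fr4 _.
    have rt4 : reach_table s4 by move=> v w; rewrite fr4 // rt2.
    pose l0 := Ordinal lp.
    have s4i : s4 x_i 0 = i by rewrite fr4 // fr2 // fr'.
    have s4u : s4 x_u 0 = u by rewrite fr4 // fr2.
    have evl : eval s4 (entry a_reach a_rown (Var x_u) (Get a_tau (Var x_k))) =
        connect e u (tau l0).
      by apply: eval_reach => //; apply: eval_tau.
    rewrite !sem_if !sem_skip sem_put differ_eq0 evl eqb0.
    rewrite [eval _ (Var x_k)]/= [eval _ (Var x_i)]/= s4l s4i.
    rewrite /J.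
    have -> : [exists k' : 'I_p, [&& k' < l.+1, k' != i & connect e u (tau k')]] =
      ((l0 != i) && connect e u (tau l0)) ||
      [exists k' : 'I_p, [&& k' < l, k' != i & connect e u (tau k')]].
      apply/existsP/orP => [[k' /and3P[]]|[/andP[k0u cu]|/existsP[k' /and3P[kk ki cu]]]].
      - rewrite ltnS leq_eqVlt => /orP[/eqP kk'|kk'] ki cu.
          by left; rewrite (_ : l0 = k') ?ki //; apply: val_inj.
        by right; apply/existsP; exists k'; rewrite kk' ki.
      - by exists l0; rewrite ltnS leqnn k0u.
      - by exists k'; rewrite ltnS ltnW // ki.
    have -> : (l == i :> nat) = (l0 == i) by [].
    case: eqP => //= _; case: connect => //=.
    by rewrite /update /= orbT.
  move=> ->; congr nat_of_bool; apply/orP/exists_inP => [[ud|/existsP[k' /and3P[_ ki cu]]]|[y]].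
  - by exists d => //; rewrite !inE eqxx.
  - by exists (tau k') => //; rewrite !inE imset_f ?inE ?ki ?orbT.
  rewrite !inE => /orP[/eqP -> ->|/imsetP[k']]; first by left.
  rewrite inE => ki -> cu; right; apply/existsP; exists k'.
  by rewrite ltn_ord ki.
have s3b : s3 x_bad 0 = s' x_bad 0 by rewrite /s3 sem_frame // fr2.
rewrite /I; have -> : [forall u : 'I_n, (u < k.+1) ==> hits u] =
    hits u && [forall u : 'I_n, (u < k) ==> hits u].
  apply/forallP/andP => [H|[hu /forallP H] v].
    split; first by have := H u; rewrite ltnSn.
    apply/forallP => v; apply/implyP => vk.
    by have := H v; rewrite ltnS ltnW.
  apply/implyP; rewrite ltnS leq_eqVlt => /orP[/eqP vk|vk].
    by rewrite (_ : v = u) //; apply: val_inj.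
  by have := H v; rewrite vk.
rewrite sem_if sem_skip sem_put /= s3h eqb0 -Ik -s3b.
by case: (hits u).
Qed.

Definition covers (s : store) (B : 'I_N -> 'I_p -> bool) :=
  forall (j : 'I_N) (i : 'I_p), s a_cover (j * p + i) = B j i.

Lemma mark_covers_spec s B (i : 'I_p) (d x : 'I_n) : inputs s ->
    s x_i 0 = i -> s x_d 0 = d -> s x_x 0 = x -> covers s B ->
  covers (sem mark_covers s)
    (fun j i' => B j i' || [&& i' == i, d \in Z j & x \in Z j]).
Proof.
move=> ins si sd sx cB.
pose I k (s' : store) := forall (j : 'I_N) (i' : 'I_p), s' a_cover (j * p + i') =
  B j i' || [&& j < k, i' == i, d \in Z j & x \in Z j].
suff H : I N (sem mark_covers s) by move=> j i'; rewrite H ltn_ord.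
apply: for_ind (in_N ins) _ _ _ _ => //.
  by move=> j i'; rewrite orbF.
move=> k s' kN s'k fr Ik j i'; pose j0 := Ordinal kN.
have ins' : inputs s' by apply: inputs_frame ins fr _.
rewrite !sem_if !sem_skip sem_put.
rewrite (@eval_table _ _ _ j0 d) //; last by rewrite /= fr.
rewrite (@eval_table _ _ _ j0 x) //; last by rewrite /= fr.
rewrite !eqb0 [eval _ (Add _ _)]/= s'k (in_rowp ins') // fr // si.
have -> : (j < k.+1) = (j == j0) || (j < k).
  by rewrite ltnS leq_eqVlt.
have [jE|jj0] := eqVneq j j0.
  have jk : (j < k) = false by rewrite jE /= ltnn.
  have := Ik j i'; rewrite jk orbF /= jE.
  case: (d \in Z j0); case: (x \in Z j0) => /=; rewrite ?andbF ?orbF //.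
  rewrite /update /= row_index // eqxx /= => ->.
  have -> : (i' == i :> nat) = (i' == i) by [].
  by case: (i' == i); rewrite ?orbT ?orbF.
have up y : update s' a_cover (k * p + i) y a_cover (j * p + i') = s' a_cover (j * p + i').
  rewrite /update /= row_index // (_ : j == k :> nat = false) //.
  by apply: contraNF jj0 => /eqP jk; apply/eqP/val_inj.
by case: ifP => _; [|case: ifP => _]; rewrite ?up Ik.
Qed.

(** The pair d, x makes up for the loss of the i-th state of F.  For a tip, d
    takes its place in the tip set; x equals d when this already leaves no
    vertex without an observed descendant, and otherwise lies in the component
    of the lost tip.  For a representative of a sink component, d = x is another
    vertex of it. *)
Definition repairs (i : 'I_p) (d x : 'I_n) : bool :=
  (d != tau i) &&
  if i < m then
    `[< matched e (swap_tip m tau i d) >] &&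
    (if `[< reaches e (interchanged m tau i d) >] then x == d
     else (x != tau i) && (x \in scc e (tau i)))
  else (x == d) && (d \in scc e (tau i)).

(** The body of the double loop adds to the table the contribution of the pairs
    whose first member is d. *)
Lemma try_element_spec s B (i : 'I_p) (d : 'I_n) : inputs s -> reach_table s ->
    injective tau -> m <= p -> s x_i 0 = i -> s x_d 0 = d -> covers s B ->
  covers (sem try_element s)
    (fun j i' => B j i' || [&& i' == i, d \in Z j & [exists x in Z j, repairs i d x]]).
Proof.
move=> ins rt tau_inj mp si sd cB.
have skip s' : (forall x, repairs i d x = false) -> covers s' B -> covers s'
    (fun j i' => B j i' || [&& i' == i, d \in Z j & [exists x in Z j, repairs i d x]]).
  move=> nok cs' j i'; rewrite cs'; congr nat_of_bool.
  rewrite (_ : [exists x in Z j, repairs i d x] = false) ?andbF ?orbF //.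
  by apply/negbTE/exists_inPn => x _; rewrite nok.
rewrite /try_element sem_if sem_skip differ_eq0 (eval_tau (i := i)) // [eval _ _]/= sd.
have -> : (d == tau i :> nat) = (d == tau i) by [].
case: ifPn => [/eqP di|di]; first by apply: skip => // x; rewrite /repairs di eqxx.
rewrite sem_if [eval _ _]/= (in_m ins) si subn_eq0 leqNgt.
have [im|mi] := boolP (i < m) => /=; last first.
  rewrite sem_seq sem_put; set s1 := update _ _ _ _.
  have fr1 c : c \notin [:: x_x] -> s1 c = s c.
    by rewrite inE => ca; rewrite /s1 update_other.
  have ins1 : inputs s1 by apply: inputs_frame ins fr1 _.
  have rt1 : reach_table s1 by move=> v w; rewrite fr1 // rt.
  have cB1 : covers s1 B by move=> j i'; rewrite fr1 // cB.
  have okE x : repairs i d x = [&& x == d, connect e (tau i) d & connect e d (tau i)].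
    by rewrite /repairs di (negPf mi) inE.
  have st : eval s1 (Get a_tau (Var x_i)) = tau i.
    by apply: eval_tau => //=; rewrite fr1.
  have sd1 : eval s1 (Var x_d) = d by rewrite /= fr1.
  rewrite /same_scc !sem_if !sem_skip.
  rewrite (eval_reach ins1 rt1 st sd1) (eval_reach ins1 rt1 sd1 st) !eqb0.
  case: ifPn => [c1|/negbNE c1].
    by apply: skip => // x; rewrite okE (negPf c1) andbF.
  case: ifPn => [c2|/negbNE c2].
    by apply: skip => // x; rewrite okE (negPf c2) !andbF.
  have s1x : s1 x_x 0 = d by rewrite /s1 updateE.
  have := @mark_covers_spec s1 B i d d ins1 _ sd1 s1x cB1; rewrite fr1 // => /(_ si) mc.
  move=> j i'; rewrite mc; congr (nat_of_bool (_ || (_ && _))).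
  case dj : (d \in Z j) => //=; apply/esym/exists_inP; exists d => //.
  by rewrite okE eqxx c1.
rewrite 2!sem_seq; set s1 := sem tip_table s.
have fr1 c : c \notin writes tip_table -> s1 c = s c by apply: sem_frame.
have ins1 : inputs s1 by apply: inputs_frame ins fr1 _.
have tips1 := tip_table_spec ins mp si sd.
have := auction_spec ins1 tips1; set s2 := sem auction s1 => auc.
have fr2 c : c \notin writes auction -> s2 c = s1 c by apply: sem_frame.
have ins2 : inputs s2 by apply: inputs_frame ins1 fr2 _.
have rt2 : reach_table s2 by move=> v w; rewrite fr2 // fr1 // rt.
have cB2 : covers s2 B by move=> j i'; rewrite fr2 // fr1 // cB.
have hE : (s2 x_hole 0 == 0) = `[< matched e (swap_tip m tau i d) >].
  by apply/eqP/asboolP => /auc.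
have s2i : s2 x_i 0 = i by rewrite fr2 // fr1.
have s2d : s2 x_d 0 = d by rewrite fr2 // fr1.
rewrite sem_if sem_skip [eval _ _]/= hE.
case: ifPn => [mat|nmat]; last first.
  by apply: skip => // x; rewrite /repairs im (negPf nmat) andbF.
rewrite sem_seq; have := check_reach_spec ins2 rt2 tau_inj im s2i s2d.
set s3 := sem check_reach s2 => bad.
have fr3 c : c \notin writes check_reach -> s3 c = s2 c by apply: sem_frame.
have ins3 : inputs s3 by apply: inputs_frame ins2 fr3 _.
have rt3 : reach_table s3 by move=> v w; rewrite fr3 // rt2.
have cB3 : covers s3 B by move=> j i'; rewrite fr3 // cB2.
have s3i : s3 x_i 0 = i by rewrite fr3.
have s3d : s3 x_d 0 = d by rewrite fr3.
set q := PFor _ _ _.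
pose I k (s' : store) := covers s' (fun j i' => B j i' ||
  [&& i' == i, d \in Z j & [exists x in Z j, (x < k) && repairs i d x]]).
suff H : I n (sem q s3).
  move=> j i'; rewrite H; congr (nat_of_bool (_ || [&& _, _ & _])).
  by apply: eq_existsb => x; rewrite ltn_ord.
apply: for_ind (in_n ins3) _ _ _ _ => //.
  move=> j i'; rewrite cB3; case: exists_inP => [[]//|_].
  by rewrite !andbF orbF.
move=> k s4 kn s4k fr4 Ik; pose x := Ordinal kn.
have ins4 : inputs s4 by apply: inputs_frame ins3 fr4 _.
have rt4 : reach_table s4 by move=> v w; rewrite fr4 // rt3.
have s4i : s4 x_i 0 = i by rewrite fr4.
have s4d : s4 x_d 0 = d by rewrite fr4.
have bad4 : (s4 x_bad 0 == 0) = `[< reaches e (interchanged m tau i d) >].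
  by rewrite fr4.
rewrite sem_seq; set s5 := sem decide s4.
have fr5 c : c \notin writes decide -> s5 c = s4 c by apply: sem_frame.
have ins5 : inputs s5 by apply: inputs_frame ins4 fr5 _.
have s5ok : s5 x_ok 0 = repairs i d x.
  rewrite /s5 /decide sem_seq sem_put; set s6 := update _ _ _ _.
  have fr6 c : c \notin [:: x_ok] -> s6 c = s4 c.
    by rewrite inE => ca; rewrite /s6 update_other.
  have ins6 : inputs s6 by apply: inputs_frame ins4 fr6 _.
  have rt6 : reach_table s6 by move=> v w; rewrite fr6 // rt4.
  have st : eval s6 (Get a_tau (Var x_i)) = tau i.
    by apply: eval_tau => //=; rewrite fr6.
  have sx : eval s6 (Var x_x) = x by rewrite /= fr6.
  have sd6 : eval s6 (Var x_d) = d by rewrite /= fr6.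
  have s6o : s6 x_ok 0 = 0 by rewrite /s6 updateE.
  rewrite /same_scc !sem_if !sem_skip sem_put !differ_eq0 st sx sd6.
  rewrite (eval_reach ins6 rt6 st sx) (eval_reach ins6 rt6 sx st) !eqb0.
  rewrite [eval _ (Var _)]/= fr6 // bad4 /repairs di im mat /=.
  have -> : (k == d :> nat) = (x == d) by [].
  have -> : (k == tau i :> nat) = (x == tau i) by [].
  rewrite inE; case: `[< _ >]; first by case: eqP.
  by case: eqP => //= _; case: connect => //=; case: connect.
have cov5 : I k s5 by move=> j i'; rewrite fr5.
rewrite sem_if sem_skip [eval _ _]/= s5ok eqb0.
have exE j : [exists x in Z j, (x < k.+1) && repairs i d x] =
    [exists x in Z j, (x < k) && repairs i d x] || ((x \in Z j) && repairs i d x).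
  apply/exists_inP/orP => [[y yj]|[/exists_inP[y yj /andP[yk oky]]|/andP[xj okx]]].
  - rewrite ltnS leq_eqVlt => /andP[/orP[/eqP yk|yk] oky].
      by right; rewrite (_ : x = y) ?yj //; apply: val_inj.
    by left; apply/exists_inP; exists y; rewrite ?yk.
  - by exists y; rewrite // ltnS ltnW.
  - by exists x; rewrite // ltnS leqnn.
case: ifPn => [nok|/negbNE okx].
  by move=> j i'; rewrite cov5 exE (negPf nok) andbF orbF.
have s5x : s5 x_x 0 = x by rewrite fr5.
have s5i : s5 x_i 0 = i by rewrite fr5.
have s5d : s5 x_d 0 = d by rewrite fr5.
have mc := @mark_covers_spec s5 _ i d x ins5 s5i s5d s5x cov5.
move=> j i'; rewrite mc exE okx andbT; congr nat_of_bool.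
by case: (B j i'); case: (i' == i); case: (d \in Z j).
Qed.

Lemma fill_cover_spec s : inputs s -> reach_table s ->
    injective tau -> m <= p -> covers s (fun _ _ => false) ->
  covers (sem fill_cover s)
    (fun j i => [exists d in Z j, exists x in Z j, repairs i d x]).
Proof.
move=> ins rt tau_inj mp c0.
pose G j i := [exists d in Z j, exists x in Z j, repairs i d x].
pose I k (s' : store) := covers s' (fun j i => (i < k) && G j i).
suff H : I p (sem fill_cover s) by move=> j i; rewrite H ltn_ord.
apply: for_ind (in_p ins) _ _ _ _ => //.
move=> k s1 kp s1k fr1 Ik; pose i := Ordinal kp.
have ins1 : inputs s1 by apply: inputs_frame ins fr1 _.
have rt1 : reach_table s1 by move=> v w; rewrite fr1 // rt.
pose J l (s' : store) := covers s' (fun j i' => (i' < k) && G j i' ||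
   (i' == i) && [exists d in Z j, (d < l) && [exists x in Z j, repairs i d x]]).
set q := PFor _ _ _; suff H : J n (sem q s1).
  move=> j i'; rewrite H; congr nat_of_bool.
  have -> : (i' < k.+1) = (i' == i) || (i' < k) by rewrite ltnS leq_eqVlt.
  have [->|] /= := eqVneq i' i; last by rewrite orbF.
  rewrite ltnn /=; apply: eq_existsb => d; by rewrite ltn_ord.
apply: for_ind (in_n ins1) _ _ _ _ => //.
  move=> j i'; rewrite Ik; case: exists_inP => [[]//|_].
  by rewrite andbF orbF.
move=> l s2 ln s2l fr2 Jl; pose d := Ordinal ln.
have ins2 : inputs s2 by apply: inputs_frame ins1 fr2 _.
have rt2 : reach_table s2 by move=> v w; rewrite fr2 // rt1.
have s2i : s2 x_i 0 = i by rewrite fr2.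
have te := @try_element_spec s2 _ i d ins2 rt2 tau_inj mp s2i s2l Jl.
move=> j i'; rewrite te -orbA; congr (nat_of_bool (_ || _)).
have -> : [exists d in Z j, (d < l.+1) && [exists x in Z j, repairs i d x]] =
    [exists d in Z j, (d < l) && [exists x in Z j, repairs i d x]] ||
    ((d \in Z j) && [exists x in Z j, repairs i d x]).
  apply/exists_inP/orP => [[y yj]|[/exists_inP[y yj /andP[yk oky]]|/andP[xj okx]]].
  - rewrite ltnS leq_eqVlt => /andP[/orP[/eqP yk|yk] oky].
      by right; rewrite (_ : d = y) ?yj //; apply: val_inj.
    by left; apply/exists_inP; exists y; rewrite ?yk.
  - by exists y; rewrite // ltnS ltnW.
  - by exists d; rewrite // ltnS leqnn.
by case: (i' == i).
Qed.

Lemma setup_spec s : stores_system s m A tau Z ->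
  [/\ sem setup s x_m 0 = m, sem setup s x_p 0 = p, sem setup s x_N 0 = N
    & sem setup s x_n1 0 = n.+1].
Proof.
move=> [[sn sm sp] _ _ _]; rewrite /setup 4!sem_seq !sem_put.
set s1 := update s _ _ _; set s2 := update s1 _ _ _; set s3 := update s2 _ _ _.
set s4 := update s3 _ _ _.
have s4n : s4 a_sizes 0 = n by [].
set q := PFor _ _ _.
have frq c : c \notin [:: x_k; x_N] -> sem q s4 c = s4 c by move=> ca; apply: sem_frame.
split.
- by rewrite frq.
- by rewrite frq.
- pose I k (s' : store) := s' x_N 0 = k + 'C(k, 2).
  suff : I n (sem q s4) by [].
  apply: for_ind s4n _ _ _ _ => // k s' kn s'k fr Ik.
  rewrite /I sem_put updateE /= Ik s'k binS bin1; lia.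
- by rewrite frq // /s4 /s3 /s2 /s1 /update /= sn addn1.
Qed.

Lemma tabulate_spec s : stores_system s m A tau Z -> injective tau -> m <= p ->
  let s' := sem tabulate (sem setup s) in
  stores_set_cover s' (fun j => #|Z j|)
    (fun j => [set i | [exists d in Z j, exists x in Z j, repairs i d x]]).
Proof.
move=> st tau_inj mp; have [h_m h_p h_N h_n1] := setup_spec st.
case: st => [[sn _ _] sA sT sZ].
rewrite /tabulate 5!sem_seq; set s0 := sem setup s.
have fr0 c : c \notin writes setup -> s0 c = s c by apply: sem_frame.
have s0n : s0 a_sizes 0 = n by rewrite fr0.
set s1 := sem _ s0.
have fr1 c : c \notin [:: a_rown; x_k; a_rown] -> s1 c = s0 c by move=> ca; apply: sem_frame.
have rown : forall k, k <= N -> s1 a_rown k = k * n :=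
  @row_starts_spec N s0 a_rown a_sizes n h_N s0n isT isT isT isT.
set s2 := sem _ s1.
have fr2 c : c \notin [:: a_rowp; x_k; a_rowp] -> s2 c = s1 c by move=> ca; apply: sem_frame.
have [s1N s1p] : s1 x_N 0 = N /\ s1 x_p 0 = p by rewrite !fr1.
have rowp : forall k, k <= N -> s2 a_rowp k = k * p :=
  @row_starts_spec N s1 a_rowp x_p p s1N s1p isT isT isT isT.
have ins2 : inputs s2.
  split; try by rewrite fr2 // fr1.
  - by move=> i j; rewrite fr2 // fr1 // fr0.
  - by move=> i; rewrite fr2 // fr1 // fr0.
  - by move=> j k; rewrite fr2 // fr1 // fr0.
  - by move=> k kN; rewrite fr2 // rown // ltnW.
  - by move=> k kN; rewrite rowp // ltnW.
have [outp outN outc] := sizes_and_costs_spec ins2.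
set s3 := sem sizes_and_costs s2.
have ins3 : inputs s3 by apply: inputs_sem ins2 _.
have cc := clear_cover_spec ins3.
set s4 := sem clear_cover s3.
have ins4 : inputs s4 by apply: inputs_sem ins3 _.
have cl := closure_spec ins4.
set s5 := sem closure s4.
have ins5 : inputs s5 by apply: inputs_sem ins4 _.
have c5 : covers s5 (fun _ _ => false).
  by move=> j i; rewrite /s5 sem_frame // cc.
have fc := fill_cover_spec ins5 cl tau_inj mp c5.
have fr c : c \notin writes clear_cover -> c \notin writes closure ->
    c \notin writes fill_cover -> sem fill_cover s5 c = s3 c.
  by move=> c1 c2 c3; rewrite (sem_frame _ c3) /s5 (sem_frame _ c2) /s4 (sem_frame _ c1).
split.
- by rewrite fr.
- by rewrite fr.
- by move=> j; rewrite fr // outc.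
- by move=> j i; rewrite fc inE.
Qed.

Definition construct : cmd := Seq (code setup) (code tabulate).
Definition construct_time (n : nat) : nat :=
  coefficient setup * n.+1 + coefficient tabulate * n.+1 ^ 5.

Lemma construct_spec s : stores_system s m A tau Z -> injective tau -> m <= p ->
  exists t s', [/\ exec construct s t s', t <= construct_time n
    & stores_set_cover s' (fun j => #|Z j|)
        (fun j => [set i | [exists d in Z j, exists x in Z j, repairs i d x]])].
Proof.
move=> st tau_inj mp; have pn : p <= n.
  by have := leq_card _ tau_inj; rewrite !card_ord.
have [h_m h_p h_N h_n1] := setup_spec st.
have sn : s a_sizes 0 = n by case: st => -[].
have [t1 e1 t1le] : exists2 t, exec (code setup) s t (sem setup s)
    & t <= coefficient setup * n.+1.
  have [||t et tle] := @exec_code size_exponent n.+1 setup s isT isT.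
  - by apply/allP.
  - by move=> b; rewrite inE => /eqP ->; rewrite sn expn1.
  - by exists t => //; move: tle; rewrite expn1.
have [t2 e2 t2le] : exists2 t, exec (code tabulate) (sem setup s) t
     (sem tabulate (sem setup s)) & t <= coefficient tabulate * n.+1 ^ 5.
  have [|||t et tle] := @exec_code size_exponent n.+1 tabulate (sem setup s) isT.
  - by [].
  - exact/allP/tabulate_bounds.
  - have sn' : sem setup s a_sizes 0 = n by rewrite sem_frame.
    have N2 : N <= n.+1 ^ 2 by have := bin2 n; nia.
    move=> b bB; have : b \in [:: a_sizes; x_m; x_p; x_N; x_n1].
      by move: b bB; apply/allP.
    rewrite !inE => /or4P[/eqP ->|/eqP ->|/eqP ->|/orP[/eqP ->|/eqP ->]].
    + by rewrite sn' expn1.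
    + by rewrite h_m expn1; lia.
    + by rewrite h_p expn1; lia.
    + by rewrite h_N.
    + by rewrite h_n1 expn1.
  - by exists t => //; rewrite tabulate_degree in tle.
exists (t1 + t2), (sem tabulate (sem setup s)); split.
- exact: ExecSeq e1 e2.
- exact: leq_add.
- exact: tabulate_spec.
Qed.

End Repairs.

(** * Choosing a cover *)

Definition read_sizes : prog :=
  x_p ::= Get a_out (Cst 0) ;; x_N ::= Get a_out (Cst 1).

(** As costs are 1 or 2, the difference 2 - c_j is nonzero exactly for
    singletons. *)
Definition scan_subset : prog :=
  PPut a_sel (Var x_j) (Cst 0) ;;
  x_ok ::= Sub (Cst 2) (Get a_cost (Var x_j)) ;;
  (for x_i below x_p do
     PIf (entry a_cover a_rowp (Var x_j) (Var x_i)) PSkip (x_ok ::= Cst 0)) ;;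
  when Var x_ok do x_best ::= succ_of (Var x_j).

Definition select_for_each : prog :=
  for x_i below x_p do
    ((for x_j below x_N do
        when entry a_cover a_rowp (Var x_j) (Var x_i) do x_bid ::= Var x_j) ;;
     PPut a_sel (Var x_bid) (Cst 1)).

(** If no perfect set was found, the last set containing i is chosen for each i;
    hence at most p sets are chosen. *)
Definition choose : prog :=
  row_starts a_rowp x_p ;;
  x_best ::= Cst 0 ;;
  (for x_j below x_N do scan_subset) ;;
  PIf (Var x_best)
    (PPut a_sel (pred_of (Var x_best)) (Cst 1))
    select_for_each.

Definition approximate : cmd := Seq (code read_sizes) (code choose).
Definition approximate_time (n : nat) : nat :=
  coefficient read_sizes + coefficient choose * n.+1 ^ 3.

Section Choice.
Variables (p N : nat) (c : 'I_N -> nat) (V : 'I_N -> {set 'I_p}).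
Hypothesis c12 : forall j, c j = 1 \/ c j = 2.
Hypothesis coverable : exists J, is_cover V J.

(** A singleton that covers everything: choosing it alone adds one element to
    F. *)
Definition perfect j := (c j == 1) && (V j == [set: 'I_p]).

Definition good_choice (J : {set 'I_N}) : Prop :=
  (exists2 j, perfect j & J = [set j]) \/
  [/\ forall j, ~~ perfect j, #|J| <= p & is_cover V J].

Record instance (s : store) : Prop := Instance {
  inst_p : s x_p 0 = p; inst_N : s x_N 0 = N;
  inst_c : forall j : 'I_N, s a_cost j = c j;
  inst_V : forall (j : 'I_N) (i : 'I_p), s a_cover (j * p + i) = (i \in V j);
  inst_row : forall k, k < N -> s a_rowp k = k * p }.

Lemma instance_frame (W : seq nat) s s' :
    instance s -> (forall a, a \notin W -> s' a = s a) ->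
    all (fun a => a \notin W) [:: x_p; x_N; a_cost; a_cover; a_rowp] ->
  instance s'.
Proof.
move=> [H1 H2 H3 H4 H5] fr /and5P[W1 W2 W3 W4 /andP[W5 _]].
by split; rewrite ?fr // => *; rewrite fr.
Qed.

Lemma eval_cover s x y (j : 'I_N) (i : 'I_p) : instance s ->
    eval s x = j -> eval s y = i ->
  eval s (entry a_cover a_rowp x y) = (i \in V j).
Proof. by move=> ins /= -> ->; rewrite (inst_row ins) // (inst_V ins). Qed.

Lemma scan_subset_spec s (j : 'I_N) : instance s -> s x_j 0 = j ->
  sem scan_subset s x_best 0 = (if perfect j then j.+1 else s x_best 0) /\
  forall k, sem scan_subset s a_sel k = if k == j :> nat then 0 else s a_sel k.
Proof.
move=> ins sj; rewrite /scan_subset !sem_seq !sem_put.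
set s1 := update s _ _ _; set s2 := update s1 _ _ _.
have fr2 a : a \notin [:: a_sel; x_ok] -> s2 a = s a.
  by rewrite !inE negb_or => /andP[a1 a2]; rewrite /s2 /s1 !update_other.
have ins2 : instance s2 by apply: instance_frame ins fr2 _.
have s2j : s2 x_j 0 = j by rewrite fr2.
set s3 := sem _ s2.
have s3ok : (s3 x_ok 0 != 0) = perfect j.
  pose I k (s' : store) := (s' x_ok 0 != 0) =
    (c j == 1) && [forall i : 'I_p, (i < k) ==> (i \in V j)].
  have : I p s3.
    apply: for_ind (inst_p ins2) _ _ _ _ => //.
      rewrite /I /s2 /s1 /update /= sj (inst_c ins).
      rewrite (_ : [forall i, _] = true); last by apply/forallP.
      by have := c12 j; case: (c j) => [|[|[|?]]] // [].
    move=> k s' kp s'k fr Ik; have ins' : instance s' by apply: instance_frame ins2 fr _.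
    rewrite sem_if sem_skip sem_put (@eval_cover _ _ _ j (Ordinal kp)) //; last by rewrite /= fr.
    rewrite eqb0 /I.
    have -> : [forall i : 'I_p, (i < k.+1) ==> (i \in V j)] =
       (Ordinal kp \in V j) && [forall i : 'I_p, (i < k) ==> (i \in V j)].
      apply/forallP/andP => [H|[hu /forallP H] v].
        split; first by have := H (Ordinal kp); rewrite ltnSn.
        apply/forallP => v; apply/implyP => vk.
        by have := H v; rewrite ltnS ltnW.
      apply/implyP; rewrite ltnS leq_eqVlt => /orP[/eqP vk|vk].
        by rewrite (_ : v = Ordinal kp) //; apply: val_inj.
      by have := H v; rewrite vk.
    case: ifPn => [/negPf ->|/negbNE ->]; last exact: Ik.
    by rewrite updateE andbF.
  rewrite /I => ->; congr (_ && _); apply/forallP/eqP => [H|->].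
    2: by move=> i; rewrite inE implybT.
  by apply/setP => i; have := H i; rewrite ltn_ord inE.
have s3j : s3 x_j 0 = j by rewrite /s3 sem_frame.
have s3b : s3 x_best 0 = s x_best 0 by rewrite /s3 sem_frame // fr2.
have s3s k : s3 a_sel k = if k == j :> nat then 0 else s a_sel k.
  by rewrite /s3 sem_frame // /s2 /s1 /update /= sj.
rewrite sem_if sem_skip sem_put [eval _ (Var _)]/= -s3ok.
by case: eqP => [_|_] /=; split=> // *; rewrite ?s3s // updateE /= s3j addn1.
Qed.

Lemma select_for_each_spec s : instance s -> (forall j : 'I_N, s a_sel j = 0) ->
  exists J : {set 'I_N}, [/\ stores_selection (sem select_for_each s) J,
    #|J| <= p & is_cover V J].
Proof.
move=> ins s0.
pose I k (s' : store) := exists J : {set 'I_N}, [/\ stores_selection s' J,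
  #|J| <= k & forall i : 'I_p, i < k -> exists2 j, j \in J & i \in V j].
suff [J [sJ Jp JV]] : I p (sem select_for_each s).
  exists J; split=> //; apply/fintype.subsetP => i _.
  by have [j jJ ij] := JV i (ltn_ord i); apply/bigcupP; exists j.
apply: for_ind (inst_p ins) _ _ _ _ => //.
  exists finset.set0; split=> //; first by move=> j; rewrite inE s0.
  by rewrite cards0.
move=> k s1 kp s1k fr1 [J [sJ Jk JV]]; pose i := Ordinal kp.
have ins1 : instance s1 by apply: instance_frame ins fr1 _.
rewrite sem_seq; set s2 := sem _ s1.
have [j s2b ij] : exists2 j : 'I_N, s2 x_bid 0 = j & i \in V j.
  pose G l (s' : store) := (exists2 j : 'I_N, s' x_bid 0 = j & i \in V j) \/
    forall j : 'I_N, j < l -> i \notin V j.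
  have : G N s2.
    apply: for_ind (inst_N ins1) _ _ _ _ => //; first by right.
    move=> l s' lN s'l fr Gl; have ins' : instance s' by apply: instance_frame ins1 fr _.
    rewrite sem_if sem_skip sem_put (@eval_cover _ _ _ (Ordinal lN) i) //; last by rewrite /= fr.
    rewrite eqb0; case: ifPn => [nil|/negbNE il].
      case: Gl => [?|Gl]; [by left|right=> j].
      rewrite ltnS leq_eqVlt => /orP[/eqP jl|]; last exact: Gl.
      by rewrite (_ : j = Ordinal lN) //; apply: val_inj.
    by left; exists (Ordinal lN) => //; rewrite updateE /=.
  case=> // none; have [J0 /fintype.subsetP/(_ i)] := coverable.
  rewrite inE => /(_ isT)/bigcupP[j _ ij].
  by have := none j (ltn_ord j); rewrite ij.
have s2s k' : s2 a_sel k' = s1 a_sel k' by rewrite /s2 sem_frame.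
exists (j |: J); split.
- move=> j'; rewrite sem_put /update /= s2b s2s inE sJ !inE.
  have -> : (j' == j :> nat) = (j' == j) by [].
  by case: (j' == j).
- by apply: leq_trans (leq_card_setU _ _) _; rewrite cards1 add1n.
- move=> i'; rewrite ltnS leq_eqVlt => /orP[/eqP i'k|i'k].
    by exists j; rewrite ?setU11 // (_ : i' = i) //; apply: val_inj.
  by have [j' j'J i'j'] := JV i' i'k; exists j'; rewrite // inE j'J orbT.
Qed.

Lemma choose_spec s : s x_p 0 = p -> s x_N 0 = N ->
    (forall j : 'I_N, s a_cost j = c j) ->
    (forall (j : 'I_N) (i : 'I_p), s a_cover (j * p + i) = (i \in V j)) ->
  exists2 J, stores_selection (sem choose s) J & good_choice J.
Proof.
move=> sp sN sc sV; rewrite /choose 3!sem_seq.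
set s1 := sem _ s.
have rowp : forall k, k <= N -> s1 a_rowp k = k * p :=
  @row_starts_spec N s a_rowp x_p p sN sp isT isT isT isT.
have fr1 a : a \notin [:: a_rowp; x_k; a_rowp] -> s1 a = s a.
  by move=> ca; apply: sem_frame.
have ins1 : instance s1.
  split.
  - by rewrite fr1.
  - by rewrite fr1.
  - by move=> j; rewrite fr1 // sc.
  - by move=> j i; rewrite fr1 // sV.
  - by move=> k kN; rewrite rowp // ltnW.
rewrite sem_put; set s2 := update _ _ _ _.
have fr2 a : a \notin [:: x_best] -> s2 a = s1 a.
  by rewrite inE => ca; rewrite /s2 update_other.
have ins2 : instance s2 by apply: instance_frame ins1 fr2 _.
set s3 := sem _ s2.
have [s3s s3b] : (forall j : 'I_N, s3 a_sel j = 0) /\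
    ((s3 x_best 0 = 0 /\ forall j, ~~ perfect j) \/
     exists2 j : 'I_N, s3 x_best 0 = j.+1 & perfect j).
  pose I k (s' : store) := (forall j : 'I_N, j < k -> s' a_sel j = 0) /\
    ((s' x_best 0 = 0 /\ forall j : 'I_N, j < k -> ~~ perfect j) \/
     exists2 j : 'I_N, s' x_best 0 = j.+1 & perfect j).
  suff [I1 I2] : I N s3.
    split=> [j|]; first exact: I1.
    by case: I2 => [[b0 np]|?]; [left; split=> // j; apply: np|right].
  apply: for_ind (inst_N ins2) _ _ _ _ => //; first by split=> //; left.
  move=> k s4 kN s4k fr4 [I1 I2]; pose j := Ordinal kN.
  have ins4 : instance s4 by apply: instance_frame ins2 fr4 _.
  have [sb ss] := @scan_subset_spec s4 j ins4 s4k.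
  split=> [j'|].
    rewrite ltnS leq_eqVlt ss => /orP[->//|j'k].
    by case: ifP => // _; apply: I1.
  rewrite sb; case: ifPn => [pj|npj]; first by right; exists j.
  case: I2 => [[b0 np]|?]; [left|by right].
  split=> // j'; rewrite ltnS leq_eqVlt => /orP[/eqP j'k|]; last exact: np.
  by rewrite (_ : j' = j) //; apply: val_inj.
have ins3 : instance s3.
  apply: (instance_frame (W := writes (PFor x_j x_N scan_subset))) ins2 _ _ => // a.
  exact: sem_frame.
rewrite sem_if [eval _ _]/=; case: s3b => [[-> np]|[j s3b pj]] /=.
  have [J [sJ Jp JV]] := select_for_each_spec ins3 s3s.
  by exists J => //; right.
exists [set j]; last by left; exists j.
rewrite s3b /= => j'; rewrite sem_put /update /= s3b subn1 /= s3s inE.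
have -> : (j' == j :> nat) = (j' == j) by [].
by case: (j' == j).
Qed.

Lemma approximate_spec n s : stores_set_cover s c V -> p <= n -> N <= n.+1 ^ 2 ->
  exists t s' J, [/\ exec approximate s t s', t <= approximate_time n,
    stores_selection s' J & good_choice J].
Proof.
move=> [s4p s4N s5c s6V] pn Nn.
pose s1 := sem read_sizes s.
have fr1 a : a \notin [:: x_p; x_N] -> s1 a = s a by move=> ca; apply: sem_frame.
have s1p : s1 x_p 0 = p by [].
have s1N : s1 x_N 0 = N by [].
have [t1 e1 t1le] : exists2 t, exec (code read_sizes) s t s1
    & t <= coefficient read_sizes.
  have [||t et tle] := @exec_code size_exponent n.+1 read_sizes s isT isT.
  - by apply/allP.
  - by [].
  - by exists t => //; move: tle; rewrite expn0 muln1.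
have [t2 e2 t2le] : exists2 t, exec (code choose) s1 t (sem choose s1)
    & t <= coefficient choose * n.+1 ^ 3.
  have [||t et tle] := @exec_code size_exponent n.+1 choose s1 isT isT.
  - by apply/allP.
  - move=> b bB; have : b \in [:: x_p; x_N] by move: b bB; apply/allP.
    rewrite !inE => /orP[/eqP ->|/eqP ->]; last by rewrite s1N.
    by rewrite s1p expn1 ltnW.
  - by exists t.
have [J sJ gJ] : exists2 J, stores_selection (sem choose s1) J & good_choice J.
  by apply: choose_spec => // *; rewrite fr1.
exists (t1 + t2), (sem choose s1), J; split=> //; first exact: ExecSeq e1 e2.
exact: leq_add.
Qed.

End Choice.

(** * Back-ups and robustness *)

Local Open Scope ring_scope.

Lemma connect_stays (U : finType) (e : rel U) (C : {set U}) x y :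
    (forall v w, v \in C -> e v w -> w \in C) -> x \in C -> connect e x y ->
  y \in C.
Proof.
move=> closedC xC /connectP[q]; elim: q x xC => [|w q IH] x xC /=; first by move=> _ ->.
by move=> /andP[exw pq] yE; apply: IH pq yE; apply: closedC exw.
Qed.

Section BackUpSystem.
Variables (R : realType) (n : nat) (A : 'M[bool]_n) (F : {set 'I_n}).
Variables (ps cs : seq (walk 'I_n)) (p m : nat) (tau : 'I_p -> 'I_n).
Variable Z : 'I_(n + 'C(n, 2)) -> {set 'I_n}.
Hypothesis minF : min_feasible R A F.
Hypothesis decF : decomposes A m tau F ps cs.
Hypothesis enumZ : enumerates_small_sets Z.
Local Notation N := (n + 'C(n, 2))%N.
Local Notation e := (state_digraph A).
Local Notation T := (tip_part m tau).
Local Notation S := (sink_part m tau).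
Local Notation fixes := (repairs m A tau).
Local Notation V := (cover_set R A m tau Z).

Lemma tau_inj : injective tau. Proof. by case: decF. Qed.
Lemma leq_mp : (m <= p)%N. Proof. by case: decF. Qed.

Lemma F_tau i : tau i \in F.
Proof. by case: decF => _ -> *; apply: imset_f. Qed.

Lemma F_inv y : y \in F -> exists i, y = tau i.
Proof. by case: decF => _ -> _ _ _ /imsetP[i _ ->]; exists i. Qed.

Lemma card_F : #|F| = p.
Proof. by case: decF => inj -> *; rewrite card_imset // card_ord. Qed.

Lemma mem_T i : (tau i \in T) = (i < m)%N.
Proof.
apply/imsetP/idP => [[k]|im]; last by exists i; rewrite ?inE.
by rewrite inE => km /tau_inj ->.
Qed.

Lemma mem_S i : (tau i \in S) = (m <= i)%N.
Proof.
apply/imsetP/idP => [[k]|im]; last by exists i; rewrite ?inE.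
by rewrite inE => km /tau_inj ->.
Qed.

Lemma tip_set_T : is_tip_set e T.
Proof. by case: decF => _ _ _ [mins E] _; exists ps, cs. Qed.

Lemma matched_T : matched e T.
Proof. by have /is_tip_setP[] := tip_set_T. Qed.

Lemma min_T Y : matched e Y -> (#|T| <= #|Y|)%N.
Proof. by have /is_tip_setP[_ h] := tip_set_T; apply: h. Qed.

Lemma sub_T_F : T \subset F.
Proof. by apply/fintype.subsetP => y /imsetP[k _ ->]; apply: F_tau. Qed.

Lemma reaches_F : reaches e F.
Proof. by case: minF => /feasibleP[]. Qed.

Lemma feasible_sub (Y Y' : {set 'I_n}) :
  Y \subset Y' -> feasible R A Y -> feasible R A Y'.
Proof.
move=> sYY' /feasibleP[re ma]; apply/feasibleP; split; last exact: matched_sub ma.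
by move=> v; have [y yY vy] := re v; exists y; rewrite ?(fintype.subsetP sYY').
Qed.

(** Hence a matched interchanged set is a smallest matched set. *)
Lemma swap_smaller (i : 'I_p) (d : 'I_n) : (i < m)%N -> (#|swap_tip m tau i d| <= #|T|)%N.
Proof.
move=> im; apply: leq_trans (leq_card_setU _ _) _.
by rewrite cards1 [X in (_ <= X)%N](cardsD1 (tau i)) mem_T im.
Qed.

Lemma tip_alternativeE (i : 'I_p) (d : 'I_n) : (i < m)%N ->
  tip_alternative A m tau i d <->
  d != tau i /\ matched e (swap_tip m tau i d).
Proof.
move=> im; split=> [[di /is_tip_setP[]]|[di ma]]; first by [].
split=> //; apply/is_tip_setP; split=> // Y /min_T.
exact/leq_trans/swap_smaller.
Qed.

Lemma feasible_interchangedE (i : 'I_p) (d : 'I_n) :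
    matched e (swap_tip m tau i d) ->
  feasible R A (interchanged m tau i d) <-> reaches e (interchanged m tau i d).
Proof.
move=> ma; split=> [/feasibleP[]//|re]; apply/feasibleP; split=> //.
exact: matched_sub (finset.subsetUl _ _) ma.
Qed.

(** The representative is alone: a further element of F in its component would
    be a tip, or a second representative. *)
Lemma sink_part_scc (i : 'I_p) : (m <= i)%N -> is_sink_scc e (scc e (tau i)) /\
  forall k, tau k \in scc e (tau i) -> k = i.
Proof.
rewrite -mem_S => iS; case: decF => _ _ _ _ [uncov one].
have [sink dis] := uncov _ iS; split=> // k kC.
have /eqP/cards1P[y Cy] := one _ sink dis.
have iC : tau i \in scc e (tau i) by rewrite inE connect0.
have iy : tau i \in [set y] by rewrite -Cy inE iC.
have ky : tau k \in [set y].
  rewrite -Cy inE kC mem_S leqNgt -mem_T.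
  by apply/negP => kT; have := disjointFr dis kC; rewrite kT.
by move: iy ky; rewrite !inE => /eqP <- /eqP/tau_inj.
Qed.

Lemma back_upE (i : 'I_p) (Y : {set 'I_n}) :
  back_up R A m tau i Y <-> exists d x, fixes i d x /\ Y = [set d; x].
Proof.
rewrite /back_up /repairs; case: ifPn => im; last first.
  split=> [[d [[di dscc _] ->]]|[d [x [/andP[di /andP[/eqP -> dscc]] ->]]]].
    by exists d, d; rewrite di eqxx dscc finset.setUid.
  exists d; split; last by rewrite finset.setUid.
  by split=> //; have [] := @sink_part_scc i; rewrite // leqNgt.
split=> [[d [/(tip_alternativeE _ im)[di ma] H]]|[d [x [/and3P[di /asboolP ma H] ->]]]].
  have E := feasible_interchangedE ma.
  case: H => [[/E re ->]|[nre [x [xi xscc ->]]]].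
    exists d, d; rewrite di finset.setUid; split=> //=.
    by apply/andP; split; [apply/asboolP|rewrite (asboolT re)].
  exists d, x; rewrite di xi xscc; split=> //=.
  apply/andP; split; first exact/asboolP.
  by rewrite asboolF // => /E.
exists d; split; first exact/tip_alternativeE.
have E := feasible_interchangedE ma.
move: H; case: asboolP => [re /eqP ->|nre /andP[xi xscc]]; [left|right].
  by rewrite finset.setUid; split=> //; apply/E.
by split; [move/E|exists x].
Qed.

(** The two-element sets inherit the back-ups that are singletons contained in
    them, which is the case d = x; for d <> x the set Z_j, having at most two
    elements, equals the pair. *)
Lemma cover_setE j i :
  (i \in V j) = [exists d in Z j, exists x in Z j, fixes i d x].
Proof.
case: enumZ => _ small single _.
have card_Z : #|Z j| = 1%N \/ #|Z j| = 2%N by apply/small/codom_f.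
apply/idP/exists_inP => [|[d dj /exists_inP[x xj fixdx]]].
  have direct : i \in backed_up_by R A m tau (Z j) ->
      exists2 d, d \in Z j & [exists x in Z j, fixes i d x].
    rewrite inE => /asboolP/back_upE[d [x [fixdx ->]]].
    by exists d; rewrite ?set21 //; apply/exists_inP; exists x; rewrite ?set22.
  rewrite /cover_set; case: ifP => // _; rewrite inE => /orP[//|/bigcupP[k kj]].
  rewrite inE => /asboolP/back_upE[d [x [fixdx]]]; rewrite single => E.
  have /set1P dk : d \in [set k] by rewrite E set21.
  have /set1P xk : x \in [set k] by rewrite E set22.
  rewrite dk xk in fixdx; exists k => //; apply/exists_inP; by exists k.
have back k : d = k -> x = k -> i \in backed_up_by R A m tau (Z (lshift _ k)).
  move=> dk xk; rewrite inE; apply/asboolP/back_upE; exists d, x.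
  by rewrite dk xk finset.setUid single -{1}dk -{1}xk.
rewrite /cover_set; case: ifPn => jn.
  have jE : j = lshift _ (Ordinal jn) by apply: val_inj.
  have /set1P dk : d \in [set Ordinal jn] by rewrite -single -jE.
  have /set1P xk : x \in [set Ordinal jn] by rewrite -single -jE.
  by rewrite jE; apply: back.
have [dx|dx] := eqVneq d x.
  rewrite inE; apply/orP; right; apply/bigcupP; exists d => //; exact: back.
rewrite inE; apply/orP; left; rewrite inE; apply/asboolP/back_upE.
exists d, x; split=> //; apply/esym/eqP; rewrite eqEcard cards2 dx.
apply/andP; split; last by case: card_Z => ->.
by apply/fintype.subsetP => y /set2P[] ->.
Qed.

(** If the interchange leaves a vertex without observed descendant, that vertex
    used to reach the lost state, hence reaches x in the same component. *)
Lemma repairs_feasible i d x : fixes i d x ->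
  [/\ d != tau i, x != tau i & feasible R A (d |: (x |: F :\ tau i))].
Proof.
rewrite /repairs => /andP[di]; case: ifPn => [im|mi].
  move=> /andP[/asboolP ma fixx].
  have ma' : matched e (d |: (x |: F :\ tau i)).
    apply: matched_sub ma; apply: finset.setUS; apply: fintype.subset_trans (finset.subsetUr _ _).
    exact: finset.setSD sub_T_F.
  move: fixx; case: asboolP => [re /eqP xd|nre /andP[xi]].
    split; rewrite ?xd //; apply/feasibleP; split; last by move: ma'; rewrite xd.
    move=> v; have [y yI vy] := re v; exists y => //; move: yI.
    rewrite (interchangedE _ tau_inj im) !inE => /orP[->//|/imsetP[k]].
    by rewrite inE => ki ->; rewrite F_tau (inj_eq tau_inj) ki !orbT.
  rewrite inE => /andP[ix xi']; split=> //; apply/feasibleP; split=> // v.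
  have [y yF vy] := reaches_F v; have [yi|yi] := eqVneq y (tau i).
    by exists x; rewrite ?(connect_trans vy) ?yi // !inE eqxx orbT.
  by exists y; rewrite // !inE yi yF !orbT.
move=> /andP[/eqP ->]; rewrite inE => /andP[id di']; split=> //.
apply/feasibleP; split=> [v|].
  have [y yF vy] := reaches_F v; have [yi|yi] := eqVneq y (tau i).
    by exists d; rewrite ?(connect_trans vy) ?yi // !inE eqxx.
  by exists y; rewrite // !inE yi yF !orbT.
apply: matched_sub matched_T; apply/fintype.subsetP => y yT.
rewrite !inE (fintype.subsetP sub_T_F) // andbT.
suff -> : y != tau i by rewrite !orbT.
by apply: contraNneq mi => yi; rewrite -mem_T -yi.
Qed.

(** Losing an added element leaves a superset of F; losing the i-th element of F
    is repaired by the two elements that make Z_j cover i. *)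
Lemma cover_robust J : is_cover V J -> s_robust R A (\bigcup_(j in J) Z j :|: F).
Proof.
move=> /fintype.subsetP covJ x xF'.
have [xF|xF] := boolP (x \in F); last first.
  apply: feasible_sub minF.1; apply/fintype.subsetP => y yF; rewrite !inE yF orbT andbT.
  by apply: contraNneq xF => <-.
have [i xi] := F_inv xF; rewrite {x xF' xF}xi.
have /bigcupP[j jJ] := covJ i (finset.in_setT i).
rewrite cover_setE => /exists_inP[d dj /exists_inP[x xj /repairs_feasible[di xi fe]]].
apply: feasible_sub fe; apply/fintype.subsetP => y.
have inF' z : z \in Z j -> z \in \bigcup_(j in J) Z j.
  by move=> zj; apply/bigcupP; exists j.
rewrite !inE => /or3P[/eqP ->|/eqP ->|/andP[-> ->]]; last by rewrite orbT.
  by rewrite di inF'.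
by rewrite xi inF'.
Qed.

Lemma drop_infeasible i : ~ feasible R A (F :\ tau i).
Proof.
by case: minF => _ min /min; rewrite (cardsD1 (tau i) F) F_tau ltnn.
Qed.

(** For a representative of a sink component, y must lie in that component, as
    the lost state reaches nothing else.  For a tip, the exchange property gives
    some d with which to replace it.  If d is y the claim holds.  It cannot be
    another tip, by minimality of the tip set.  If d represents a sink
    component, then y lies in the same component, and F without the tip would
    already be feasible, contradicting the minimality of F. *)
Lemma single_extra_repairs y : y \notin F -> s_robust R A (y |: F) ->
  forall i, fixes i y y.
Proof.
move=> yF rob i.
have yi k : y != tau k by apply: contraNneq yF => ->; apply: F_tau.
have GE k : (y |: F) :\ tau k = y |: F :\ tau k.
  by apply/setP => z; rewrite !inE; have [->|] := eqVneq z y; rewrite ?yi.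
have fe k : feasible R A (y |: F :\ tau k).
  by rewrite -GE; apply: rob; rewrite inE F_tau orbT.
have sink_case (k : 'I_p) : (m <= k)%N -> y \in scc e (tau k).
  move=> mk; have [[_ sink] uniq_k] := sink_part_scc mk.
  have /feasibleP[/(_ (tau k))[z zY kz] _] := fe k.
  have zC : z \in scc e (tau k).
    have tC : tau k \in scc e (tau k) by rewrite inE connect0.
    exact: connect_stays sink tC kz.
  move: zY; rewrite !inE => /orP[/eqP <-|/andP[zk /F_inv[l zl]]].
    by move: zC; rewrite inE.
  by move: zk; rewrite zl (uniq_k l) ?eqxx // -zl.
rewrite /repairs yi eqxx /=; case: ifPn => im; last by apply: sink_case; rewrite leqNgt.
have interE : interchanged m tau i y = y |: F :\ tau i.
  rewrite (interchangedE _ tau_inj im); congr (_ |: _); apply/setP => z.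
  rewrite !inE; apply/imsetP/andP => [[k]|[zi /F_inv[k zk]]].
    by rewrite inE => ki ->; rewrite F_tau (inj_eq tau_inj).
  by exists k; rewrite // inE; apply: contraNneq zi => <-; rewrite zk.
have [re maW] : reaches e (y |: F :\ tau i) /\ matched e (y |: F :\ tau i).
  exact/feasibleP.
rewrite interE (asboolT re) andbT; apply/asboolP.
have iW : tau i \notin y |: F :\ tau i by rewrite !inE eqxx eq_sym (negPf (yi i)).
have noT : ~ matched e (T :\ tau i).
  by move/min_T; rewrite (cardsD1 (tau i) T) mem_T im ltnn.
have iT : tau i \in T by rewrite mem_T.
have [//|[d dW mad]] := matched_exchange matched_T maW iT iW.
move: dW; rewrite !inE => /orP[/eqP dy|/andP[di /F_inv[k dk]]].
  by rewrite /swap_tip -dy.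
rewrite dk in di mad.
have [km|mk] := ltnP k m.
  case: noT; rewrite (finset.setUidPr _) // in mad.
  by apply/fintype.subsetP => z /set1P ->; rewrite !inE mem_T km di.
case: (@drop_infeasible i); apply/feasibleP; split.
  move=> v; have [z zW vz] := re v; move: zW; rewrite 2!inE => /orP[/eqP zy|zF]; last by exists z.
  exists (tau k); first by rewrite !inE di F_tau.
  have := sink_case k mk; rewrite inE => /andP[_ yk].
  by apply: connect_trans vz _; rewrite zy.
apply: matched_sub mad; apply/fintype.subsetP => z; rewrite !inE.
by case/orP => [/eqP ->|/andP[-> /(fintype.subsetP sub_T_F)]] //; rewrite di F_tau.
Qed.

End BackUpSystem.

(** Equality holds for p = 1.  The increment from p to p + 1 is
    H(p) - 2 + 2 / (p+1), which vanishes for p = 1 and increases with p. *)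
Lemma harmonic_ge (R : realFieldType) (p : nat) : (0 < p)%N ->
  3 * p%:R <= (p%:R + 2) * \sum_(1 <= k < p.+1) (k%:R : R)^-1.
Proof.
move=> p0; pose H q : R := \sum_(1 <= k < q.+1) (k%:R : R)^-1.
have HS q : H q.+1 = H q + (q.+1%:R)^-1 by rewrite /H big_nat_recr.
have H1 : H 1%N = 1 by rewrite /H big_nat1 invr1.
have low q : 2 <= H q.+1 + 2 * (q.+2%:R)^-1.
  elim: q => [|q IH]; first by rewrite H1; lra.
  rewrite HS; apply: le_trans IH _.
  rewrite -addrA lerD2l.
  have q2 : (0 : R) < q.+2%:R by rewrite ltr0n.
  have q3 : (0 : R) < q.+3%:R by rewrite ltr0n.
  rewrite -subr_ge0.
  have -> : q.+2%:R^-1 + 2 / q.+3%:R - 2 / q.+2%:R =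
      (q.+1%:R) / (q.+2%:R * q.+3%:R) :> R.
    rewrite -!natr1; field.
    by rewrite !natr1 -?natrD ?pnatr_eq0.
  by rewrite divr_ge0 ?mulr_ge0 ?ler0n.
suff : forall q, 3 * q.+1%:R <= (q.+1%:R + 2) * H q.+1.
  by case: p p0 => // q _; apply.
elim=> [|q IH]; first by rewrite H1; lra.
rewrite HS [X in _ <= X]mulrDr.
have q2 : (0 : R) < q.+2%:R by rewrite ltr0n.
have E : (q.+2%:R + 2) * (q.+2%:R)^-1 = 1 + 2 * (q.+2%:R)^-1 :> R.
  by rewrite mulrDl divff ?gt_eqF.
have := low q; rewrite E; move: IH; rewrite -[q.+2%:R]natr1; nra.
Qed.

(** * Complexity and performance ratio *)

Lemma polynomial_bigO (R : realType) (f : nat -> nat) (C k : nat) :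
    (forall n, (0 < n)%N -> (f n <= C * n ^ k)%N) ->
  (fun n => (f n)%:R : R) =O_eventually (fun n => (n%:R : R) ^+ k).
Proof.
move=> fC; apply/eqO_exP; exists (C.+1%:R); first by rewrite ltr0n.
near=> n; rewrite normr_nat normrX normr_nat -natrX -natrM ler_nat.
apply: leq_trans (fC n _) _; last by rewrite leq_mul2r leqnSn orbT.
by near: n; exists 1%N.
Unshelve. all: by end_near.
Qed.

Lemma construct_time_leq n : (0 < n)%N ->
  (construct_time n <= (32 * (coefficient setup + coefficient tabulate)) * n ^ 5)%N.
Proof.
move=> n0; rewrite /construct_time.
set a := coefficient setup; set b := coefficient tabulate.
have n5 : (n.+1 ^ 5 <= 32 * n ^ 5)%N by rewrite -(expnMn 2 n 5) leq_exp2r //; lia.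
have n1 : (n.+1 <= n.+1 ^ 5)%N by rewrite -{1}[n.+1]expn1 leq_pexp2l.
have h1 : (a * n.+1 <= a * (32 * n ^ 5))%N by rewrite leq_mul2l (leq_trans n1) ?orbT.
have h2 : (b * n.+1 ^ 5 <= b * (32 * n ^ 5))%N by rewrite leq_mul2l n5 orbT.
by rewrite -mulnA mulnCA mulnDl leq_add.
Qed.

Lemma approximate_time_leq n : (0 < n)%N ->
  (approximate_time n <= (8 * (coefficient read_sizes + coefficient choose)) * n ^ 3)%N.
Proof.
move=> n0; rewrite /approximate_time.
set a := coefficient read_sizes; set b := coefficient choose.
have n3 : (n.+1 ^ 3 <= 8 * n ^ 3)%N by rewrite -(expnMn 2 n 3) leq_exp2r //; lia.
have n1 : (1 <= 8 * n ^ 3)%N by rewrite muln_gt0 expn_gt0 n0.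
have h1 : (a <= a * (8 * n ^ 3))%N by rewrite leq_pmulr.
have h2 : (b * n.+1 ^ 3 <= b * (8 * n ^ 3))%N by rewrite leq_mul2l n3 orbT.
by rewrite -mulnA mulnCA mulnDl leq_add.
Qed.

(** The case p = 0 relies on the convention x / 0 = 0: there F is empty and so is
    the minimal G. *)
Lemma performance_ratio (R : realType) (n : nat) (A : 'M[bool]_n) (F : {set 'I_n})
    (ps cs : seq (walk 'I_n)) (p m : nat) (tau : 'I_p -> 'I_n)
    (Z : 'I_(n + 'C(n, 2)) -> {set 'I_n}) :
    min_feasible R A F -> decomposes A m tau F ps cs -> enumerates_small_sets Z ->
  forall J G, good_choice (fun j => #|Z j|) (cover_set R A m tau Z) J ->
    min_s_robust_containing R A F G ->
  #|(\bigcup_(j in J) Z j) :|: F|%:R / #|G|%:R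
    <= \sum_(1 <= k < p.+1) (k%:R : R)^-1.
Proof.
move=> minF decF enumZ J G gJ [FG robG minG].
set V := cover_set R A m tau Z in gJ *.
have cF := card_F decF.
have cU : (#|\bigcup_(j in J) Z j| <= \sum_(j in J) #|Z j|)%N.
  elim/big_rec2: _ => [|j k B _ IH]; first by rewrite cards0.
  by apply: leq_trans (leq_card_setU _ _) _; rewrite leq_add2l.
have [p0|p_gt0] := posnP p.
  have F0 : F = finset.set0 by apply: finset.cards0_eq; rewrite cF.
  have : (#|G| <= #|F|)%N by apply: minG => // x; rewrite F0 inE.
  rewrite cF {1}p0 leqn0 => /eqP ->; rewrite invr0 mulr0.
  by apply: sumr_ge0 => k _; rewrite invr_ge0.
have GF : (p < #|G|)%N.
  rewrite -cF; apply: proper_card; rewrite finset.properEneq FG andbT.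
  apply/eqP => FE; rewrite -FE in robG.
  pose i := Ordinal p_gt0.
  exact: (drop_infeasible minF decF (i := i)) (robG _ (F_tau decF i)).
have G0 : (0 : R) < #|G|%:R by rewrite ltr0n (leq_ltn_trans _ GF).
rewrite ler_pdivrMr //.
have H1 : (1 : R) <= \sum_(1 <= k < p.+1) (k%:R : R)^-1.
  rewrite big_ltn // invr1 lerDl; apply: sumr_ge0 => k _; by rewrite invr_ge0.
have cF' : (#|(\bigcup_(j in J) Z j) :|: F| <= \sum_(j in J) #|Z j| + p)%N.
  by apply: leq_trans (leq_card_setU _ _) _; rewrite cF leq_add2r.
case: gJ => [[j /andP[/eqP cj _] JE]|[np Jp _]].
  apply: (@le_trans _ _ #|G|%:R); last by rewrite ler_peMl // ltW.
  by rewrite ler_nat (leq_trans cF') // JE big_set1 cj add1n.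
have G2 : (p.+2 <= #|G|)%N.
  rewrite leqNgt ltnS; apply/negP => Gle.
  have GE : #|G| = p.+1 by apply/eqP; rewrite eqn_leq Gle.
  have /eqP/cards1P[y yE] : #|G :\: F| = 1%N.
    by rewrite cardsDS // GE cF subSnn.
  have yGF : y \in G :\: F by rewrite yE set11.
  have yF : y \notin F by move: yGF; rewrite inE => /andP[].
  have GyF : G = y |: F.
    apply/setP => z; have /setP/(_ z) := yE; rewrite !inE.
    have [zF _|zF] := boolP (z \in F); last by rewrite orbF.
    by rewrite orbT (fintype.subsetP FG).
  rewrite GyF in robG.
  have fixyy := single_extra_repairs minF decF yF robG.
  have [_ _ single _] := enumZ.
  have /negP[] := np (lshift _ y); rewrite /perfect single cards1 eqxx /=.
  apply/eqP/setP => i; rewrite inE (cover_setE R decF enumZ) single.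
  apply/exists_inP; exists y; rewrite ?set11 //.
  by apply/exists_inP; exists y; rewrite ?set11.
have Z2 j : (#|Z j| <= 2)%N.
  by case: enumZ => _ small _ _; have /small[->|->] := codom_f Z j.
have cF3 : (#|(\bigcup_(j in J) Z j) :|: F| <= 3 * p)%N.
  apply: leq_trans cF' _; have : (\sum_(j in J) #|Z j| <= #|J| * 2)%N.
    by rewrite -sum_nat_const; apply: leq_sum.
  by lia.
apply: (@le_trans _ _ (3 * p%:R)); first by rewrite -natrM ler_nat.
apply: le_trans (harmonic_ge R p_gt0) _.
rewrite mulrC ler_pM2l ?(lt_le_trans _ H1) //.
by rewrite -natrD ler_nat addn2.
Qed.

Theorem theorem5 (R : realType) :
  exists (construct approximate : cmd) (time5 time3 : nat -> nat),
    ((fun n => (time5 n)%:R : R) =O_eventually (fun n => (n%:R : R) ^+ 5)) /\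
    ((fun n => (time3 n)%:R : R) =O_eventually (fun n => (n%:R : R) ^+ 3)) /\
    forall (n : nat) (A : 'M[bool]_n) (F : {set 'I_n})
      (ps cs : seq (walk 'I_n)) (p m : nat) (tau : 'I_p -> 'I_n)
      (Z : 'I_(n + 'C(n, 2)) -> {set 'I_n}),
      min_feasible R A F ->
      decomposes A m tau F ps cs ->
      enumerates_small_sets Z ->
      let V := cover_set R A m tau Z in
      let c := fun j => #|Z j| in
      (exists J, is_cover V J) ->
      (forall s, stores_system s m A tau Z ->
         exists t s', [/\ exec construct s t s', (t <= time5 n)%N
                        & stores_set_cover s' c V]) /\
      (forall s, stores_set_cover s c V ->
         exists t s' J',
           [/\ exec approximate s t s', (t <= time3 n)%N,
               stores_selection s' J', is_cover V J'
             & let F' := (\bigcup_(j in J') Z j) :|: F in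
               s_robust R A F' /\
               forall G, min_s_robust_containing R A F G ->
                 #|F'|%:R / #|G|%:R <= \sum_(1 <= k < p.+1) (k%:R : R)^-1]).
Proof.
exists construct, approximate, construct_time, approximate_time.
split; first exact: polynomial_bigO construct_time_leq.
split; first exact: polynomial_bigO approximate_time_leq.
move=> n A F ps cs p m tau Z minF decF enumZ V c coverable.
have tau_inj := tau_inj decF; have mp := leq_mp decF.
have VE j : V j = [set i | [exists d in Z j, exists x in Z j, repairs m A tau i d x]].
  by apply/setP => i; rewrite (cover_setE R decF enumZ) inE.
split=> s st.
  have [t [s' [ex tle [H1 H2 H3 H4]]]] := construct_spec st tau_inj mp.
  exists t, s'; split=> //; split=> // j i; by rewrite H4 VE.
have c12 j : c j = 1%N \/ c j = 2%N.
  by case: enumZ => _ small _ _; apply/small/codom_f.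
have pn : (p <= n)%N by have := leq_card _ tau_inj; rewrite !card_ord.
have Nn : (n + 'C(n, 2) <= n.+1 ^ 2)%N by have := bin2 n; nia.
have [t [s' [J [ex tle sJ gJ]]]] := approximate_spec c12 coverable st pn Nn.
have covJ : is_cover V J.
  case: gJ => [[j /andP[_ /eqP Vj] ->]|[]//].
  by rewrite /is_cover big_set1 Vj.
exists t, s', J; split=> //; split; first exact: (cover_robust minF decF enumZ covJ).
by move=> G; apply: (performance_ratio minF decF enumZ gJ).
Qed.
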